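(* Let $E$ be a Euclidean space and let $X\subset E$ be a connected submanifold of Clifford type. Then $X$ is a compact extrinsically symmetric space.
   Context: A Euclidean space $E$ is a finite-dimensional Euclidean affine space. Submanifolds of $E$ are embedded and carry the Riemannian metric induced from $E$. Clifford torus: for an integer $r\ge 0$ and positive reals $\rho_1,\dots,\rho_r$, the standard Clifford torus is $C_{\rho_1\cdots\rho_r}=\{z\in\mathbb{C}^r : |z_j|=\rho_j \text{ for all } j=1,\dots,r\}$, where $\mathbb{C}^r$ carries the inner product $\langle z,w\rangle=\mathrm{Re}\big(\sum_{j} z_j\overline{w_j}\big)$ (for $r=0$ it is the single point $\{0\}$). A submanifold of $E$ is a Clifford torus if it is the image of a standard Clifford torus in some $\mathbb{C}^r$ under an affine isometric (not necessarily surjective) map $\mathbb{C}^r\to E$. Clifford type: a submanifold $X\subset E$ is of Clifford type if every geodesic of $X$ lies in a totally geodesic submanifold $C$ of $X$ which is a Clifford torus in $E$. Extrinsically symmetric: a submanifold $X\subset E$ is called extrinsically symmetric if for every $p\in X$ one has $r_p(X)=X$, where $r_p:E\to E$ is the orthogonal reflection along the affine normal space $p+N_pX$ of $X$ at $p$, i.e. the affine isometry of $E$ fixing $p$ whose linear part is $+\mathrm{id}$ on $N_pX$ and $-\mathrm{id}$ on $T_pX$. *)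

(* Defs.v *)
From HB Require Import structures.
From mathcomp Require Import all_boot all_order all_algebra.
From mathcomp Require Import complex.
From mathcomp Require Import all_classical all_reals all_analysis.
Import numFieldNormedType.Exports.
Import Order.TTheory GRing.Theory Num.Theory.

Set Implicit Arguments.
Unset Strict Implicit.
Unset Printing Implicit Defensive.

Local Open Scope classical_set_scope.
Local Open Scope ring_scope.

(* A Euclidean space is modelled by 'rV[R]_n with the standard inner product
   [dot].  The library norm on 'rV[R]_n is the sup norm; it is used only through
   the topology and the differential calculus it induces, which are the usual
   ones. *)
Section Euclidean.
Variable R : realType.

Definition dot n (u v : 'rV[R]_n) : R := \sum_(i < n) u 0 i * v 0 i.

(* C^oo on the open set [U]: all iterated directional derivatives of [f] exist
   and are (Frechet) differentiable at every point of [U].  Only the values of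
   [f] on [U] matter, provided [U] is open. *)
Definition smooth (V W : normedModType R) (f : V -> W) (U : set V) : Prop :=
  forall (vs : seq V) (x : V), U x ->
    differentiable (foldr (fun v (g : V -> W) => fun y => 'D_v g y) f vs) x.

Definition diffeomorphism n (U V : set 'rV[R]_n) (phi : 'rV[R]_n -> 'rV[R]_n) :
    Prop :=
  exists psi : 'rV[R]_n -> 'rV[R]_n,
    [/\ smooth phi U, smooth psi V,
        (forall x, U x -> V (phi x) /\ psi (phi x) = x)
      & (forall y, V y -> U (psi y) /\ phi (psi y) = y)].

(* Embedded submanifold of dimension [d]: around each of its points, [X] is
   straightened to R^d x {0} by a diffeomorphism between open sets of R^n. *)
Definition submanifold_dim n (d : nat) (X : set 'rV[R]_n) : Prop :=
  (d <= n)%N /\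
  forall p, X p -> exists (U V : set 'rV[R]_n) (phi : 'rV[R]_n -> 'rV[R]_n),
    [/\ open U, open V, U p, diffeomorphism U V phi
      & forall x, U x ->
          (X x <-> forall i : 'I_n, (d <= i)%N -> phi x 0 i = 0)].

Definition submanifold n (X : set 'rV[R]_n) : Prop :=
  exists d, submanifold_dim d X.

(* Velocities at [p] of smooth curves in [X]. *)
Definition tangent_space n (X : set 'rV[R]_n) (p : 'rV[R]_n) : set 'rV[R]_n :=
  [set v | exists (e : R) (c : R -> 'rV[R]_n),
     [/\ 0 < e, smooth c [set t | - e < t < e],
         (forall t, - e < t < e -> X (c t)), c 0 = p
       & derive1 c 0 = v]].

Definition normal_space n (X : set 'rV[R]_n) (p : 'rV[R]_n) : set 'rV[R]_n :=
  [set w | forall v, tangent_space X p v -> dot v w = 0].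

(* The Levi-Civita covariant derivative of the induced metric along a curve is
   the tangential part of the derivative in R^n, so that c is a geodesic iff its
   acceleration is everywhere normal.  [I] is any nonempty open interval,
   bounded or not; constant curves are allowed. *)
Definition geodesic n (X : set 'rV[R]_n) (I : set R) (c : R -> 'rV[R]_n) :
    Prop :=
  [/\ open I, is_interval I, I !=set0, smooth c I
    & forall t, I t -> X (c t) /\ normal_space X (c t) (derive1n 2 c t)].

Definition totally_geodesic n (X C : set 'rV[R]_n) : Prop :=
  [/\ submanifold C, C `<=` X
    & forall (I : set R) (c : R -> 'rV[R]_n), geodesic C I c -> geodesic X I c].

Definition cdot r (z w : 'rV[R[i]]_r) : R :=
  complex.Re (\sum_(j < r) z 0 j * (w 0 j)^*%C).

Definition standard_clifford_torus r (rho : 'I_r -> R) : set 'rV[R[i]]_r :=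
  [set z | forall j, `|z 0 j| = (rho j)%:C%C].

(* [L] is the R-linear part, [a%:C *: z] being multiplication by the real
   scalar [a]. *)
Definition affine_isometric_map r n (f : 'rV[R[i]]_r -> 'rV[R]_n) : Prop :=
  exists (q : 'rV[R]_n) (L : 'rV[R[i]]_r -> 'rV[R]_n),
    [/\ (forall (a : R) z w, L (a%:C%C *: z + w) = a *: L z + L w),
        (forall z w, dot (L z) (L w) = cdot z w)
      & forall z, f z = q + L z].

Definition clifford_torus n (C : set 'rV[R]_n) : Prop :=
  exists (r : nat) (rho : 'I_r -> R) (f : 'rV[R[i]]_r -> 'rV[R]_n),
    [/\ (forall j, 0 < rho j), affine_isometric_map f
      & C = f @` standard_clifford_torus rho].

Definition clifford_type n (X : set 'rV[R]_n) : Prop :=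
  forall (I : set R) (c : R -> 'rV[R]_n), geodesic X I c ->
    exists C : set 'rV[R]_n,
      [/\ totally_geodesic X C, clifford_torus C & c @` I `<=` C].

(* [s] is the orthogonal reflection along p + N_p X.  When [X] is a submanifold
   and [p] a point of it, R^n = T_p X + N_p X, so [s] exists and is unique. *)
Definition normal_reflection n (X : set 'rV[R]_n) (p : 'rV[R]_n)
    (s : 'rV[R]_n -> 'rV[R]_n) : Prop :=
  exists L : {linear 'rV[R]_n -> 'rV[R]_n},
    [/\ (forall x, s x = p + L (x - p)),
        (forall u v, dot (L u) (L v) = dot u v),
        (forall w, normal_space X p w -> L w = w)
      & (forall v, tangent_space X p v -> L v = - v)].

Definition extrinsically_symmetric n (X : set 'rV[R]_n) : Prop :=
  forall p, X p ->
    exists s : 'rV[R]_n -> 'rV[R]_n, normal_reflection X p s /\ s @` X = X.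

End Euclidean.

(* Main.v *)
Require Import Defs.
From HB Require Import structures.
From mathcomp Require Import all_boot all_order all_algebra.
From mathcomp Require Import complex ring lra.
From mathcomp Require Import all_classical all_reals all_analysis.
Import numFieldNormedType.Exports.
Import Order.TTheory GRing.Theory Num.Theory.

(* Near each of its points X is the zero set of a submersion, so two nearby
   points of X are joined by a geodesic: one solves the boundary value problem
   for the geodesic equation by Picard iteration.  By the Clifford hypothesis a
   geodesic g of X extends to the whole line as a trigonometric curve in a torus
   C, and, C being totally geodesic, its radial vectors are normal to X.
   Consequently the reflection r at g(s) maps g(s + t) to g(s - t), and it fixes
   the centre of C.

   For p in X, the points near which r_p maps X into X form an open and closed
   subset of X: r_p maps a geodesic of X to a curve which is a geodesic of X near
   one point, and two trigonometric curves which agree near a point agree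
   everywhere.  Hence X is extrinsically symmetric; the reflections act
   transitively on X, so X, being locally closed, is closed.

   For boundedness, consider the linear space K of Killing fields z |-> z A + b
   spanned by the velocities at t = 0 of r_{g(t)} r_{g(0)}.  It contains no
   nonzero constant field, because trigonometric curves are bounded.  Hence
   tr(A A'^T) is definite on K, and for an orthonormal basis (A_i, b_i) of K the
   equation sum_i (z A_i + b_i) A_i^T = 0 is solvable and invariant under the
   reflections.  Each generator vanishes at the centre of its torus, which forces
   it to vanish at any solution o.  The velocities of the geodesics are values of
   generators, hence are orthogonal to the radii from o, and X lies in a sphere
   around o. *)

Set Implicit Arguments.
Unset Strict Implicit.
Unset Printing Implicit Defensive.

Local Open Scope classical_set_scope.
Local Open Scope ring_scope.

(* The library uses the name [normal_space] for the separation axiom. *)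
Local Notation normal_space := Defs.normal_space.

(** * Calculus *)

(** Joining nearby points by a boundary value problem, and not through the exponential map, avoids
    the inverse function theorem: the contraction carries both endpoints. The equation is posed in
    the ambient space, with an acceleration extended off [X] so that the defining functions of [X]
    are affine in time along every solution. Endpoints in [X] then keep the whole curve in [X].

    The obstacle to boundedness is that each geodesic brings its own torus, with its own centre and,
    a priori, unbounded radii. A common centre is produced from the symmetry instead. The equation
    for [o] is the normal equation for minimising the sum of the squared lengths of the fields
    [z A_i + b_i]. This makes it solvable, and it does not depend on the orthonormal basis, which
    makes its solution set invariant. *)

Section Derivatives.
Variable R : realType.
Implicit Types (V W Z : normedModType R).

Lemma is_derive_mxP V (m n : nat) (M : V -> 'M[R]_(m, n)) t v l :
  is_derive t v M l <-> forall i j, is_derive t v (fun x => M x i j) (l i j).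
Proof.
split=> [[dM lE] i j|dM].
  split; first by apply: (derivable_mxP _ _ _).1.
  by rewrite -lE derive_mx// mxE.
have dM' : derivable M t v by apply/derivable_mxP => i j; case: (dM i j).
split=> //; rewrite derive_mx//; apply/matrixP => i j; rewrite mxE.
by case: (dM i j).
Qed.

Lemma is_derive_diff V W (f : V -> W) x v :
  differentiable f x -> is_derive x v f ('d f x v).
Proof. by move=> df; rewrite -deriveE//; apply/derivableP/diff_derivable. Qed.

Lemma is_derive_chain V W (f : V -> W) (c : R -> V) (t : R) l :
  differentiable f (c t) -> is_derive t 1 c l ->
  is_derive t 1 (f \o c) ('d f (c t) l).
Proof.
move=> df [dc lE].
have dc' : differentiable c t by apply/derivable1_diffP.
have := is_derive_diff (1 : R) (differentiable_comp dc' df).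
by rewrite diff_comp//= -lE deriveE.
Qed.

Lemma is_derive_comp V W Z (f : V -> W) (g : W -> Z) x u :
  differentiable f x -> differentiable g (f x) ->
  is_derive x u (g \o f) ('D_('D_u f x) g (f x)).
Proof.
move=> df dg; have := is_derive_diff u (differentiable_comp df dg).
by rewrite diff_comp//= !deriveE.
Qed.

Lemma is_derive_mulmxr (m n p : nat) (c : R -> 'M[R]_(m, n)) (A : 'M[R]_(n, p))
    (t : R) l : is_derive t 1 c l -> is_derive t 1 (fun s => c s *m A) (l *m A).
Proof.
move=> /is_derive_mxP dc; apply/is_derive_mxP => i j.
rewrite (_ : (fun _ => _) = \sum_k (fun s => c s i k * A k j)); last first.
  by apply/funext => s; rewrite mxE fct_sumE.
rewrite mxE; apply: is_derive_sum => k.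
rewrite (_ : (fun _ => _) = A k j \*: (fun s => c s i k)); last first.
  by apply/funext => s /=; rewrite mulrC.
by rewrite mulrC; apply: is_deriveZ.
Qed.

Lemma is_derive_dot (n : nat) (c d : R -> 'rV[R]_n) (t : R) l l' :
  is_derive t 1 c l -> is_derive t 1 d l' ->
  is_derive t 1 (fun s => dot (c s) (d s)) (dot l (d t) + dot (c t) l').
Proof.
move=> /is_derive_mxP dc /is_derive_mxP dd.
rewrite (_ : (fun _ => _) = \sum_k ((fun s => c s 0 k) * (fun s => d s 0 k))); last first.
  by apply/funext => s; rewrite fct_sumE.
rewrite /dot -big_split/=; apply: is_derive_sum => k.
apply: (is_derive_eq (is_deriveM (dc 0 k) (dd 0 k))).
by rewrite addrC /GRing.scale/= [l 0 k * _]mulrC.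
Qed.

Lemma is_derive_continuous V (c : R -> V) (t : R) l :
  is_derive t 1 c l -> {for t, continuous c}.
Proof.
by case=> dc _; apply/differentiable_continuous/derivable1_diffP.
Qed.

Lemma is_derive_addf V W (f g : V -> W) x v f' g' :
  is_derive x v f f' -> is_derive x v g g' ->
  is_derive x v (fun y => f y + g y) (f' + g').
Proof. exact: is_deriveD. Qed.

Lemma is_derive_subf V W (f g : V -> W) x v f' g' :
  is_derive x v f f' -> is_derive x v g g' ->
  is_derive x v (fun y => f y - g y) (f' - g').
Proof. exact: is_deriveB. Qed.

Lemma is_derive_constf V W (a : W) (x v : V) : is_derive x v (fun _ => a) 0.
Proof. exact: is_derive_cst. Qed.

Lemma is_derive_idf (x : R) : is_derive x 1 (fun y : R => y) 1.
Proof. exact: is_derive_id. Qed.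

Lemma is_derive_mul V (f g : V -> R) x v f' g' :
  is_derive x v f f' -> is_derive x v g g' ->
  is_derive x v (fun y => f y * g y) (f' * g x + f x * g').
Proof.
move=> df dg; apply: (is_derive_eq (is_deriveM df dg)).
by rewrite addrC /GRing.scale/= [f' * _]mulrC.
Qed.

Lemma is_derive_cmul V (k : R) (f : V -> R) x v f' :
  is_derive x v f f' -> is_derive x v (fun y => k * f y) (k * f').
Proof. exact: is_deriveZ. Qed.

Lemma is_derive_scale (f : R -> R) (n : nat) (c : R -> 'rV[R]_n) (t : R) f' c' :
  is_derive t 1 f f' -> is_derive t 1 c c' ->
  is_derive t 1 (fun s => f s *: c s) (f' *: c t + f t *: c').
Proof.
move=> df /is_derive_mxP dc; apply/is_derive_mxP => i j.
rewrite (_ : (fun _ => _) = fun s => f s * c s i j); last first.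
  by apply/funext => s; rewrite mxE.
by rewrite !mxE; apply: is_derive_mul.
Qed.

Lemma is_derive_bigsum V W (I : finType) (f : I -> V -> W) x v f' :
  (forall i, is_derive x v (f i) (f' i)) ->
  is_derive x v (fun y => \sum_i f i y) (\sum_i f' i).
Proof.
move=> df; pose g (k : 'I_#|I|) := f (enum_val k).
rewrite (_ : (fun _ => _) = \sum_k g k); last first.
  apply/funext => y; rewrite fct_sumE; apply/esym.
  by rewrite /g (reindex (@enum_rank I)) ?enum_rank_bij//=; [apply: eq_bigr => i _;
    rewrite enum_rankK|exact/onW_bij/enum_rank_bij].
rewrite (_ : \sum_i f' i = \sum_(k < #|I|) f' (enum_val k)); last first.
  by apply/esym; rewrite (reindex (@enum_rank I)) /=; [apply: eq_bigr => i _;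
    rewrite enum_rankK|exact/onW_bij/enum_rank_bij].
by apply: is_derive_sum => k; exact: df.
Qed.

(** The endpoints come in either order, so that the value at any time can be compared with that at a
    base time. *)
Lemma MVT_itv (I : set R) (f df : R -> R) (a b : R) : is_interval I ->
  I a -> I b -> (forall x, I x -> is_derive x 1 f (df x)) ->
  exists c, [/\ I c, Num.min a b <= c <= Num.max a b
    & f b - f a = df c * (b - a)].
Proof.
move=> itvI; wlog ab : a b / a <= b => [hw Ia Ib fI|Ia Ib fI].
  case: (leP a b) => [ab|/ltW ba]; first by have := hw _ _ ab Ia Ib fI;
    rewrite min_l ?max_r.
  have [c [Ic cb fE]] := hw _ _ ba Ib Ia fI.
  exists c; split => //; first by move: cb; rewrite min_l// max_r.
  by rewrite -opprB fE -mulrN opprB.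
have sub x : x \in `[a, b] -> I x.
  by rewrite in_itv/= => abx; apply: itvI Ia Ib _ abx.
have [c cab fE] : exists2 c, c \in `[a, b] & f b - f a = df c * (b - a).
  apply: MVT_segment => // [x xab|].
    by apply/fI/sub; apply: subset_itv_oo_cc xab.
  by apply: derivable_within_continuous => x /sub/fI[].
exists c; split => //; first exact: sub.
by rewrite min_l// max_r.
Qed.

Lemma is_derive0_cst (I : set R) (f : R -> R) (a b : R) : is_interval I ->
  I a -> I b -> (forall x, I x -> is_derive x 1 f 0) -> f a = f b.
Proof.
move=> itvI Ia Ib fI; have [c [_ _ /eqP]] := MVT_itv itvI Ia Ib fI.
by rewrite mul0r subr_eq0 => /eqP.
Qed.

Lemma is_derive0_cst_rV (n : nat) (I : set R) (f : R -> 'rV[R]_n) (a b : R) :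
  is_interval I -> I a -> I b -> (forall x, I x -> is_derive x 1 f 0) ->
  f a = f b.
Proof.
move=> itvI Ia Ib fI; apply/rowP => j.
apply: (is_derive0_cst (f := fun t => f t 0 j) itvI Ia Ib) => x /fI/is_derive_mxP.
by move=> /(_ 0 j); rewrite mxE.
Qed.

Lemma open_oo (a b : R) : open [set t : R | a < t < b].
Proof.
rewrite (_ : mkset _ = [set t | t > a] `&` [set t | t < b]).
  by apply: openI; [exact: open_gt|exact: open_lt].
by apply/seteqP; split => t /= => [/andP[]|[-> ->]].
Qed.

Lemma is_interval_oo (a b : R) : is_interval [set t : R | a < t < b].
Proof.
move=> x y /= /andP[x1 x2] /andP[y1 y2] z /andP[xz zy].
by rewrite (lt_le_trans x1)// (le_lt_trans zy).
Qed.

(** On the real line ['D_v] is [v] times the derivative, so on [I] every iterated directional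
    derivative is a scalar multiple of a member of the sequence. *)
Lemma smooth_derive_seq W (I : set R) (c : nat -> R -> W) : open I ->
  (forall k t, I t -> is_derive t 1 (c k) (c k.+1 t)) -> smooth (c 0) I.
Proof.
move=> oI dc vs.
suff [a ha] : exists a : R, forall t, I t ->
    foldr (fun v (g : R -> W) => fun y => 'D_v g y) (c 0) vs t = a *: c (size vs) t.
  move=> t It; apply/derivable1_diffP.
  apply: (near_eq_derivable (f := a \*: c (size vs))).
    by near=> s; rewrite ha//; near: s; exact: open_nbhs_nbhs.
  by apply: derivableZ; case: (dc (size vs) _ It).
elim: vs => [|v vs [a ha]]; first by exists 1 => t _; rewrite scale1r.
exists (v * a) => t It /=.
rewrite (near_eq_derive (g := a \*: c (size vs))); last first.
  by near=> s; rewrite ha//; near: s; exact: open_nbhs_nbhs.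
have [dct dcE] := dc (size vs) _ It.
rewrite deriveZ; last exact/diff_derivable/derivable1_diffP.
have dd : differentiable (c (size vs)) t by apply/derivable1_diffP.
rewrite deriveE// (_ : v = v *: (1:R)); last by rewrite /GRing.scale/= mulr1.
rewrite linearZ/= -deriveE// dcE scalerA
  [GRing.scale v 1]mulr1 mulrC.
Unshelve. all: by end_near. Qed.

(** Reduces smoothness to finding a class of curves closed under differentiation, with no formula
    for higher derivatives. *)
Lemma smooth_class W (P : (R -> W) -> Prop) (I : set R) (c : R -> W) : open I ->
  (forall u, P u -> exists2 w, P w & forall t, I t -> is_derive t 1 u (w t)) ->
  P c -> smooth c I.
Proof.
move=> oI dP Pc.
have [D hD] : exists D : (R -> W) -> (R -> W), forall u, P u ->
    P (D u) /\ forall t, I t -> is_derive t 1 u (D u t).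
  have /choice[D hD] u : exists w, P u -> P w /\ forall t, I t -> is_derive t 1 u (w t).
    have [/dP[w Pw dw]|nP] := pselect (P u); first by exists w.
    by exists u.
  by exists D.
have Pk k : P (iter k D c) by elim: k => // k /hD[].
by apply: (@smooth_derive_seq _ I (fun k => iter k D c)) => // k t It;
  apply (hD _ (Pk k)).2.
Qed.

Lemma derive_derivable V (c : R -> V) (t : R) : derivable c t 1 ->
  is_derive t 1 c (derive1 c t).
Proof. by move=> dc; rewrite derive1E; exact: derivableP. Qed.

Lemma smooth_derive1 V (I : set R) (c : R -> V) : smooth c I ->
  forall k t, I t -> is_derive t 1 (derive1n k c) (derive1n k.+1 c t).
Proof.
move=> sc k t It; rewrite [derive1n k.+1 c]/=.
apply/derive_derivable/derivable1_diffP.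
have := sc (nseq k 1) t It; congr (differentiable _ _).
elim: k {sc} => //= k IH; rewrite IH; apply/funext => s.
by rewrite derive1E.
Qed.

Lemma near_derive V (c d : R -> V) (I : set R) (t : R) l : open I -> I t ->
  (forall s, I s -> c s = d s) -> is_derive t 1 c l -> is_derive t 1 d l.
Proof.
move=> oI It cd; apply: near_eq_is_derive.
by near=> s; apply: cd; near: s; exact: open_nbhs_nbhs.
Unshelve. all: by end_near. Qed.

Lemma is_derive_unique V W (c : V -> W) (t : V) v l l' :
  is_derive t v c l -> is_derive t v c l' -> l = l'.
Proof. by move=> [_ <-] [_ <-]. Qed.

Lemma antiderivative_oo (f : R -> R) (a b : R) : continuous f -> a < b ->
  exists F : R -> R, forall t, a < t < b -> is_derive t 1 F (f t).
Proof.
move=> cf ab; pose mu := @lebesgue_measure R.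
exists (fun x => \int[mu]_(t in `[a, x]) f t) => t /andP[at_ tb].
have fi : mu.-integrable `[a, b] (EFin \o f).
  by apply: continuous_compact_integrable;
    [exact: segment_compact|exact: continuous_subspaceT].
have [dF FE] := continuous_FTC1 tb fi at_ (cf t).
by rewrite -FE; exact: derive_derivable.
Qed.

End Derivatives.

(** * The boundary value problem for a quadratic acceleration *)

Section Clamp.
Variable R : realType.

(** Composing with [clamp] turns a map continuous on a compact interval into one continuous on the
    whole line. *)
Definition clamp (a b t : R) : R := Num.max a (Num.min b t).

Lemma clamp_continuous a b : continuous (clamp a b).
Proof.
move=> t; rewrite /clamp; apply: (@continuous_max _ _ (cst a) (fun t => Num.min b t)).
  exact: cst_continuous.
apply: (@continuous_min _ _ (cst b) id); [exact: cst_continuous|exact: cvg_id].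
Qed.

Lemma clamp_itv a b t : a <= b -> a <= clamp a b t <= b.
Proof. by move=> ab; rewrite /clamp le_max lexx ge_max ab ge_min lexx. Qed.

Lemma clamp_id a b t : a <= t <= b -> clamp a b t = t.
Proof. by move=> /andP[at_ tb]; rewrite /clamp min_r// max_r. Qed.

End Clamp.

(** * Double primitives with prescribed boundary values *)

Section Green.
Variable R : realType.

(** The interval is an open neighbourhood of [[-1, 2]], where the estimates are made and whose
    interior contains the boundary times 0 and 1. *)
Definition double_primitive (f G G1 : R -> R) := forall t : R, -2 < t < 3 ->
  is_derive t 1 G (G1 t) /\ is_derive t 1 G1 (f t).

(** The mean value theorem between 0 and 1 gives a zero of [G1] in [[0, 1]]. Every point of
    [[-1, 2]] is within 2 of that zero and of 0, whence the factors 2 and 4. *)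
Lemma double_primitive_bound (f G G1 : R -> R) (K : R) :
  double_primitive f G G1 -> G 0 = 0 -> G 1 = 0 ->
  (forall t, -1 <= t <= 2 -> `|f t| <= K) ->
  forall t, -1 <= t <= 2 -> `|G t| <= 4 * K /\ `|G1 t| <= 2 * K.
Proof.
move=> dG G0 G1_0 fK t tI.
have sub (s : R) : -1 <= s <= 2 -> -2 < s < 3.
  by move=> /andP[? ?]; apply/andP; split; lra.
pose I := [set t : R | -1 <= t <= 2].
have itvI : is_interval I.
  move=> x y /= /andP[x1 x2] /andP[y1 y2] z /andP[xz zy].
  by rewrite /I/= (le_trans x1)// (le_trans zy).
have dGI (s : R) : I s -> is_derive s 1 G (G1 s) by move=> /sub/dG[].
have dG1I (s : R) : I s -> is_derive s 1 G1 (f s) by move=> /sub/dG[].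
have I0 : I 0 by rewrite /I/=; apply/andP; split; lra.
have I1 : I 1 by rewrite /I/=; apply/andP; split; lra.
have [x [Ix]] := MVT_itv itvI I0 I1 dGI.
rewrite G0 G1_0 !subr0 mulr1 => x01 /esym G1x.
have G1b (s : R) : I s -> `|G1 s| <= 2 * K.
  move=> Is; have [y [Iy _]] := MVT_itv itvI Ix Is dG1I.
  rewrite G1x subr0 => ->; rewrite normrM mulrC ler_pM//; last exact: fK.
  move: x01 Is; rewrite min_l ?max_r// /I/= => /andP[? ?] /andP[? ?].
  by rewrite ler_norml; apply/andP; split; lra.
split; last exact: G1b.
have [y [Iy _]] := MVT_itv itvI I0 tI dGI.
rewrite G0 !subr0 => ->; rewrite normrM mulrC.
have -> : 4 * K = 2 * (2 * K) by ring.
rewrite ler_pM//; last exact: G1b.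
by move/andP: tI => [? ?]; rewrite ler_norml; apply/andP; split; lra.
Qed.

Lemma double_primitive_exists (f : R -> R) (x y : R) : continuous f ->
  exists G G1, [/\ double_primitive f G G1, G 0 = x & G 1 = y].
Proof.
move=> cf.
have [F dF] := antiderivative_oo (a := -4) (b := 5) cf ltac:(lra).
(* [F] is a primitive only on [(-4, 5)]; clamping makes it continuous everywhere and leaves it
   unchanged on [(-2, 3)]. *)
pose g t := F (clamp (-3) 4 t).
have cg : continuous g.
  move=> t; apply: (@continuous_comp _ _ _ (clamp (-3) 4) F).
    exact: clamp_continuous.
  have /andP[? ?] : -3 <= clamp (-3) 4 t <= 4 by apply: clamp_itv; lra.
  by have := dF (clamp (-3) 4 t) ltac:(apply/andP; split; lra);
    apply: is_derive_continuous.
have [H dH] := antiderivative_oo (a := -4) (b := 5) cg ltac:(lra).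
exists (fun t => H t - H 0 + x + (y - x - (H 1 - H 0)) * t).
exists (fun t => F t + (y - x - (H 1 - H 0))).
split; [|by ring|by ring].
move=> t /andP[t1 t2]; split; last first.
  rewrite -[X in is_derive _ _ _ X]addr0.
  exact: (is_derive_addf (dF t ltac:(apply/andP; split; lra)) (is_derive_constf _ _ _)).
have dHt : is_derive t 1 H (F t).
  rewrite -[t in F t](@clamp_id _ (-3) 4); last by apply/andP; split; lra.
  by apply: dH; apply/andP; split; lra.
set k := y - x - _.
have := is_derive_addf (is_derive_addf (is_derive_subf dHt
  (is_derive_constf (H 0) t 1)) (is_derive_constf x t 1))
  (is_derive_cmul k (is_derive_idf t)).
by rewrite subr0 addr0 mulr1.
Qed.

End Green.

(** * Uniform limits and vector-valued double primitives *)

Section Norm.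
Variable R : realType.

Lemma coord_le_norm (n : nat) (u : 'rV[R]_n) j : `|u 0 j| <= `|u|.
Proof.
rewrite [leRHS]/Num.Def.normr/= mx_normrE.
exact: (le_bigmax _ (fun ij : 'I_1 * 'I_n => `|u ij.1 ij.2|) (0, j)).
Qed.

Lemma norm_le_coord (n : nat) (u : 'rV[R]_n) K : 0 <= K ->
  (forall j, `|u 0 j| <= K) -> `|u| <= K.
Proof.
move=> K0 uK; rewrite [leLHS]/Num.Def.normr/= mx_normrE (bigmax_le _ K0)//= => -[i j] _.
by rewrite /= ord1.
Qed.

Lemma geometric_small (D e : R) : 0 < e -> exists k, D * 2^-1 ^+ k < e.
Proof.
move=> e0.
have h : D * 2^-1 ^+ k @[k --> \oo] --> (0 : R).
  by apply: cvg_geometric; rewrite ger0_norm ?invf_lt1// ltr1n.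
have /cvgrPdist_lt/(_ _ e0)[N _ hN] := h.
exists N; apply: le_lt_trans (ler_norm _) _.
by have := hN N (leqnn _); rewrite /= sub0r normrN.
Qed.

(** The tail of the geometric series gives the factor 2; the rate is uniform in [t], hence the limit
    is continuous. *)
Lemma geometric_limit (n : nat) (u : nat -> R -> 'rV[R]_n) (D : R) :
  (forall k, continuous (u k)) ->
  (forall k t, `|u k.+1 t - u k t| <= D * 2^-1 ^+ k) ->
  exists v : R -> 'rV[R]_n, continuous v /\
    forall k t, `|v t - u k t| <= 2 * D * 2^-1 ^+ k.
Proof.
move=> cu du.
have dist k m t : `|u (m + k)%N t - u k t| <= 2 * D * 2^-1 ^+ k - 2 * D * 2^-1 ^+ (m + k).
  elim: m => [|m IH]; first by rewrite add0n !subrr normr0.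
  rewrite -(subrKA (u (m + k)%N t)) (le_trans (ler_normD _ _))//.
  rewrite (le_trans (lerD (du _ _) IH))// addSn exprS; lra.
have D0 : 0 <= D by have := du 0%N 0; rewrite expr0 mulr1; apply: le_trans.
have dist' k m t : (k <= m)%N -> `|u m t - u k t| <= 2 * D * 2^-1 ^+ k.
  move=> km; have := dist k (m - k)%N t; rewrite subnK// => /le_trans; apply.
  by rewrite lerBlDr lerDl !mulr_ge0// exprn_ge0// invr_ge0.
have cvu t : cvg (u k t @[k --> \oo]).
  apply: cauchy_cvg; apply: cauchy_exP => e e0.
  have [k hk] := geometric_small (2 * D) e0.
  exists (u k t); exists k => // m /= km.
  rewrite -ball_normE /ball_/= distrC.
  exact: le_lt_trans (dist' _ _ _ km) hk.
exists (fun t => lim (u k t @[k --> \oo])).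
have lb k t : `|lim (u k t @[k --> \oo]) - u k t| <= 2 * D * 2^-1 ^+ k.
  apply/ler_addgt0Pr => e e0; have /cvgrPdist_lt/(_ _ e0)[N _ hN] := cvu t.
  have h1 := hN (maxn N k) (leq_maxl _ _).
  have h2 := dist' _ _ t (leq_maxr N k).
  rewrite -(subrKA (u (maxn N k) t)) (le_trans (ler_normD _ _))// addrC.
  by rewrite lerD// ltW.
split=> // t; apply/cvgrPdist_lt => e e0.
have [k hk] := geometric_small (2 * D) (divr_gt0 e0 (ltr0n R 3)).
near=> s.
have ust : `|u k t - u k s| < e / 3.
  by near: s; apply: cvgr_dist_lt; [exact: cu|rewrite divr_gt0].
have h1 := le_lt_trans (lb k t) hk; have h2 := le_lt_trans (lb k s) hk.
rewrite -(subrKA (u k t)) (le_lt_trans (ler_normD _ _))//.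
rewrite (_ : e = e / 3 + (e / 3 + e / 3)); last by field.
rewrite ltrD// -(subrKA (u k s)) (le_lt_trans (ler_normD _ _))//.
by rewrite ltrD// distrC.
Unshelve. all: by end_near. Qed.

Lemma double_primitive_exists_rV (n : nat) (f : R -> 'rV[R]_n) (x y : 'rV[R]_n) :
  continuous f -> exists G G1 : R -> 'rV[R]_n,
  [/\ forall t : R, -2 < t < 3 ->
    is_derive t 1 G (G1 t) /\ is_derive t 1 G1 (f t), G 0 = x & G 1 = y].
Proof.
move=> cf.
have cfj j : continuous (fun t => f t 0 j).
  move=> t; apply: (@continuous_comp _ _ _ f (fun u : 'rV_n => u 0 j)) (cf t) _.
  exact: coord_continuous.
have h j := double_primitive_exists (x 0 j) (y 0 j) (cfj j).
have /choice[G {}h] := h; have /choice[G1 {}h] := h.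
exists (fun t => \row_j G j t), (fun t => \row_j G1 j t).
split; last 2 first.
- by apply/rowP => j; rewrite mxE; case: (h j).
- by apply/rowP => j; rewrite mxE; case: (h j).
move=> t tI; split; apply/is_derive_mxP => i j; rewrite ord1.
- have [/(_ t tI)[d _] _ _] := h j; rewrite mxE.
  by rewrite (_ : (fun _ => _) = G j)//; apply/funext => s; rewrite mxE.
- have [/(_ t tI)[_ d] _ _] := h j.
  by rewrite (_ : (fun _ => _) = G1 j)//; apply/funext => s; rewrite mxE.
Qed.

Lemma double_primitive_bound_rV (n : nat) (f g G G1 H H1 : R -> 'rV[R]_n) (K : R) :
  (forall t : R, -2 < t < 3 -> is_derive t 1 G (G1 t) /\ is_derive t 1 G1 (f t)) ->
  (forall t : R, -2 < t < 3 -> is_derive t 1 H (H1 t) /\ is_derive t 1 H1 (g t)) ->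
  G 0 = H 0 -> G 1 = H 1 ->
  (forall t, -1 <= t <= 2 -> `|f t - g t| <= K) ->
  forall t, -1 <= t <= 2 -> `|G t - H t| <= 4 * K /\ `|G1 t - H1 t| <= 2 * K.
Proof.
move=> dG dH GH0 GH1 fg t tI.
have K0 : 0 <= K by apply: le_trans (fg t tI).
have h j : `|G t 0 j - H t 0 j| <= 4 * K /\ `|G1 t 0 j - H1 t 0 j| <= 2 * K.
  apply: (@double_primitive_bound _ (fun s => f s 0 j - g s 0 j)
    (fun s => G s 0 j - H s 0 j) (fun s => G1 s 0 j - H1 s 0 j) K _ _ _ _ t tI).
  - move=> s sI; have [/is_derive_mxP a /is_derive_mxP b] := dG s sI.
    have [/is_derive_mxP c /is_derive_mxP d] := dH s sI.
    by split; [exact: (is_derive_subf (a 0 j) (c 0 j))|exact: (is_derive_subf (b 0 j)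
      (d 0 j))].
  - by rewrite GH0 subrr.
  - by rewrite GH1 subrr.
  - move=> s sI; apply: le_trans (fg s sI).
    by have := coord_le_norm (f s - g s) j; rewrite !mxE.
split; apply: norm_le_coord; rewrite ?mulr_ge0// => j; rewrite !mxE; case: (h j) => //.
Qed.

End Norm.

(** * Picard iteration with two fixed endpoints *)

Section BoundaryValue.
Variable R : realType.
Variables (n : nat) (Q : 'rV[R]_n -> 'rV[R]_n -> 'rV[R]_n) (p : 'rV[R]_n).
Variables (r B s : R).
Hypothesis Qbound : forall x v, `|x - p| <= r -> `|v| <= s -> `|Q x v| <= B * s ^+ 2.
Hypothesis Qlip : forall x x' v v', `|x - p| <= r -> `|x' - p| <= r ->
  `|v| <= s -> `|v'| <= s ->
  `|Q x v - Q x' v'| <= B * s * (`|x - x'| + `|v - v'|).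
(** For a quadratic [Q] and velocities up to [s] the Lipschitz constant is of order [s]. A Picard
    step multiplies distances by at most [(4 + 2) * B * s], which [sB] bounds by 1/2. Endpoints
    within [s / 3] of [p] give a chord of speed at most [2 / 3 * s], leaving room for the correction
    due to [Q]. *)
Hypotheses (B0 : 0 <= B) (s0 : 0 < s) (sr : 2 * s <= r) (sB : 12 * (B * s) <= 1).
Variables (x y : 'rV[R]_n).
Hypotheses (xp : `|x - p| <= s / 3) (yp : `|y - p| <= s / 3).

Ltac slra := have ? := s0; have ? := sr; have ? := sB; have ? := xp;
  have ? := yp; lra.

Let curve := ((R -> 'rV[R]_n) * (R -> 'rV[R]_n))%type.
Let tau : R -> R := clamp (-1) 2.

Let tauP t : -1 <= tau t <= 2.
Proof. by apply: clamp_itv; slra. Qed.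

Let admissible (c : curve) :=
  [/\ continuous (c.1 \o tau), continuous (c.2 \o tau) &
    forall t : R, -1 <= t <= 2 -> `|c.1 t - p| <= r /\ `|c.2 t| <= s].

(** The velocity of the input is a separate component, not tied to the derivative of the position;
    the uniform limits of both can be taken before any differentiability of the limit is known. *)
Let picard_step (c d : curve) :=
  [/\ forall t : R, -2 < t < 3 -> is_derive t 1 d.1 (d.2 t) /\
        is_derive t 1 d.2 (Q (c.1 (tau t)) (c.2 (tau t))),
    d.1 0 = x & d.1 1 = y].

Let close (E : R) (c d : curve) := forall t : R, -1 <= t <= 2 ->
  `|c.1 t - d.1 t| + `|c.2 t - d.2 t| <= E.

Let picard_step_contract c c' d d' (E : R) : admissible c -> admissible c' ->
  picard_step c d -> picard_step c' d' -> close E c c' -> close (E / 2) d d'.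
Proof.
move=> [_ _ ac] [_ _ ac'] [dd d0 d1] [dd' d0' d1'] cc' t tI.
have [] := @double_primitive_bound_rV _ n _ _ _ _ _ _ (B * s * E) dd dd'
  (etrans d0 (esym d0')) (etrans d1 (esym d1')) _ _ tI.
  move=> u uI; have [? ?] := ac _ (tauP u); have [? ?] := ac' _ (tauP u).
  by apply: le_trans (Qlip _ _ _ _) _ => //; rewrite ler_wpM2l ?mulr_ge0 ?(ltW s0)// cc'.
have E0 : 0 <= E.
  by have := cc' t tI; apply: le_trans; rewrite addr_ge0.
have Bs12 : B * s <= 1 / 12 by slra.
have : B * s * E <= 1 / 12 * E by rewrite ler_wpM2r.
by move=> ? ? ?; slra.
Qed.

(** Serves twice: as the first iterate, and as the curve from which every Picard step differs by a
    function vanishing at 0 and 1, to which the double primitive bounds apply. *)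
Let line : curve := (fun t => x + t *: (y - x), fun _ => y - x).

Let line_derive (t : R) : is_derive t 1 line.1 (line.2 t) /\
  is_derive t 1 line.2 (0 : 'rV[R]_n).
Proof.
split; last exact: is_derive_constf.
have := is_derive_addf (is_derive_constf x t 1)
  (is_derive_scale (is_derive_idf t) (is_derive_constf (y - x) t 1)).
by rewrite add0r scale1r scaler0 addr0.
Qed.

Let line_bound t : -1 <= t <= 2 -> `|line.1 t - p| <= 5 / 3 * s /\
  `|line.2 t| <= 2 / 3 * s.
Proof.
move=> /andP[t1 t2].
have xy : `|y - x| <= 2 / 3 * s.
  by rewrite -(subrKA p) (le_trans (ler_normD _ _))// (distrC p); slra.
split=> //=; rewrite addrAC (le_trans (ler_normD _ _))// normrZ.
have : `|t| * `|y - x| <= 2 * (2 / 3 * s).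
  by rewrite ler_pM// ler_norml; apply/andP; split; slra.
slra.
Qed.

Let continuous_tau (f : R -> 'rV[R]_n) :
  (forall t : R, -1 <= t <= 2 -> {for t, continuous f}) -> continuous (f \o tau).
Proof.
move=> cf t; apply: continuous_comp; first exact: clamp_continuous.
exact/cf/tauP.
Qed.

Let picard_step_exists c : admissible c -> exists d, admissible d /\ picard_step c d.
Proof.
move=> [c1 c2 ac].
have cQ : continuous (fun t => Q (c.1 (tau t)) (c.2 (tau t))).
  move=> t; apply/cvgrPdist_lt => e e0.
  near=> u.
  have [? ?] := ac _ (tauP t); have [? ?] := ac _ (tauP u).
  apply: le_lt_trans (Qlip _ _ _ _) _ => //.
  have h1 : `|c.1 (tau t) - c.1 (tau u)| < e.
    by near: u; apply: cvgr_dist_lt => //; exact: c1.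
  have h2 : `|c.2 (tau t) - c.2 (tau u)| < e.
    by near: u; apply: cvgr_dist_lt => //; exact: c2.
  apply: (@le_lt_trans _ _ (1 / 12 * (2 * e))); last slra.
  by apply: ler_pM; rewrite ?mulr_ge0 ?addr_ge0 ?(ltW s0)//; slra.
have [G [G1 [dG G0 G1_]]] := double_primitive_exists_rV x y cQ.
exists (G, G1); split; last by split.
have sub (t : R) : -1 <= t <= 2 -> -2 < t < 3 by move=> /andP[? ?]; apply/andP;
  split; slra.
split.
- by apply: continuous_tau => t /sub/dG[/is_derive_continuous].
- by apply: continuous_tau => t /sub/dG[_ /is_derive_continuous].
move=> t tI.
have [] := @double_primitive_bound_rV _ n _ _ _ _ _ _ (B * s ^+ 2) dG
  (fun t _ => line_derive t) _ _ _ _ tI.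
- by rewrite G0/= scale0r addr0.
- by rewrite G1_/= scale1r subrKC.
- by move=> u uI; rewrite subr0; have [? ?] := ac _ (tauP u); exact: Qbound.
have [l1 l2] := line_bound tI.
have : B * s ^+ 2 <= 1 / 12 * s by rewrite expr2 mulrA ler_wpM2r ?(ltW s0)//; slra.
move=> Bs h1 h2; split => /=.
  by rewrite -(subrKA (line.1 t)) (le_trans (ler_normD _ _))//; slra.
by rewrite -[G1 t](subrK (line.2 t)) (le_trans (ler_normD _ _))//; slra.
Unshelve. all: by end_near. Qed.

Lemma boundary_value_solution : exists c c1 : R -> 'rV[R]_n,
  [/\ forall t : R, -1 < t < 2 -> is_derive t 1 c (c1 t) /\
        is_derive t 1 c1 (Q (c t) (c1 t)),
      c 0 = x, c 1 = y &
      forall t : R, -1 <= t <= 2 -> `|c t - p| <= r].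
Proof.
have [F hF] : exists F : curve -> curve, forall c, admissible c ->
    admissible (F c) /\ picard_step c (F c).
  have h c : exists d, admissible c -> admissible d /\ picard_step c d.
    have [/picard_step_exists[d hd]|nc] := pselect (admissible c); first by exists d.
    by exists c.
  by have [F hF] := choice h; exists F.
pose u k := iter k F line.
have line_adm : admissible line.
  split.
  - by apply: continuous_tau => t _; case: (line_derive t) => /is_derive_continuous.
  - by apply: continuous_tau => t _; case: (line_derive t) => _ /is_derive_continuous.
  - by move=> t /line_bound[? ?]; split; slra.
have adm k : admissible (u k) by elim: k => // k /hF[].
have step k : picard_step (u k) (u k.+1) by case: (hF _ (adm k)).
(* On [[-1, 2]] any two admissible curves are at distance at most [D]. *)
pose D := 2 * r + 2 * s.
have D0 : 0 <= D by rewrite /D; slra.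
have cl k : close (D * 2^-1 ^+ k) (u k.+1) (u k).
  elim: k => [|k IH]; last first.
    by rewrite exprS mulrCA mulrC; apply: (picard_step_contract (adm _) (adm _)).
  move=> t tI; have [_ _ /(_ t tI)[a b]] := adm 0%N; have [_ _ /(_ t tI)[a' b']] :=
    adm 1%N.
  rewrite expr0 mulr1 -(subrKA p) (distrC _ ((u 0%N).2 t)).
  have h1 := ler_normD ((u 1%N).1 t - p) (p - (u 0%N).1 t).
  have h2 := ler_normB ((u 0%N).2 t) ((u 1%N).2 t).
  by rewrite [`|p - _|]distrC in h1; rewrite /D; slra.
have [v [cv hv]] := @geometric_limit _ _ (fun k => (u k).1 \o tau) D
  (fun k => let: And3 a _ _ := adm k in a)
  (fun k t => le_trans (ler_wpDr (normr_ge0 _) (lexx _)) (cl k _ (tauP t))).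
have [v1 [cv1 hv1]] := @geometric_limit _ _ (fun k => (u k).2 \o tau) D
  (fun k => let: And3 _ a _ := adm k in a)
  (fun k t => le_trans (ler_wpDl (normr_ge0 _) (lexx _)) (cl k _ (tauP t))).
have tauE t : -1 <= t <= 2 -> tau t = t by exact: clamp_id.
have adm_v : admissible (v, v1).
  split=> [||t tI].
  - by apply: continuous_tau => t _; exact: cv.
  - by apply: continuous_tau => t _; exact: cv1.
  split; apply/ler_addgt0Pr => e e0; have [k hk] := geometric_small (2 * D) e0;
    have [_ _ /(_ t tI)[a b]] := adm k.
    rewrite -(subrKA ((u k).1 t)) (le_trans (ler_normD _ _))// addrC lerD//.
    by have := hv k t; rewrite /= tauE// => /le_trans; apply; exact: ltW.
  rewrite /= -[v1 t](subrK ((u k).2 t)) (le_trans (ler_normD _ _))//= addrC lerD//.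
  by have := hv1 k t; rewrite /= tauE// => /le_trans; apply; exact: ltW.
have [adm_d step_d] := hF _ adm_v.
have clv k : close (4 * D * 2^-1 ^+ k) (v, v1) (u k).
  move=> t tI; have := hv k t; have := hv1 k t; rewrite /= tauE//.
  by move=> ? ?; slra.
have cld k := picard_step_contract adm_v (adm k) step_d (step k) (clv k).
(* The limit is a fixed point of [F] on [[-1, 2]]. The solution returned is [F (v, v1)] and not
   [(v, v1)], since the former is differentiable by construction. *)
have dv t : -1 <= t <= 2 -> (F (v, v1)).1 t = v t /\ (F (v, v1)).2 t = v1 t.
  move=> tI.
  have small e : 0 < e -> `|(F (v, v1)).1 t - v t| + `|(F (v, v1)).2 t - v1 t| <= e.
    move=> e0; have [k hk] := geometric_small (4 * D) e0.
    have := cld k t tI; have := clv k.+1 t tI; rewrite exprS /=.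
    have h1 := ler_normD ((F (v, v1)).1 t - (u k.+1).1 t) ((u k.+1).1 t - v t).
    have h2 := ler_normD ((F (v, v1)).2 t - (u k.+1).2 t) ((u k.+1).2 t - v1 t).
    rewrite subrKA (distrC ((u k.+1).1 t)) in h1;
      rewrite subrKA (distrC ((u k.+1).2 t)) in h2.
    rewrite -/(u k) /= in h1 h2 *.
    by move=> ? ?; slra.
  have : `|(F (v, v1)).1 t - v t| + `|(F (v, v1)).2 t - v1 t| <= 0.
    by apply/ler_addgt0Pr => e e0; rewrite add0r; exact: small.
  move=> h; have ge1 := normr_ge0 ((F (v, v1)).1 t - v t).
  have ge2 := normr_ge0 ((F (v, v1)).2 t - v1 t).
  by split; apply/eqP; rewrite -subr_eq0 -normr_eq0; apply/eqP; slra.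
have [dd d0 d1] := step_d.
exists (F (v, v1)).1, (F (v, v1)).2; split => //.
- move=> t /andP[t1 t2].
  have tI : -1 <= t <= 2 by rewrite !ltW.
  have [|a b] := dd t; first by apply/andP; split; slra.
  by split => //; have [-> ->] := dv t tI; rewrite /= tauE in b.
- by move=> t tI; have [_ _ /(_ t tI)[]] := adm_d.
Qed.

End BoundaryValue.

(** * Rational functions of the derivatives of a chart *)

Section SmoothClass.
Variable R : realType.
Variables (n : nat) (U : set 'rV[R]_n) (phi : 'rV[R]_n -> 'rV[R]_n).
Hypotheses (oU : open U) (sphi : smooth phi U).

Definition iter_derive (vs : seq 'rV[R]_n) : 'rV[R]_n -> 'rV[R]_n :=
  foldr (fun v (g : 'rV[R]_n -> 'rV[R]_n) => fun y => 'D_v g y) phi vs.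

(* This class is stable under directional derivatives, hence consists of
   functions smooth on [U]. *)
Inductive rational_in_derivatives : ('rV[R]_n -> R) -> Prop :=
| rid_derive vs j : rational_in_derivatives (fun x => iter_derive vs x 0 j)
| rid_coord j : rational_in_derivatives (fun x => x 0 j)
| rid_cst a : rational_in_derivatives (fun _ => a)
| rid_add f g : rational_in_derivatives f -> rational_in_derivatives g ->
    rational_in_derivatives (fun x => f x + g x)
| rid_mul f g : rational_in_derivatives f -> rational_in_derivatives g ->
    rational_in_derivatives (fun x => f x * g x)
| rid_inv f : rational_in_derivatives f -> (forall x, U x -> f x != 0) ->
    rational_in_derivatives (fun x => (f x)^-1).

Local Notation rid := rational_in_derivatives.

Lemma rid_sum (I : Type) (s : seq I) (P : pred I) (f : I -> 'rV[R]_n -> R) :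
  (forall i, rid (f i)) -> rid (fun x => \sum_(i <- s | P i) f i x).
Proof.
move=> hf; elim: s => [|i s IH].
  by under eq_fun do rewrite big_nil; exact: rid_cst.
case Pi : (P i); under eq_fun do rewrite big_cons Pi; last exact: IH.
by apply: rid_add.
Qed.

Lemma rid_prod (I : Type) (s : seq I) (P : pred I) (f : I -> 'rV[R]_n -> R) :
  (forall i, rid (f i)) -> rid (fun x => \prod_(i <- s | P i) f i x).
Proof.
move=> hf; elim: s => [|i s IH].
  by under eq_fun do rewrite big_nil; exact: rid_cst.
case Pi : (P i); under eq_fun do rewrite big_cons Pi; last exact: IH.
by apply: rid_mul.
Qed.

Lemma rid_mulmx (m k l : nat) (A : 'rV[R]_n -> 'M[R]_(m, k)) (B :
  'rV[R]_n -> 'M[R]_(k, l)) :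
  (forall i j, rid (fun x => A x i j)) -> (forall i j, rid (fun x => B x i j)) ->
  forall i j, rid (fun x => (A x *m B x) i j).
Proof.
move=> hA hB i j; under eq_fun do rewrite mxE.
by apply: rid_sum => h; exact: rid_mul.
Qed.

Lemma rid_det (m : nat) (A : 'rV[R]_n -> 'M[R]_m) :
  (forall i j, rid (fun x => A x i j)) -> rid (fun x => \det (A x)).
Proof.
move=> hA; apply: rid_sum => s; apply: rid_mul; first exact: rid_cst.
exact: rid_prod.
Qed.

Lemma rid_adj (m : nat) (A : 'rV[R]_n -> 'M[R]_m) :
  (forall i j, rid (fun x => A x i j)) ->
  forall i j, rid (fun x => (\adj (A x)) i j).
Proof.
move=> hA i j; under eq_fun do rewrite mxE.
apply: rid_mul; first exact: rid_cst.
apply: rid_det => k l; under eq_fun do rewrite !mxE.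
exact: hA.
Qed.

Lemma rid_differentiable f x : rid f -> U x -> differentiable f x.
Proof.
move=> hf; elim: hf x => [vs j|j|a|{}f g _ IHf _ IHg|{}f g _ IHf _ IHg|{}f _ IHf f0] x Ux.
- apply: (@differentiable_comp _ _ _ _ (iter_derive vs) (fun u : 'rV[R]_n => u 0 j)).
    exact: sphi.
  exact: differentiable_coord.
- exact: differentiable_coord.
- exact: differentiable_cst.
- by apply: differentiableD; [exact: IHf|exact: IHg].
- by apply: differentiableM; [exact: IHf|exact: IHg].
- by apply: differentiableV; [exact: IHf|exact: f0].
Qed.

Lemma rid_derivative f e : rid f ->
  exists2 g, rid g & forall x, U x -> is_derive x e f (g x).
Proof.
elim=> [vs j|j|a|{}f g hf [df hdf IHf] hg [dg hdg IHg]|{}f g hf [df hdf IHf] hg [dg hdg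
  IHg]|{}f hf [df hdf IHf] f0].
- exists (fun x => iter_derive (e :: vs) x 0 j); first exact: rid_derive.
  move=> x Ux; have := is_derive_diff e (sphi vs Ux).
  by rewrite -deriveE; [move/is_derive_mxP|exact: sphi].
- exists (fun=> e 0 j) => [|x _]; first exact: rid_cst.
  by have /is_derive_mxP/(_ 0 j) := is_derive_id x e.
- by exists (fun=> 0) => [|x _]; [exact: rid_cst|exact: is_derive_constf].
- exists (fun x => df x + dg x) => [|x Ux]; first exact: rid_add.
  by apply: is_derive_addf; [exact: IHf|exact: IHg].
- exists (fun x => df x * g x + f x * dg x) => [|x Ux].
    by apply: rid_add; exact: rid_mul.
  by apply: is_derive_mul; [exact: IHf|exact: IHg].
- exists (fun x => -1 * (((f x)^-1 * (f x)^-1) * df x)) => [|x Ux].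
    apply: rid_mul; first exact: rid_cst.
    by apply: rid_mul => //; apply: rid_mul; exact: rid_inv.
  have [dfx dfE] := IHf x Ux.
  split; first by apply: derivableV => //; exact: f0.
  rewrite deriveV ?f0// dfE mulN1r /GRing.scale/= mulNr.
  by rewrite -exprVn expr2.
Qed.

Lemma diff_coord_sum (f : 'rV[R]_n -> R) x v : differentiable f x ->
  'd f x v = \sum_j v 0 j * 'd f x (delta_mx 0 j).
Proof.
move=> df; rewrite [in LHS](row_sum_delta v) linear_sum/=.
by apply: eq_bigr => j _; rewrite linearZ.
Qed.

Lemma rid_locally_bounded f p : rid f -> U p ->
  exists2 r, 0 < r & exists2 K, 0 <= K &
    forall x, `|x - p| <= r -> U x /\ `|f x| <= K.
Proof.
move=> hf Up.
have cf : {for p, continuous f}.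
  by apply: differentiable_continuous; exact: rid_differentiable.
have h : \forall x \near p, U x /\ `|f p - f x| < 1.
  near=> x; split; first by near: x; exact: open_nbhs_nbhs.
  by near: x; apply: cvgr_dist_lt.
have [e /= e0 he] := (nbhs_ballP _ _).1 h.
exists (e / 2); rewrite ?divr_gt0//; exists (`|f p| + 1); rewrite ?addr_ge0// => x xp.
have [|Ux fx] := he x.
  by rewrite -ball_normE /ball_/= distrC (le_lt_trans xp)// ltr_pdivrMr// ltr_pMr// ltr1n.
split=> //; rewrite -[f x](subrK (f p)) (le_trans (ler_normD _ _))//.
by rewrite addrC lerD2l distrC ltW.
Unshelve. all: by end_near. Qed.

(** Mean value theorem on the segment from [y] to [x]; the partial derivatives are again in the
    class, hence locally bounded. *)
Lemma rid_locally_lipschitz f p : rid f -> U p ->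
  exists2 r, 0 < r & exists2 K, 0 <= K &
    forall x y, `|x - p| <= r -> `|y - p| <= r ->
      `|f x| <= K /\ `|f x - f y| <= K * `|x - y|.
Proof.
move=> hf Up.
have [r0 r0_gt0 [K0 K0_ge0 hK0]] := rid_locally_bounded hf Up.
have /choice[r hr] (j : 'I_n) : exists r, 0 < r /\ exists2 K, 0 <= K &
    forall x, `|x - p| <= r -> U x /\ `|'d f x (delta_mx 0 j)| <= K.
  have [g hg dg] := rid_derivative (delta_mx 0 j) hf.
  have [r r_gt0 [K K_ge0 hK]] := rid_locally_bounded hg Up.
  exists r; split=> //; exists K => // x /hK[Ux gx]; split=> //.
  have [_ gE] := dg x Ux.
  by rewrite -deriveE ?gE//; exact: rid_differentiable.
have /choice[K hK] (j : 'I_n) : exists K, 0 <= K /\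
    forall x, `|x - p| <= r j -> U x /\ `|'d f x (delta_mx 0 j)| <= K.
  by have [_ [K ? ?]] := hr j; exists K.
pose rr := \big[Num.min/r0]_j r j.
have rr0 : 0 < rr.
  by rewrite /rr; elim/big_ind: _ => // [a b a0 b0|j _]; [rewrite lt_min a0|case: (hr j)].
have rr_le0 : rr <= r0 by exact: bigmin_le_id.
have rr_le j : rr <= r j by exact: bigmin_le_cond.
pose KK := K0 + \sum_j K j.
have sK : 0 <= \sum_j K j by apply: sumr_ge0 => j _; case: (hK j).
exists rr => //; exists KK; first by rewrite addr_ge0.
move=> x y xp yp; split.
  have [_ h] := hK0 x (le_trans xp rr_le0).
  by rewrite (le_trans h)// lerDl.
pose l t := y + t *: (x - y).
have lp (t : R) : 0 <= t <= 1 -> `|l t - p| <= rr.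
  move=> /andP[t0 t1].
  have -> : l t - p = t *: (x - p) + (1 - t) *: (y - p).
    rewrite /l scalerBl scale1r !scalerBr; apply/rowP => j; rewrite !mxE; ring.
  rewrite (le_trans (ler_normD _ _))// !normrZ !ger0_norm ?subr_ge0//.
  have h1 := ler_wpM2l t0 xp; have h2 :
    (1 - t) * `|y - p| <= (1 - t) * rr by rewrite ler_wpM2l// subr_ge0.
  by move: (`|x - p|) (`|y - p|) h1 h2 => a b h1 h2; nra.
have dl (t : R) : is_derive t 1 l (x - y).
  have := is_derive_addf (is_derive_constf y t 1)
    (is_derive_scale (is_derive_idf t) (is_derive_constf (x - y) t 1)).
  by rewrite add0r scale1r scaler0 addr0.
have dfl (t : R) : 0 <= t <= 1 -> is_derive t 1 (f \o l) ('d f (l t) (x - y)).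
  move=> t01; apply: is_derive_chain => //; apply: rid_differentiable => //.
  by have [] := hK0 _ (le_trans (lp t t01) rr_le0).
have itv01 : is_interval [set t : R | 0 <= t <= 1].
  move=> a b /= /andP[a0 a1] /andP[b0 b1] z /andP[az zb].
  by rewrite (le_trans a0)// (le_trans zb).
have [||t [/= t01 _]] := MVT_itv itv01 _ _ dfl (a := 0) (b := 1).
- by rewrite /= lexx ler01.
- by rewrite /= lexx ler01.
rewrite /= /l scale0r addr0 scale1r subrKC subr0 mulr1 => ->.
have Ul : U (l t) by have [] := hK0 _ (le_trans (lp t t01) rr_le0).
rewrite diff_coord_sum; last exact: rid_differentiable.
rewrite (le_trans (ler_norm_sum _ _ _))// /KK mulrDl ler_wpDl ?mulr_ge0//.
rewrite mulr_suml ler_sum// => j _; rewrite normrM mulrC ler_pM//.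
  by have [_ /(_ (l t) (le_trans (lp t t01) (rr_le j)))[]] := hK j.
exact: coord_le_norm.
Qed.

End SmoothClass.

(** * Tangent and normal spaces *)

Section Dot.
Variable R : realType.
Variable n : nat.
Implicit Types (u v w : 'rV[R]_n) (A : 'M[R]_n).

Lemma dotE u v : dot u v = (u *m v^T) 0 0.
Proof. by rewrite mxE; apply: eq_bigr => i _; rewrite mxE. Qed.

Lemma dotC u v : dot u v = dot v u.
Proof. by apply: eq_bigr => i _; rewrite mulrC. Qed.

Lemma dotDl u v w : dot (u + v) w = dot u w + dot v w.
Proof. by rewrite !dotE mulmxDl mxE. Qed.

Lemma dotZl a u w : dot (a *: u) w = a * dot u w.
Proof. by rewrite !dotE -scalemxAl mxE. Qed.

Lemma dotNl u w : dot (- u) w = - dot u w.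
Proof. by rewrite -scaleN1r dotZl mulN1r. Qed.

Lemma dotDr u v w : dot w (u + v) = dot w u + dot w v.
Proof. by rewrite dotC dotDl !(dotC w). Qed.

Lemma dotZr a u w : dot w (a *: u) = a * dot w u.
Proof. by rewrite dotC dotZl (dotC w). Qed.

Lemma dotNr u w : dot w (- u) = - dot w u.
Proof. by rewrite dotC dotNl (dotC w). Qed.

Lemma dotBr u v w : dot w (u - v) = dot w u - dot w v.
Proof. by rewrite dotDr dotNr. Qed.

Lemma dot0l w : dot 0 w = 0.
Proof. by rewrite -(scale0r 0) dotZl mul0r. Qed.

Lemma dot0r w : dot w 0 = 0.
Proof. by rewrite dotC dot0l. Qed.

Lemma dot_suml (I : Type) (s : seq I) (P : pred I) (f : I -> 'rV[R]_n) w :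
  dot (\sum_(i <- s | P i) f i) w = \sum_(i <- s | P i) dot (f i) w.
Proof.
by apply: (big_morph (fun u => dot u w)) => [u v|]; rewrite ?dotDl ?dot0l.
Qed.

Lemma dot_ge0 u : 0 <= dot u u.
Proof. by apply: sumr_ge0 => i _; rewrite -expr2 sqr_ge0. Qed.

Lemma dot_eq0 u : dot u u = 0 -> u = 0.
Proof.
move=> /eqP; rewrite psumr_eq0 => [/allP h|i _]; last by rewrite -expr2 sqr_ge0.
apply/rowP => i; rewrite mxE; have := h i (mem_index_enum _).
by rewrite /= -expr2 sqrf_eq0 => /eqP.
Qed.

Lemma dot_mulmxl u v A : dot (u *m A) v = dot u (v *m A^T).
Proof. by rewrite !dotE trmx_mul trmxK mulmxA. Qed.

Lemma unitmx_inj A : (forall u, u *m A = 0 -> u = 0) -> A \in unitmx.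
Proof.
move=> h; rewrite -row_free_unit -kermx_eq0; apply/rowV0P => v /sub_kermxP.
exact: h.
Qed.

End Dot.

(** * Tangent space, normal projector and geodesic acceleration in a chart *)

Section Chart.
Variable R : realType.
Variables (n d : nat) (X U V : set 'rV[R]_n) (phi psi : 'rV[R]_n -> 'rV[R]_n).
Hypotheses (oU : open U) (oV : open V) (sphi : smooth phi U) (spsi : smooth psi V).
Hypothesis phiK : forall x, U x -> V (phi x) /\ psi (phi x) = x.
Hypothesis psiK : forall y, V y -> U (psi y) /\ phi (psi y) = y.
Hypothesis XU : forall x, U x ->
  (X x <-> forall i : 'I_n, (d <= i)%N -> phi x 0 i = 0).

Local Notation e_ i := (delta_mx 0 i : 'rV[R]_n).
Local Notation rid := (rational_in_derivatives U phi).

Definition jac x : 'M[R]_n := \matrix_(i, j) (iter_derive phi [:: e_ i] x) 0 j.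
Definition vmask : 'M[R]_n := diag_mx (\row_(i < n) (d <= i)%:R).
(** Gram matrix of the gradients of the defining functions, the coordinates of [phi] of index at
    least [d], completed by the identity in the other coordinates so as to be invertible of size
    [n]. *)
Definition gram x := vmask *m (jac x)^T *m jac x *m vmask + (1%:M - vmask).
(** Written with the adjugate, and not with [invmx], so that the entries are visibly rational in the
    derivatives of [phi]. *)
Definition gram_inv x := (\det (gram x))^-1 *: \adj (gram x).
(** The pseudo-inverse of [jac x *m vmask]. On [U] its rows span the gradients of the defining
    functions, which at points of [X] is the normal space. *)
Definition conormal x := vmask *m gram_inv x *m vmask *m (jac x)^T.
Definition nproj x := jac x *m conormal x.
Definition hess x (v : 'rV[R]_n) : 'rV[R]_n :=
  \sum_i \sum_k (v 0 i * v 0 k) *: iter_derive phi [:: e_ k; e_ i] x.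
(** The acceleration in the span of the gradients for which the defining functions have zero second
    derivative along the curve. On [X] this is the geodesic equation, and it makes sense on all of
    [U]. *)
Definition accel x v := - hess x v *m conormal x.

Lemma mask_mul (u : 'rV[R]_n) : u *m vmask = 0 <-> forall i :
  'I_n, (d <= i)%N -> u 0 i = 0.
Proof.
split=> [h i di|h].
  by move/rowP: h => /(_ i); rewrite mul_mx_diag !mxE di mulr1.
apply/rowP => i; rewrite mul_mx_diag !mxE; case: leqP => [/h->|];
  by rewrite ?mul0r ?mulr0.
Qed.

Lemma mask_idem : vmask *m vmask = vmask.
Proof.
rewrite /vmask mulmx_diag; congr diag_mx; apply/rowP => i; rewrite !mxE.
by case: leqP; rewrite ?mulr1 ?mulr0.
Qed.

Lemma mask_tr : vmask^T = vmask.
Proof. exact: tr_diag_mx. Qed.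

Lemma deriv_phi x u : U x -> 'D_u phi x = u *m jac x.
Proof.
move=> Ux; have dphi : differentiable phi x by exact: (sphi [::]).
rewrite deriveE// [in LHS](row_sum_delta u) linear_sum/=.
apply/rowP => j; rewrite summxE !mxE; apply: eq_bigr => i _.
by rewrite linearZ/= !mxE -deriveE.
Qed.

Lemma derive_psi_phi x u : U x -> 'D_(u *m jac x) psi (phi x) = u.
Proof.
move=> Ux.
have dphi : differentiable phi x by exact: (sphi [::]).
have dpsi : differentiable psi (phi x) by apply: (spsi [::]); case: (phiK Ux).
have h1 : is_derive x u (psi \o phi) ('D_('D_u phi x) psi (phi x)).
  exact: is_derive_comp.
have h2 : is_derive x u (psi \o phi) u.
  apply: near_eq_is_derive (is_derive_id x u).
  by near=> y; rewrite /= (phiK _).2//; near: y; exact: open_nbhs_nbhs.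
by rewrite -deriv_phi//; exact: is_derive_unique h1 h2.
Unshelve. all: by end_near. Qed.

Lemma jac_unit x : U x -> jac x \in unitmx.
Proof.
move=> Ux; apply: unitmx_inj => u uJ.
rewrite -(derive_psi_phi u Ux) uJ.
exact: derive0.
Qed.

Lemma gram_tr x : (gram x)^T = gram x.
Proof.
by rewrite /gram linearD linearB/= !trmx_mul trmxK mask_tr trmx1 !mulmxA.
Qed.

(** [dot (u *m gram x) u] is a sum of two squared lengths, whose vanishing kills both parts of
    [u]. *)
Lemma gram_unit x : U x -> gram x \in unitmx.
Proof.
move=> Ux; apply: unitmx_inj => u uM.
have cmask : (1%:M - vmask) *m (1%:M - vmask) = 1%:M - vmask.
  by rewrite mulmxBl !mulmxBr !mul1mx mulmx1 mask_idem subrr subr0.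
have cmaskT : (1%:M - vmask)^T = 1%:M - vmask by rewrite linearB/= trmx1 mask_tr.
have : dot (u *m gram x) u = 0 by rewrite uM dot0l.
rewrite /gram mulmxDr dotDl.
have -> : dot (u *m (vmask *m (jac x)^T *m jac x *m vmask)) u =
    dot (u *m vmask *m (jac x)^T) (u *m vmask *m (jac x)^T).
  by rewrite !mulmxA dot_mulmxl mask_tr dot_mulmxl.
have -> : dot (u *m (1%:M - vmask)) u = dot (u *m (1%:M - vmask)) (u *m (1%:M - vmask)).
  by rewrite -{1}cmask mulmxA dot_mulmxl cmaskT.
move=> h; have /dot_eq0 h1 : dot (u *m vmask *m (jac x)^T) (u *m vmask *m (jac x)^T) = 0.
  by apply/eqP; rewrite eq_le dot_ge0 -h lerDl dot_ge0.
have /dot_eq0 h2 : dot (u *m (1%:M - vmask)) (u *m (1%:M - vmask)) = 0.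
  by apply/eqP; rewrite eq_le dot_ge0 -h lerDr dot_ge0.
have : u *m vmask = 0.
  rewrite -[_ *m _](mulmxK (_ : (jac x)^T \in unitmx)) ?h1 ?mul0mx//.
  by rewrite unitmx_tr jac_unit.
by move: h2; rewrite mulmxBr mulmx1 => /eqP; rewrite subr_eq0 => /eqP <-.
Qed.

Lemma gram_invE x : U x -> gram_inv x = invmx (gram x).
Proof. by move=> Ux; rewrite /gram_inv /invmx gram_unit. Qed.

Lemma conormal_jac x : U x -> conormal x *m jac x *m vmask = vmask.
Proof.
move=> Ux; have e : vmask *m (jac x)^T *m jac x *m vmask = gram x *m vmask.
  rewrite /gram mulmxDl mulmxBl mul1mx mask_idem subrr addr0.
  by rewrite -[RHS]mulmxA mask_idem.
have -> : conormal x *m jac x *m vmask =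
    vmask *m gram_inv x *m (vmask *m (jac x)^T *m jac x *m vmask).
  by rewrite /conormal !mulmxA.
by rewrite e gram_invE// mulmxA mulmxKV ?gram_unit// mask_idem.
Qed.

Lemma conormal_jac_conormal x : U x -> conormal x *m jac x *m conormal x = conormal x.
Proof.
move=> Ux; rewrite {2}/conormal !mulmxA conormal_jac//.
Qed.

Lemma nproj_idem x : U x -> nproj x *m nproj x = nproj x.
Proof.
move=> Ux; rewrite /nproj mulmxA -(mulmxA (jac x)) -(mulmxA (jac x)).
by rewrite conormal_jac_conormal.
Qed.

Lemma nproj_tr x : U x -> (nproj x)^T = nproj x.
Proof.
move=> Ux; rewrite /nproj /conormal !trmx_mul trmxK mask_tr gram_invE// trmx_inv.
by rewrite gram_tr !mulmxA.
Qed.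

Lemma nproj_jac x : U x -> nproj x *m jac x *m vmask = jac x *m vmask.
Proof. move=> Ux; rewrite /nproj -(mulmxA (jac x)) -(mulmxA (jac x)).
by rewrite conormal_jac. Qed.

Lemma nproj_rank x : U x -> \rank (nproj x) = \rank vmask.
Proof.
move=> Ux; apply/eqP; rewrite eqn_leq; apply/andP; split.
  rewrite /nproj (leq_trans (mxrankM_maxr _ _))// /conormal -!mulmxA.
  exact: mxrankM_maxl.
have <- : \rank (jac x *m vmask) = \rank vmask.
  have fJ : row_full (jac x) by rewrite row_full_unit jac_unit.
  by rewrite (eqmxMfull vmask fJ).
by rewrite -nproj_jac// -mulmxA mxrankM_maxl.
Qed.

(** The curve is the image under [psi] of the straight line through [phi x] with direction
    [v *m jac x], which stays in the slice. *)
Lemma straight_curve_tangent x v : X x -> U x -> v *m jac x *m vmask = 0 ->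
  tangent_space X x v.
Proof.
move=> Xx Ux vJ; pose w := v *m jac x; pose a := phi x.
have [Va psia] := phiK Ux.
pose l (t : R) := a + t *: w.
have dl (t : R) : is_derive t 1 l w.
  have := is_derive_addf (is_derive_constf a t 1)
    (is_derive_scale (is_derive_idf t) (is_derive_constf w t 1)).
  by rewrite add0r scale1r scaler0 addr0.
have oI : open (l @^-1` V).
  apply: open_comp => // t _; exact: is_derive_continuous (dl t).
have l0 : l 0 = a by rewrite /l scale0r addr0.
have [e /= e0 he] : exists2 e : R, 0 < e & forall t, - e < t < e -> V (l t).
  have /nbhs_ballP[e /= e0 he] : nbhs (0 : R) (l @^-1` V).
    by apply: open_nbhs_nbhs; split => //; rewrite /preimage/= l0.
  exists e => // t te; apply: he; rewrite -ball_normE /ball_/= sub0r normrN.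
  by rewrite ltr_norml.
have psi_derive vs (t : R) : V (l t) ->
    is_derive t 1 (iter_derive psi vs \o l) (iter_derive psi (w :: vs) (l t)).
  move=> Vt; have ds : differentiable (iter_derive psi vs) (l t) by exact: spsi.
  by have := is_derive_chain ds (dl t); rewrite -deriveE.
exists e, (psi \o l); split => //.
- apply: (@smooth_derive_seq _ _ _ (fun k => iter_derive psi (nseq k w) \o l)).
    exact: open_oo.
  by move=> k t /he Vt; exact: psi_derive.
- move=> t /he Vt; have [Upsi phipsi] := psiK Vt.
  apply/XU => //; rewrite phipsi; apply/mask_mul.
  rewrite /l mulmxDl -scalemxAl vJ scaler0 addr0.
  by apply/mask_mul; apply/XU.
- by rewrite /= l0.
have [_ dE] := psi_derive [::] 0 ltac:(by rewrite l0).
by rewrite derive1E -[RHS](derive_psi_phi v Ux) -/w -/a -l0; exact: dE.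
Qed.

Lemma velocity_mask x (c : R -> 'rV[R]_n) (t : R) v (I : set R) : open I -> I t ->
  c t = x -> U x -> (forall s, I s -> X (c s)) ->
  is_derive t 1 c v -> v *m jac x *m vmask = 0.
Proof.
move=> oI It ctx Ux Xc dc; subst x.
have dphi : differentiable phi (c t) by exact: (sphi [::]).
have h1 := is_derive_mulmxr vmask (is_derive_chain dphi dc).
have h2 : is_derive t 1 (fun s => (phi \o c) s *m vmask) 0.
  apply: near_eq_is_derive (is_derive_constf 0 t 1).
  have cc : {for t, continuous c} := is_derive_continuous dc.
  near=> s; apply/esym/mask_mul/XU.
    by near: s; apply: cc; exact: open_nbhs_nbhs.
  by apply: Xc; near: s; exact: open_nbhs_nbhs.
by rewrite -deriv_phi// -(is_derive_unique h1 h2) deriveE.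
Unshelve. all: by end_near. Qed.

Lemma tangent_mask x v : X x -> U x ->
  tangent_space X x v <-> v *m jac x *m vmask = 0.
Proof.
move=> Xx Ux; split=> [[e [c [e0 sc Xc c0 cv]]]|]; last exact: straight_curve_tangent.
have I0 : - e < 0 < e by rewrite oppr_lt0 e0.
apply: (@velocity_mask x c 0 v [set t | - e < t < e]) => //.
  exact: open_oo.
by have := smooth_derive1 sc 0 I0; rewrite /= cv.
Qed.

Lemma tangent_nproj x v : X x -> U x -> tangent_space X x v <-> v *m nproj x = 0.
Proof.
move=> Xx Ux; split=> [/tangent_mask h|h].
  by rewrite -(nproj_tr Ux) /nproj /conormal !trmx_mul mask_tr !trmxK !mulmxA h// !mul0mx.
by apply/tangent_mask => //;
  rewrite -(mulmxA v) -nproj_jac// (mulmxA v) (mulmxA v) h !mul0mx.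
Qed.

Lemma normal_nproj x w : X x -> U x -> normal_space X x w <-> w *m nproj x = w.
Proof.
move=> Xx Ux.
have nw u : normal_space X x (u *m nproj x).
  move=> v /tangent_nproj h; rewrite dotC dot_mulmxl nproj_tr// h//.
  by rewrite dot0r.
split=> [hw|<-]; last exact: nw.
(* The tangential component of a normal [w] is both tangent and normal, hence orthogonal to
   itself. *)
have tu : tangent_space X x (w - w *m nproj x).
  by apply/tangent_nproj => //; rewrite mulmxBl -mulmxA nproj_idem// subrr.
apply/eqP; rewrite eq_sym -subr_eq0; apply/eqP/dot_eq0.
by rewrite dotBr hw// nw// subrr.
Qed.

End Chart.

(** * Geodesics in a chart *)

Section ChartCurves.
Variable R : realType.
Variables (n d : nat) (X U V : set 'rV[R]_n) (phi psi : 'rV[R]_n -> 'rV[R]_n).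
Hypotheses (oU : open U) (oV : open V) (sphi : smooth phi U) (spsi : smooth psi V).
Hypothesis phiK : forall x, U x -> V (phi x) /\ psi (phi x) = x.
Hypothesis psiK : forall y, V y -> U (psi y) /\ phi (psi y) = y.
Hypothesis XU : forall x, U x ->
  (X x <-> forall i : 'I_n, (d <= i)%N -> phi x 0 i = 0).

Local Notation e_ i := (delta_mx 0 i : 'rV[R]_n).
Local Notation rid := (rational_in_derivatives U phi).
Local Notation vmask := (@vmask R n d).
Local Notation jac := (jac phi).
Local Notation gram_inv := (@gram_inv R n d phi).
Local Notation gram := (@gram R n d phi).
Local Notation conormal := (@conormal R n d phi).
Local Notation nproj := (@nproj R n d phi).
Local Notation accel := (@accel R n d phi).
Local Notation hess := (hess phi).

Lemma rid_jac i j : rid (fun x => jac x i j).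
Proof. by under eq_fun do rewrite mxE; exact: rid_derive. Qed.

Lemma rid_const m k (A : 'M[R]_(m, k)) i j : rid (fun=> A i j).
Proof. exact: rid_cst. Qed.

Lemma rid_jac_tr i j : rid (fun x => (jac x)^T i j).
Proof. by under eq_fun do rewrite mxE; exact: rid_jac. Qed.

Lemma rid_gram i j : rid (fun x => gram x i j).
Proof.
under eq_fun do rewrite mxE.
apply: rid_add; last exact: rid_const.
apply: rid_mulmx => [{}i {}j|]; last exact: rid_const.
apply: rid_mulmx => {i j} [i j|]; last exact: rid_jac.
by apply: rid_mulmx => {i j} [i j|]; [exact: rid_const|exact: rid_jac_tr].
Qed.

Lemma rid_gram_inv i j : rid (fun x => gram_inv x i j).
Proof.
under eq_fun do rewrite mxE.
apply: rid_mul; last by apply: rid_adj; exact: rid_gram.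
apply: rid_inv; first by apply: rid_det; exact: rid_gram.
move=> x Ux; have := gram_unit d oU sphi spsi phiK Ux.
by rewrite unitmxE unitfE.
Qed.

Lemma rid_conormal i j : rid (fun x => conormal x i j).
Proof.
apply: rid_mulmx => {i j} [i j|]; last exact: rid_jac_tr.
apply: rid_mulmx => {i j} [i j|]; last exact: rid_const.
by apply: rid_mulmx => {i j} [i j|]; [exact: rid_const|exact: rid_gram_inv].
Qed.

Lemma rid_nproj i j : rid (fun x => nproj x i j).
Proof. by apply: rid_mulmx; [exact: rid_jac|exact: rid_conormal]. Qed.

Lemma nproj_derivable (c : R -> 'rV[R]_n) (t : R) l : U (c t) ->
  is_derive t 1 c l -> exists l', is_derive t 1 (fun s => nproj (c s)) l'.
Proof.
move=> Uc dc.
exists (\matrix_(i, j) 'd (fun x => nproj x i j) (c t) l).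
apply/is_derive_mxP => i j; rewrite mxE.
apply: (is_derive_chain _ dc) => //.
by apply: (rid_differentiable sphi) => //; exact: rid_nproj.
Qed.

(** [accel] is quadratic in the velocity; these coefficients depend on the position alone and lie in
    the rational class. *)
Definition accel_coef i k x : 'rV[R]_n :=
  - iter_derive phi [:: e_ k; e_ i] x *m conormal x.

Lemma accel_coefE x v :
  accel x v = \sum_i \sum_k (v 0 i * v 0 k) *: accel_coef i k x.
Proof.
rewrite /accel /accel_coef /hess mulNmx mulmx_suml -sumrN; apply: eq_bigr => i _.
rewrite mulmx_suml -sumrN; apply: eq_bigr => k _.
by rewrite -scalemxAl mulNmx scalerN.
Qed.

Lemma rid_accel_coef i k j : rid (fun x => accel_coef i k x 0 j).
Proof.
apply: (@rid_mulmx _ _ _ _ 1 n n (fun x => - iter_derive phi [:: e_ k; e_ i] x) conormal).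
  move=> a b; rewrite ord1.
  rewrite (_ : (fun _ => _) = fun x => -1 * iter_derive phi [:: e_ k; e_ i] x 0 b).
    by apply: rid_mul; [exact: rid_cst|exact: rid_derive].
  by apply/funext => x; rewrite mxE mulN1r.
exact: rid_conormal.
Qed.

Variable I : set R.
Hypothesis oI : open I.
Variables c c1 : R -> 'rV[R]_n.
Hypothesis Uc : forall t, I t -> U (c t).
Hypothesis dc : forall t, I t -> is_derive t 1 c (c1 t).
Hypothesis dc1 : forall t, I t -> is_derive t 1 c1 (accel (c t) (c1 t)).

(** Polynomials in the velocity with rational functions of the position as coefficients. The
    differential equation makes this class closed under differentiation in time, which gives the
    smoothness of solutions. *)
Inductive along_curve : (R -> R) -> Prop :=
| along_pos f : rid f -> along_curve (fun t => f (c t))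
| along_velocity j : along_curve (fun t => c1 t 0 j)
| along_add f g : along_curve f -> along_curve g -> along_curve (fun t => f t + g t)
| along_mul f g : along_curve f -> along_curve g -> along_curve (fun t => f t * g t).

Lemma along_sum (J : Type) (s : seq J) (f : J -> R -> R) :
  (forall i, along_curve (f i)) -> along_curve (fun t => \sum_(i <- s) f i t).
Proof.
move=> hf; elim: s => [|i s IH].
  by under eq_fun do rewrite big_nil; apply: (along_pos (rid_cst _ _ 0)).
by under eq_fun do rewrite big_cons; apply: along_add.
Qed.

Lemma along_derivative f : along_curve f ->
  exists2 g, along_curve g & forall t, I t -> is_derive t 1 f (g t).
Proof.
elim=> [{}f hf|j|{}f g hf [df hdf IHf] hg [dg hdg IHg]|{}f g hf [df hdf IHf] hg [dg hdg
  IHg]].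
- have /choice[g hg] (j : 'I_n) : exists g, rid g /\
      forall x, U x -> is_derive x (e_ j) f (g x).
    by have [g ? ?] := rid_derivative sphi (e_ j) hf; exists g.
  exists (fun t => \sum_j c1 t 0 j * g j (c t)).
    apply: along_sum => j; apply: along_mul; first exact: along_velocity.
    by apply: along_pos; case: (hg j).
  move=> t It; have dfc := rid_differentiable sphi hf (Uc It).
  have := is_derive_chain dfc (dc It); rewrite diff_coord_sum//.
  move=> hder; apply: (is_derive_eq hder); apply: eq_bigr => j _; rewrite -deriveE//.
  by have [_ /(_ _ (Uc It))[_ ->]] := hg j.
- exists (fun t => \sum_i \sum_k c1 t 0 i * c1 t 0 k * accel_coef i k (c t) 0 j).
    apply: along_sum => i; apply: along_sum => k.
    exact: (along_mul (along_mul (along_velocity i) (along_velocity k))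
      (along_pos (rid_accel_coef i k j))).
  move=> t It; have /is_derive_mxP/(_ 0 j) := dc1 It.
  move=> hder; apply: (is_derive_eq hder); rewrite accel_coefE summxE;
    apply: eq_bigr => i _.
  by rewrite summxE; apply: eq_bigr => k _; rewrite mxE.
- exists (fun x => df x + dg x) => [|x Ix]; first exact: along_add.
  by apply: is_derive_addf; [exact: IHf|exact: IHg].
- exists (fun x => df x * g x + f x * dg x) => [|x Ix].
    by apply: along_add; exact: along_mul.
  by apply: is_derive_mul; [exact: IHf|exact: IHg].
Qed.

Lemma solution_smooth : smooth c I.
Proof.
pose P (u : R -> 'rV[R]_n) := forall j, along_curve (fun t => u t 0 j).
apply: (@smooth_class _ _ P) => // [u Pu|j]; last first.
  by apply: (along_pos (rid_coord U phi j)).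
have /choice[w hw] (j : 'I_n) : exists w, along_curve w /\
    forall t, I t -> is_derive t 1 (fun t => u t 0 j) (w t).
  by have [w ? ?] := along_derivative (Pu j); exists w.
exists (fun t => \row_j w j t) => [j|t It].
  by under eq_fun do rewrite mxE; case: (hw j).
by apply/is_derive_mxP => i j; rewrite ord1 mxE; case: (hw j) => _; apply.
Qed.

(** The derivative of [c1 *m jac c] is [accel *m jac + hess], and [accel] is chosen so that [vmask]
    kills it. *)
Lemma solution_velocity_const : is_interval I -> forall s t, I s -> I t ->
  c1 s *m jac (c s) *m vmask = c1 t *m jac (c t) *m vmask.
Proof.
move=> itvI s t Is It.
apply: (is_derive0_cst_rV (f := fun t => c1 t *m jac (c t) *m vmask) itvI Is It) =>
  {s t Is It} t It.
have dJ : is_derive t 1 (fun s => c1 s *m jac (c s))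
    (accel (c t) (c1 t) *m jac (c t) + hess (c t) (c1 t)).
  apply: (near_derive (c := fun s =>
    \sum_i c1 s 0 i *: iter_derive phi [:: e_ i] (c s)) oI It).
    move=> s Is; rewrite [in RHS](row_sum_delta (c1 s)) mulmx_suml.
    apply: eq_bigr => i _; rewrite -scalemxAl -rowE; congr (_ *: _).
    by apply/rowP => j; rewrite !mxE.
  have h i : is_derive t 1 (fun s => c1 s 0 i *: iter_derive phi [:: e_ i] (c s))
      (accel (c t) (c1 t) 0 i *: iter_derive phi [:: e_ i] (c t) +
       c1 t 0 i *: \sum_k c1 t 0 k *: iter_derive phi [:: e_ k; e_ i] (c t)).
    apply: is_derive_scale; first by have /is_derive_mxP/(_ 0 i) := dc1 It.
    have dphi : differentiable (iter_derive phi [:: e_ i]) (c t) by apply: sphi;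
      exact: Uc.
    have := is_derive_chain dphi (dc It).
    move=> hder; apply: (is_derive_eq hder);
      rewrite [in LHS](row_sum_delta (c1 t)) linear_sum.
    by apply: eq_bigr => k _; rewrite linearZ/= -deriveE.
  have := is_derive_bigsum h; move=> hder; apply: (is_derive_eq hder).
  rewrite big_split/=; congr (_ + _).
    rewrite [in RHS](row_sum_delta (accel (c t) (c1 t))) mulmx_suml.
    apply: eq_bigr => i _; rewrite -scalemxAl -rowE; congr (_ *: _).
    by apply/rowP => j; rewrite !mxE.
  apply: eq_bigr => i _; rewrite scaler_sumr; apply: eq_bigr => k _.
  by rewrite scalerA.
have := is_derive_mulmxr vmask dJ; move=> hder; apply: (is_derive_eq hder).
rewrite mulmxDl.
have -> : accel (c t) (c1 t) *m jac (c t) *m vmask =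
    - hess (c t) (c1 t) *m (conormal (c t) *m jac (c t) *m vmask).
  by rewrite /accel !mulmxA.
by rewrite (conormal_jac d oU sphi spsi phiK (Uc It)) mulNmx addNr.
Qed.

(** The defining functions are affine in time along [c] and vanish at times 0 and 1. *)
Lemma solution_in_submanifold : is_interval I -> I 0 -> I 1 ->
  X (c 0) -> X (c 1) -> forall t, I t -> X (c t).
Proof.
move=> itvI I0 I1 X0 X1 t It; apply/XU; first exact: Uc.
apply/mask_mul.
pose z := c1 0 *m jac (c 0) *m vmask.
have dphic (s : R) : I s -> is_derive s 1 (fun s => phi (c s) *m vmask) z.
  move=> Is; have dphi : differentiable phi (c s) by apply: (sphi [::]); exact: Uc.
  have := is_derive_mulmxr vmask (is_derive_chain dphi (dc Is)).
  move=> hder; apply: (is_derive_eq hder);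
    rewrite /z (solution_velocity_const itvI I0 Is).
  by rewrite -(deriv_phi sphi)// ?deriveE//; exact: Uc.
have lin (s : R) : I s -> phi (c s) *m vmask = s *: z.
  move=> Is.
  have := @is_derive0_cst_rV _ n I (fun s => phi (c s) *m vmask - s *: z) 0 s itvI I0 Is.
  have -> : phi (c 0) *m vmask = 0 by apply/mask_mul/XU => //; exact: Uc.
  rewrite scale0r subr0 => /(_ _)/eqP; rewrite eq_sym subr_eq0 => /(_ _)/eqP; apply.
  move=> u Iu; have := is_derive_subf (dphic u Iu)
    (is_derive_scale (is_derive_idf u) (is_derive_constf z u 1)).
  by rewrite scale1r scaler0 addr0 subrr.
have z0 : z = 0.
  by rewrite -[LHS]scale1r -lin//; apply/mask_mul/XU => //; exact: Uc.
by rewrite lin// z0 scaler0.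
Qed.

Lemma solution_geodesic : is_interval I -> I 0 -> I 1 ->
  X (c 0) -> X (c 1) -> geodesic X I c.
Proof.
move=> itvI I0 I1 X0 X1; split => //; first by exists 0.
  exact: solution_smooth.
move=> t It; split; first exact: solution_in_submanifold.
have -> : derive1n 2 c t = accel (c t) (c1 t).
  rewrite /derive1n /= derive1E.
  have h : is_derive t 1 (derive1 c) (accel (c t) (c1 t)).
    apply: (near_derive (c := c1) oI It) (dc1 It) => s Is.
    by rewrite derive1E; case: (dc Is) => _ ->.
  by case: h.
apply/(normal_nproj oU oV sphi spsi phiK psiK XU).
- exact: solution_in_submanifold.
- exact: Uc.
rewrite /accel /nproj mulmxA -2!mulmxA (mulmxA (conormal _)).
by rewrite (conormal_jac_conormal d oU sphi spsi phiK)//; exact: Uc.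
Qed.

End ChartCurves.

(** * Chart-free statements *)

Section Submanifold.
Variable R : realType.
Variables (n : nat).
Implicit Types (X : set 'rV[R]_n) (x p v w : 'rV[R]_n).

Lemma rid_uniform_lipschitz (U : set 'rV[R]_n) phi p (A : finType)
    (f : A -> 'rV[R]_n -> R) : open U -> smooth phi U -> U p ->
  (forall a, rational_in_derivatives U phi (f a)) ->
  exists r K, [/\ 0 < r, 0 <= K, forall x, `|x - p| <= r -> U x &
    forall a x y, `|x - p| <= r -> `|y - p| <= r ->
      `|f a x| <= K /\ `|f a x - f a y| <= K * `|x - y| ].
Proof.
move=> oU sphi Up hf.
have [r0 r0_gt0 [K0 K0_ge0 hK0]] := rid_locally_bounded oU sphi (rid_cst U phi 0) Up.
have /choice[rK hrK] (a : A) : exists rK : R * R, [/\ 0 < rK.1, 0 <= rK.2 &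
    forall x y, `|x - p| <= rK.1 -> `|y - p| <= rK.1 ->
      `|f a x| <= rK.2 /\ `|f a x - f a y| <= rK.2 * `|x - y| ].
  by have [r ? [K ? ?]] := rid_locally_lipschitz oU sphi (hf a) Up; exists (r, K).
pose r := \big[Num.min/r0]_a (rK a).1.
pose K := \sum_a (rK a).2.
have r_le a : r <= (rK a).1 by exact: bigmin_le_cond.
have K_ge a : (rK a).2 <= K.
  rewrite /K (bigD1 a)//= lerDl; apply: sumr_ge0 => b _.
  by have [_ + _] := hrK b.
exists r, K; split => //.
- rewrite /r; elim/big_ind: _ => // [a b a0 b0|a _]; first by rewrite lt_min a0.
  by have [+ _ _] := hrK a.
- by apply: sumr_ge0 => a _; have [_ + _] := hrK a.
- by move=> x xp; have [] := hK0 x (le_trans xp (bigmin_le_id _ _ _ _)).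
move=> a x y xp yp; have [_ _ h] := hrK a.
have [h1 h2] := h x y (le_trans xp (r_le a)) (le_trans yp (r_le a)).
split; first exact: le_trans h1 (K_ge a).
by apply: le_trans h2 _; rewrite ler_wpM2r.
Qed.

(** Supplies the hypotheses of [boundary_value_solution]. There are [n * n] terms; a difference of
    products of three factors telescopes into three, and [s <= 1] lets [s] replace [s ^+ 2] in the
    one where the coefficient varies. *)
Lemma quadratic_map_estimates (Q : 'rV[R]_n -> 'rV[R]_n -> 'rV[R]_n)
    (G : 'I_n -> 'I_n -> 'rV[R]_n -> 'rV[R]_n) p (r K : R) : 0 <= K ->
  (forall x v, Q x v = \sum_i \sum_k (v 0 i * v 0 k) *: G i k x) ->
  (forall i k j x y, `|x - p| <= r -> `|y - p| <= r ->
    `|G i k x 0 j| <= K /\ `|G i k x 0 j - G i k y 0 j| <= K * `|x - y|) ->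
  forall s : R, 0 <= s <= 1 ->
  (forall x v, `|x - p| <= r -> `|v| <= s ->
    `|Q x v| <= (2 * (n%:R * n%:R) * K) * s ^+ 2) /\
  (forall x x' v v', `|x - p| <= r -> `|x' - p| <= r -> `|v| <= s -> `|v'| <= s ->
    `|Q x v - Q x' v'| <= (2 * (n%:R * n%:R) * K) * s * (`|x - x'| + `|v - v'|)).
Proof.
move=> K0 QE GK s /andP[s0 s1].
have sum2 (F : 'I_n -> 'I_n -> R) (B : R) : (forall i k, `|F i k| <= B) ->
    `|\sum_i \sum_k F i k| <= n%:R * n%:R * B.
  move=> FB; rewrite (le_trans (ler_norm_sum _ _ _))//.
  have -> : n%:R * n%:R * B = \sum_(i < n) \sum_(k < n) B.
    by rewrite !sumr_const !card_ord -[RHS]mulr_natl -[B *+ n]mulr_natl mulrA.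
  apply: ler_sum => i _; rewrite (le_trans (ler_norm_sum _ _ _))//.
  by apply: ler_sum => k _.
have QjE x v j : Q x v 0 j = \sum_i \sum_k v 0 i * v 0 k * G i k x 0 j.
  rewrite QE summxE; apply: eq_bigr => i _; rewrite summxE; apply: eq_bigr => k _.
  by rewrite mxE.
have nn : 0 <= n%:R * n%:R :> R by rewrite mulr_ge0.
split=> [x v xp vs|x x' v v' xp x'p vs v's].
  apply: norm_le_coord => [|j]; first by rewrite !mulr_ge0// exprn_ge0.
  rewrite QjE (le_trans (sum2 _ (K * s ^+ 2) _))//.
    move=> i k; have [h _] := GK i k j x x xp xp.
    rewrite normrM mulrC ler_pM// normrM expr2 ler_pM//.
      exact: le_trans (coord_le_norm _ _) vs.
    exact: le_trans (coord_le_norm _ _) vs.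
  rewrite -!mulrA ler_peMl ?ler1n//.
  by rewrite !mulr_ge0// exprn_ge0.
have E0 : 0 <= `|x - x'| + `|v - v'| by rewrite addr_ge0.
apply: norm_le_coord => [|j]; first by rewrite !mulr_ge0.
rewrite !mxE !QjE -sumrB; under eq_bigr do rewrite -sumrB.
rewrite (le_trans (sum2 _ (2 * (s * K) * (`|x - x'| + `|v - v'|)) _))//; last first.
  by rewrite le_eqVlt; apply/orP; left; apply/eqP; ring.
move=> i k; have [g1 g2] := GK i k j x x' xp x'p; have [g1' _] := GK i k j x' x x'p xp.
have hv l : `|v 0 l| <= s by exact: le_trans (coord_le_norm _ _) vs.
have hv' l : `|v' 0 l| <= s by exact: le_trans (coord_le_norm _ _) v's.
have hvv l : `|v 0 l - v' 0 l| <= `|v - v'|.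
  by have := coord_le_norm (v - v') l; rewrite !mxE.
have -> : v 0 i * v 0 k * G i k x 0 j - v' 0 i * v' 0 k * G i k x' 0 j =
  (v 0 i - v' 0 i) * (v 0 k * G i k x 0 j) +
  (v 0 k - v' 0 k) * (v' 0 i * G i k x 0 j) +
  (G i k x 0 j - G i k x' 0 j) * (v' 0 i * v' 0 k) by ring.
rewrite (le_trans (ler_normD _ _))// (le_trans (lerD (ler_normD _ _) (lexx _)))//.
rewrite !normrM.
have a1 : `|v 0 i - v' 0 i| * (`|v 0 k| * `|G i k x 0 j|) <= `|v - v'| * (s * K).
  by rewrite ler_pM ?mulr_ge0// ler_pM.
have a2 : `|v 0 k - v' 0 k| * (`|v' 0 i| * `|G i k x 0 j|) <= `|v - v'| * (s * K).
  by rewrite ler_pM ?mulr_ge0// ler_pM.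
have a3 : `|G i k x 0 j - G i k x' 0 j| * (`|v' 0 i| * `|v' 0 k|) <= (K * `|x - x'|) * s.
  rewrite ler_pM ?mulr_ge0// (le_trans (ler_pM _ _ (hv' i) (hv' k)))//.
  by rewrite ler_piMr.
have a4 : 0 <= `|x - x'| * (s * K) by rewrite !mulr_ge0.
apply: (le_trans (lerD (lerD a1 a2) a3)).
have -> : 2 * (s * K) * (`|x - x'| + `|v - v'|) =
  (`|v - v'| * (s * K) + `|v - v'| * (s * K) + K * `|x - x'| * s) + `|x - x'| * (s * K).
  by ring.
by rewrite lerDl.
Qed.

Lemma local_geodesic d X p : submanifold_dim d X -> X p ->
  exists2 e : R, 0 < e & forall x y, X x -> X y -> `|x - p| <= e -> `|y - p| <= e ->
    exists (I : set R) (c : R -> 'rV[R]_n),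
      [/\ geodesic X I c, I 0, I 1, c 0 = x & c 1 = y].
Proof.
move=> [dn sX] Xp.
have [U [V [phi [oU oV Up [psi [sphi spsi phiK psiK]] XU]]]] := sX p Xp.
pose G := @accel_coef R n d phi.
have [r [K [r0 K0 Ur GK]]] := rid_uniform_lipschitz oU sphi Up
  (fun ikj : 'I_n * 'I_n * 'I_n =>
    rid_accel_coef d oU sphi spsi phiK ikj.1.1 ikj.1.2 ikj.2).
pose B : R := 2 * (n%:R * n%:R) * K.
have B0 : 0 <= B by rewrite !mulr_ge0.
(* Meets the requirements [s <= 1], [2 * s <= r] and [12 * (B * s) <= 1]; [B + 1] keeps the
   denominator positive when [B] is 0. *)
pose s : R := Num.min 1 (Num.min (r / 2) (12 * (B + 1))^-1).
have B1 : 0 < 12 * (B + 1) by lra.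
have s0 : 0 < s by rewrite !lt_min ltr01 divr_gt0//= invr_gt0.
have s1 : s <= 1 by rewrite ge_min lexx.
have sr : 2 * s <= r.
  have : s <= r / 2 by rewrite !ge_min lexx orbT.
  by lra.
have sB : 12 * (B * s) <= 1.
  have : s <= (12 * (B + 1))^-1 by rewrite !ge_min lexx !orbT.
  rewrite -(ler_pM2l B1) mulfV ?gt_eqF// => h; apply: le_trans h.
  have -> : 12 * (B + 1) * s = 12 * (B * s) + 12 * s by ring.
  by rewrite lerDl mulr_ge0// ltW.
have [Qb Ql] := quadratic_map_estimates K0 (accel_coefE d phi)
  (fun i k j => GK (i, k, j)) (s := s) ltac:(by rewrite ltW).
exists (s / 3) => [|x y Xx Xy xp yp]; first by rewrite divr_gt0.
have [c [c1 [dc c0 c1E cr]]] := boundary_value_solution Qb Ql B0 s0 sr sB xp yp.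
pose I := [set t : R | -1 < t < 2].
have Uc t : I t -> U (c t).
  by move=> /andP[t1 t2]; apply/Ur/cr; rewrite !ltW.
have I0 : I 0 by rewrite /I/=; apply/andP; split; lra.
have I1 : I 1 by rewrite /I/=; apply/andP; split; lra.
exists I, c; split => //.
have oI : open I by exact: open_oo.
have dcI t : I t -> is_derive t 1 c (c1 t) by move=> /dc[].
have dc1I t : I t -> is_derive t 1 c1 (accel d phi (c t) (c1 t)) by move=> /dc[].
apply: (solution_geodesic oU oV sphi spsi phiK psiK XU oI Uc dcI dc1I) => //.
- exact: is_interval_oo.
- by rewrite c0.
- by rewrite c1E.
Qed.

(** Mentions no chart. Such a matrix is unique, so projectors computed in different charts agree,
    and [normal_proj] is differentiable along curves because each chart formula is. *)
Definition normal_projector X x (N : 'M[R]_n) :=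
  [/\ N^T = N, N *m N = N, forall w, normal_space X x w <-> w *m N = w &
    forall v, tangent_space X x v <-> v *m N = 0].

Lemma chart_projector d X (U V : set 'rV[R]_n) (phi psi : 'rV[R]_n -> 'rV[R]_n) x :
  open U -> open V -> smooth phi U ->
  smooth psi V -> (forall x, U x -> V (phi x) /\ psi (phi x) = x) ->
  (forall y, V y -> U (psi y) /\ phi (psi y) = y) ->
  (forall x, U x -> (X x <-> forall i : 'I_n, (d <= i)%N -> phi x 0 i = 0)) ->
  X x -> U x -> normal_projector X x (nproj d phi x).
Proof.
move=> oU oV sphi spsi phiK psiK XU Xx Ux; split.
- exact: (nproj_tr d oU sphi spsi phiK Ux).
- exact: (nproj_idem d oU sphi spsi phiK Ux).
- by move=> w; exact: (normal_nproj oU oV sphi spsi phiK psiK XU).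
- by move=> v; exact: (tangent_nproj oU oV sphi spsi phiK psiK XU).
Qed.

Lemma normal_projector_unique X x N N' :
  normal_projector X x N -> normal_projector X x N' -> N = N'.
Proof.
move=> [_ NN hn ht] [_ _ hn' ht'].
have e1 : N *m N' = N.
  apply/row_matrixP => i; rewrite row_mul; apply/hn'/hn.
  by rewrite -row_mul NN.
have e2 : (1%:M - N) *m N' = 0.
  apply/row_matrixP => i; rewrite row_mul row0; apply/ht'/ht.
  by rewrite -row_mul mulmxBl mul1mx NN subrr row0.
by move/eqP: e2; rewrite mulmxBl mul1mx e1 subr_eq0 => /eqP.
Qed.

Definition normal_proj X x : 'M[R]_n := xget 0 [set N | normal_projector X x N].

Lemma normal_projP d X x : submanifold_dim d X -> X x ->
  normal_projector X x (normal_proj X x).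
Proof.
move=> [dn sX] Xx.
have [U [V [phi [oU oV Ux [psi [sphi spsi phiK psiK]] XU]]]] := sX x Xx.
have h := chart_projector oU oV sphi spsi phiK psiK XU Xx Ux.
by rewrite /normal_proj; case: xgetP => [N -> //|/(_ _ h)].
Qed.

Lemma normal_projE X x N : normal_projector X x N -> normal_proj X x = N.
Proof.
rewrite /normal_proj => h; case: xgetP => [N' -> h'|/(_ _ h)//].
exact: normal_projector_unique h' h.
Qed.

(** The rank is the same at all points of [X]; [refl_normal] uses this to turn an inclusion of
    tangent spaces into an equality. *)
Lemma normal_proj_rank d X x : submanifold_dim d X -> X x ->
  \rank (normal_proj X x) = \rank (@vmask R n d).
Proof.
move=> [dn sX] Xx.
have [U [V [phi [oU oV Ux [psi [sphi spsi phiK psiK]] XU]]]] := sX x Xx.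
rewrite (normal_projE (chart_projector oU oV sphi spsi phiK psiK XU Xx Ux)).
exact: (nproj_rank d oU sphi spsi phiK Ux).
Qed.

Lemma velocity_tangent d X (I : set R) (c : R -> 'rV[R]_n) (t : R) v :
  submanifold_dim d X -> open I -> I t -> (forall s, I s -> X (c s)) ->
  is_derive t 1 c v -> tangent_space X (c t) v.
Proof.
move=> [dn sX] oI It Xc dc; have Xct := Xc t It.
have [U [V [phi [oU oV Ux [psi [sphi spsi phiK psiK]] XU]]]] := sX _ Xct.
apply: (straight_curve_tangent oU oV sphi spsi phiK psiK XU) => //.
exact: (velocity_mask oU sphi XU oI It erefl Ux Xc dc).
Qed.

Lemma normal_proj_derivable d X (I : set R) (c : R -> 'rV[R]_n) (t : R) v :
  submanifold_dim d X -> open I -> I t -> (forall s, I s -> X (c s)) ->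
  is_derive t 1 c v -> exists l, is_derive t 1 (fun s => normal_proj X (c s)) l.
Proof.
move=> [dn sX] oI It Xc dc; have Xct := Xc t It.
have [U [V [phi [oU oV Ux [psi [sphi spsi phiK psiK]] XU]]]] := sX _ Xct.
have [l hl] := nproj_derivable d oU sphi spsi phiK Ux dc; exists l.
apply: near_eq_is_derive hl.
have cc : {for t, continuous c} := is_derive_continuous dc.
near=> s; apply/esym/normal_projE/(chart_projector oU oV sphi spsi phiK psiK XU).
  by apply: Xc; near: s; exact: open_nbhs_nbhs.
by near: s; apply: cc; exact: open_nbhs_nbhs.
Unshelve. all: by end_near. Qed.

End Submanifold.

(** * Trigonometric curves *)

Section Trig.
Variable R : realType.

Lemma is_derive_cosM (a t : R) :
  is_derive t 1 (fun s => cos (a * s)) (- a * sin (a * t)).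
Proof.
have h := is_derive_cmul a (is_derive_idf t).
have := is_derive1_comp (is_derive_cos (a * t)) h.
by move=> hd; apply: (is_derive_eq hd); rewrite /GRing.scale/=; ring.
Qed.

Lemma is_derive_sinM (a t : R) :
  is_derive t 1 (fun s => sin (a * s)) (a * cos (a * t)).
Proof.
have h := is_derive_cmul a (is_derive_idf t).
have := is_derive1_comp (is_derive_sin (a * t)) h.
by move=> hd; apply: (is_derive_eq hd); rewrite /GRing.scale/=; ring.
Qed.

(** A triple is a frequency followed by the coefficients of its cosine and of its sine. *)
Definition trig_sum (s : seq (R * R * R)) (t : R) : R :=
  \sum_(m <- s) (m.1.2 * cos (m.1.1 * t) + m.2 * sin (m.1.1 * t)).

Definition trig_deriv (s : seq (R * R * R)) :=
  [seq (m.1.1, m.1.1 * m.2, - m.1.1 * m.1.2) | m <- s].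

Lemma trig_sum_derive s (t : R) : is_derive t 1 (trig_sum s) (trig_sum (trig_deriv s) t).
Proof.
elim: s => [|[[a u] w] s IH].
  rewrite /trig_sum big_nil (_ : (fun _ => _) = fun=> 0); first exact: is_derive_constf.
  by apply/funext => y; rewrite big_nil.
rewrite (_ : trig_sum (_ :: s) = fun t =>
  (u * cos (a * t) + w * sin (a * t)) + trig_sum s t); last first.
  by apply/funext => y; rewrite /trig_sum big_cons.
rewrite {2}/trig_sum big_cons -/(trig_deriv s) -/(trig_sum _ _) /=.
have hd := is_derive_addf (is_derive_addf (is_derive_cmul u (is_derive_cosM a t))
  (is_derive_cmul w (is_derive_sinM a t))) IH.
by apply: (is_derive_eq hd); ring.
Qed.

(* Induction on the number of frequencies: if [h] vanishes near [0], so does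
   [h'' + a^2 h], which has one frequency less. *)
Lemma trig_sum_eq0 s (e : R) : 0 < e ->
  (forall t, - e < t < e -> trig_sum s t = 0) -> forall t, trig_sum s t = 0.
Proof.
move=> e0; have [k] := ubnP (size s); elim: k s => // k IH [|[[a u] w] s] /= sk h0 t.
  by rewrite /trig_sum big_nil.
set h := trig_sum ((a, u, w) :: s) in h0 *.
pose h1 := trig_sum (trig_deriv ((a, u, w) :: s)).
pose h2 := trig_sum (trig_deriv (trig_deriv ((a, u, w) :: s))).
have dh (x : R) : is_derive x 1 h (h1 x) by exact: trig_sum_derive.
have dh1 (x : R) : is_derive x 1 h1 (h2 x) by exact: trig_sum_derive.
have itvE : is_interval [set x : R | - e < x < e] by exact: is_interval_oo.
have oE : open [set x : R | - e < x < e] by exact: open_oo.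
have h1_0 (x : R) : - e < x < e -> h1 x = 0.
  move=> xe; have h' : is_derive x 1 h 0.
    by apply: (near_derive oE xe _ (is_derive_constf 0 x 1)) => y /h0 ->.
  exact: is_derive_unique (dh x) h'.
have h2_0 (x : R) : - e < x < e -> h2 x = 0.
  move=> xe; have h' : is_derive x 1 h1 0.
    by apply: (near_derive oE xe _ (is_derive_constf 0 x 1)) => y /h1_0 ->.
  exact: is_derive_unique (dh1 x) h'.
pose s' := [seq (m.1.1, (a ^+ 2 - m.1.1 ^+ 2) * m.1.2, (a ^+ 2 - m.1.1 ^+ 2) * m.2) | m
  <- s].
have gE (x : R) : h2 x + a ^+ 2 * h x = trig_sum s' x.
  rewrite /h2 /h /s' /trig_deriv /trig_sum -map_comp /= !big_cons !big_map /= mulrDr.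
  rewrite addrACA [X in X + _](_ : _ = 0) ?add0r; last by ring.
  by rewrite mulr_sumr -big_split/=; apply: eq_bigr => m _; ring.
have g0 x : h2 x + a ^+ 2 * h x = 0.
  rewrite gE; apply: IH => [|y ye]; first by rewrite size_map.
  by rewrite -gE h2_0// h0// mulr0 addr0.
have z0 : - e < 0 < e by rewrite oppr_lt0 e0.
(* Now [h2 = - a ^+ 2 * h], so this energy is constant, and it is 0 at time 0. Even for [a = 0] it
   yields [h1 = 0], so that [h] is constant. *)
have E0 x : h1 x ^+ 2 + a ^+ 2 * h x ^+ 2 = 0.
  transitivity (h1 0 ^+ 2 + a ^+ 2 * h 0 ^+ 2); last first.
    by rewrite h1_0// h0// expr0n/= mulr0 addr0.
  apply: (is_derive0_cst (f := fun x => h1 x ^+ 2 + a ^+ 2 * h x ^+ 2) (I :=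
    setT)) => // y _.
  have hd := is_derive_addf (is_derive_mul (dh1 y) (dh1 y))
    (is_derive_cmul (a ^+ 2) (is_derive_mul (dh y) (dh y))).
  apply: (is_derive_eq hd); have -> : h2 y = - (a ^+ 2 * h y).
    by apply/eqP; rewrite -addr_eq0 g0.
  by ring.
have h1_all x : h1 x = 0.
  have p : 0 <= a ^+ 2 * h x ^+ 2 by rewrite mulr_ge0 ?sqr_ge0.
  by have /eqP := E0 x; rewrite paddr_eq0 ?sqr_ge0// sqrf_eq0 => /andP[/eqP].
transitivity (h 0); last exact: h0.
apply: (is_derive0_cst (f := h) (I := setT)) => // y _.
by rewrite -(h1_all y); exact: dh.
Qed.

Definition is_trig (h : R -> R) := exists s, h = trig_sum s.

Lemma is_trig_cst a : is_trig (fun=> a).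
Proof.
exists [:: (0, a, 0)]; apply/funext => t.
by rewrite /trig_sum big_seq1/= !mul0r cos0 addr0 mulr1.
Qed.

Lemma is_trig_cos a : is_trig (fun t => cos (a * t)).
Proof.
exists [:: (a, 1, 0)]; apply/funext => t.
by rewrite /trig_sum big_seq1/= mul0r addr0 mul1r.
Qed.

Lemma is_trig_sin a : is_trig (fun t => sin (a * t)).
Proof.
exists [:: (a, 0, 1)]; apply/funext => t.
by rewrite /trig_sum big_seq1/= mul0r add0r mul1r.
Qed.

Lemma is_trigD f g : is_trig f -> is_trig g -> is_trig (fun t => f t + g t).
Proof.
move=> [s ->] [s' ->]; exists (s ++ s'); apply/funext => t.
by rewrite /trig_sum big_cat.
Qed.

Lemma is_trigZ k f : is_trig f -> is_trig (fun t => k * f t).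
Proof.
move=> [s ->]; exists [seq (m.1.1, k * m.1.2, k * m.2) | m <- s]; apply/funext => t.
rewrite /trig_sum big_map mulr_sumr; apply: eq_bigr => m _ /=.
by rewrite mulrDr !mulrA.
Qed.

Lemma is_trig_sum (J : Type) (s : seq J) (f : J -> R -> R) :
  (forall j, is_trig (f j)) -> is_trig (fun t => \sum_(j <- s) f j t).
Proof.
move=> hf; elim: s => [|j s IH]; first by under eq_fun do rewrite big_nil;
  exact: is_trig_cst.
by under eq_fun do rewrite big_cons; exact: is_trigD.
Qed.

Lemma is_trig_eq f g (e : R) : 0 < e -> is_trig f -> is_trig g ->
  (forall t, - e < t < e -> f t = g t) -> f = g.
Proof.
move=> e0 tf tg fg.
have [s hs] : is_trig (fun t => f t + -1 * g t) by apply: is_trigD => //; exact: is_trigZ.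
apply/funext => t; apply/eqP; rewrite -subr_eq0 -mulN1r.
have -> : f t + -1 * g t = trig_sum s t by move/(congr1 (fun h => h t)): hs.
apply/eqP/(trig_sum_eq0 e0) => {}t te.
by move/(congr1 (fun h => h t)): hs => <-; rewrite fg// mulN1r subrr.
Qed.

(* Trigonometric sums are bounded. *)
Lemma is_trig_linear (a b : R) : is_trig (fun t => a * t + b) -> a = 0.
Proof.
move=> [s hs].
pose K : R := \sum_(m <- s) (`|m.1.2| + `|m.2|).
have bnd t : `|a * t + b| <= K.
  have -> : a * t + b = trig_sum s t by move/(congr1 (fun h => h t)): hs.
  rewrite /trig_sum (le_trans (ler_norm_sum _ _ _))// ler_sum// => m _.
  rewrite (le_trans (ler_normD _ _))// !normrM lerD// ler_piMr//.
    by rewrite ler_norml cos_geN1 cos_le1.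
  by rewrite ler_norml sin_geN1 sin_le1.
apply/eqP/negP => /negP a0.
have := bnd (((K + `|b| + 1) / a)); rewrite mulrC divfK//.
have K0 : 0 <= K by apply: sumr_ge0 => m _; rewrite addr_ge0.
have := ler_norm (- b); rewrite normrN => h1 h2.
have h3 := le_trans (ler_norm _) h2.
have h4 : `|b| + b + 1 <= 0.
  by rewrite -(lerD2l K) addr0; apply: le_trans h3; rewrite -!addrA (addrC b).
have h5 : 0 <= `|b| + b by rewrite addrC -lerBlDl sub0r.
by have := le_trans (lerD h5 (lexx 1)) h4; rewrite add0r ler10.
Qed.

End Trig.

(** * Geodesics in Clifford tori *)

Section RealTorus.
Variable R : realType.
Variable n : nat.

Definition real_torus r (rho : 'I_r -> R) (q : 'rV[R]_n) (e f : 'I_r -> 'rV[R]_n) :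
    set 'rV[R]_n :=
  [set x | exists a b : 'I_r -> R, (forall j, a j ^+ 2 + b j ^+ 2 = rho j ^+ 2) /\
    x = q + \sum_j (a j *: e j + b j *: f j)].

Definition orthonormal_frame r (e f : 'I_r -> 'rV[R]_n) := forall j k,
  [/\ dot (e j) (e k) = (j == k)%:R, dot (f j) (f k) = (j == k)%:R &
      dot (e j) (f k) = 0].

Lemma clifford_torus_real (C : set 'rV[R]_n) : clifford_torus C ->
  exists r (rho : 'I_r -> R) q e f,
    [/\ forall j, 0 < rho j, orthonormal_frame e f & C = real_torus rho q e f].
Proof.
move=> [r [rho [F [rho0 [q [L [Llin Ldot FE]]] CE]]]].
pose e j := L (delta_mx 0 j : 'rV[R[i]]_r).
pose f j := L ('i%C *: delta_mx 0 j : 'rV[R[i]]_r).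
have L0 : L 0 = 0.
  have := Llin 1 0 0; rewrite scaler0 add0r scale1r => /eqP.
  by rewrite -subr_eq0 opprD addrA subrr sub0r oppr_eq0 => /eqP.
have LD z w : L (z + w) = L z + L w by have := Llin 1 z w; rewrite !scale1r.
have LZ (a : R) z : L (a%:C%C *: z) = a *: L z.
  by have := Llin a z 0; rewrite L0 !addr0.
have Lsum (u : 'I_r -> 'rV[R[i]]_r) : L (\sum_j u j) = \sum_j L (u j).
  by apply: (big_morph L LD L0).
have LE (a b : 'I_r -> R) :
    L (\row_j (a j +i* b j)%C) = \sum_j (a j *: e j + b j *: f j).
  rewrite [X in L X](_ : _ = \sum_j ((a j)%:C%C *: delta_mx 0 j +
      (b j)%:C%C *: ('i%C *: delta_mx 0 j))); last first.
    rewrite [LHS]row_sum_delta; apply: eq_bigr => j _; rewrite mxE scalerA -scalerDl.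
    by congr (_ *: _); rewrite [LHS]complexE/= [X in _ + X]mulrC.
  by rewrite Lsum; apply: eq_bigr => j _; rewrite LD !LZ.
exists r, rho, q, e, f; split => //.
  move=> j k; rewrite /e /f !Ldot /cdot; split.
  - rewrite (bigD1 j)//= big1 ?addr0 => [|l lj].
      by rewrite !mxE !eqxx/=; case: eqP => _ /=; ring.
    by rewrite !mxE/= (negPf lj) mul0r.
  - rewrite (bigD1 j)//= big1 ?addr0 => [|l lj].
      by rewrite !mxE !eqxx/=; case: eqP => _ /=; ring.
    by rewrite !mxE/= (negPf lj) mulr0 mul0r.
  - rewrite (bigD1 j)//= big1 ?addr0 => [|l lj].
      by rewrite !mxE !eqxx/=; case: eqP => _ /=; ring.
    by rewrite !mxE/= (negPf lj) mul0r.
rewrite CE; apply/seteqP; split => [x [z hz <-]|x [a [b [hab ->]]]].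
  exists (fun j => complex.Re (z 0 j)), (fun j => complex.Im (z 0 j)); split => [j|].
    have := hz j; rewrite normc_def => -[h].
    by rewrite -h sqr_sqrtr// addr_ge0// sqr_ge0.
  rewrite FE -LE; congr (_ + L _); apply/rowP => j; rewrite mxE.
  by case: (z 0 j).
exists (\row_j (a j +i* b j)%C); last by rewrite FE LE.
move=> j; rewrite mxE normc_def/= hab sqrtr_sqr ger0_norm//.
exact: ltW.
Qed.

End RealTorus.

Section TrigCurve.
Variable R : realType.
Variables (n r : nat).
Implicit Types (q : 'rV[R]_n) (u w : 'I_r -> 'rV[R]_n) (a : 'I_r -> R).

Definition trig_curve q a u w (t : R) : 'rV[R]_n :=
  q + \sum_j (cos (a j * t) *: u j + sin (a j * t) *: w j).

Lemma trig_curve_derive q a u w (t : R) : is_derive t 1 (trig_curve q a u w)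
  (trig_curve 0 a (fun j => a j *: w j) (fun j => - a j *: u j) t).
Proof.
apply: is_derive_addf (is_derive_constf q t 1) _.
apply: is_derive_bigsum => j.
have hd := is_derive_addf
  (is_derive_scale (is_derive_cosM (a j) t) (is_derive_constf (u j) t 1))
  (is_derive_scale (is_derive_sinM (a j) t) (is_derive_constf (w j) t 1)).
apply: (is_derive_eq hd); rewrite !scaler0 !addr0 !scalerA addrC.
by congr (_ *: _ + _ *: _); rewrite mulrC.
Qed.

Lemma trig_curve_derive2 q a u w (t : R) : derive1n 2 (trig_curve q a u w) t =
  \sum_j - (a j ^+ 2) *: (cos (a j * t) *: u j + sin (a j * t) *: w j).
Proof.
have h q' u' w' : derive1 (trig_curve q' a u' w') =
    trig_curve 0 a (fun j => a j *: w' j) (fun j => - a j *: u' j).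
  by apply/funext => s; rewrite derive1E; case: (trig_curve_derive q' a u' w' s).
rewrite /derive1n /= !h /trig_curve add0r; apply: eq_bigr => j _.
rewrite !scalerA scalerDr !scalerA; congr (_ *: _ + _ *: _); ring.
Qed.

Lemma trig_curve_smooth q a u w : smooth (trig_curve q a u w) setT.
Proof.
apply: (@smooth_class _ _ (fun c => exists q u w, c = trig_curve q a u w)).
- exact: openT.
- move=> _ [q' [u' [w' ->]]]; eexists; last by move=> t _; exact: trig_curve_derive.
  by do 3 eexists.
- by do 3 eexists.
Qed.

Lemma trig_curve_is_trig q a u w k : is_trig (fun t => trig_curve q a u w t 0 k).
Proof.
rewrite (_ : (fun _ => _) = fun t => q 0 k + \sum_j
    (u j 0 k * cos (a j * t) + w j 0 k * sin (a j * t))); last first.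
  apply/funext => t; rewrite mxE summxE; congr (_ + _); apply: eq_bigr => j _.
  by rewrite !mxE ![_ * cos _]mulrC ![_ * sin _]mulrC.
apply: is_trigD; first exact: is_trig_cst.
by apply: is_trig_sum => j; apply: is_trigD; apply: is_trigZ;
  [exact: is_trig_cos|exact: is_trig_sin].
Qed.

End TrigCurve.

Section NormalTangent.
Variable R : realType.
Variable n : nat.
Variable X : set 'rV[R]_n.

Lemma normal_space_sum (J : finType) p (a : J -> R) (u : J -> 'rV[R]_n) :
  (forall j, normal_space X p (u j)) -> normal_space X p (\sum_j a j *: u j).
Proof.
move=> hu v tv; rewrite dotC dot_suml big1// => j _.
by rewrite dotZl dotC hu// mulr0.
Qed.

Lemma normal_spaceZ p k (u : 'rV[R]_n) : normal_space X p u -> normal_space X p (k *: u).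
Proof. by move=> hu v tv; rewrite dotZr hu// mulr0. Qed.

End NormalTangent.

(** * Geodesics inside a totally geodesic Clifford torus *)

Section CliffordGeodesic.
Variable R : realType.
Variables (n d : nat) (X C : set 'rV[R]_n).
Hypotheses (sX : submanifold_dim d X) (tgC : totally_geodesic X C).
Variables (r : nat) (rho : 'I_r -> R) (q : 'rV[R]_n) (e f : 'I_r -> 'rV[R]_n).
Hypotheses (rho0 : forall j, 0 < rho j) (onf : orthonormal_frame e f).
Hypothesis CE : C = real_torus rho q e f.

Let CX : C `<=` X. Proof. by case: tgC. Qed.

(* In complex notation, [radial a b j] is the vector [z_j] and [angular a b j]
   the vector [i z_j], where [z = a + i b]. *)
Let radial (a b : 'I_r -> R) j := a j *: e j + b j *: f j.
Let angular (a b : 'I_r -> R) j := - b j *: e j + a j *: f j.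
Let on_torus (a b : 'I_r -> R) := forall j, a j ^+ 2 + b j ^+ 2 = rho j ^+ 2.
Let point a b := q + \sum_j radial a b j.

Let point_in a b : on_torus a b -> C (point a b).
Proof. by move=> h; rewrite CE; exists a, b. Qed.

Let dot_frame (a b x y : 'I_r -> R) j :
  dot (\sum_k (a k *: e k + b k *: f k)) (x j *: e j + y j *: f j) = a j * x j + b j *
    y j.
Proof.
rewrite dot_suml (bigD1 j)//= big1 ?addr0 => [|k kj].
  rewrite dotDl !dotDr !dotZl !dotZr; have [-> -> ->] := onf j j.
  by rewrite (dotC (f j)); have [_ _ ->] := onf j j; rewrite eqxx/=; ring.
rewrite dotDl !dotDr !dotZl !dotZr; have [-> -> ->] := onf k j.
by rewrite (dotC (f k)); have [_ _ ->] := onf j k; rewrite (negPf kj)/=; ring.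
Qed.

(** Multiplication of the j-th complex coordinate by [exp (i w_j t)]. *)
Let rotate (w : 'I_r -> R) (a b : 'I_r -> R) (t : R) : ('I_r -> R) * ('I_r -> R) :=
  (fun j => a j * cos (w j * t) - b j * sin (w j * t),
   fun j => a j * sin (w j * t) + b j * cos (w j * t)).

Let rotate_on w a b t : on_torus a b -> on_torus (rotate w a b t).1 (rotate w a b t).2.
Proof.
move=> h j; rewrite -(h j) /=; have cs := cos2Dsin2 (w j * t).
transitivity ((a j ^+ 2 + b j ^+ 2) * (cos (w j * t) ^+ 2 + sin (w j * t) ^+ 2));
  first by ring.
by rewrite cs mulr1.
Qed.

Let radial_rotate w a b t j : radial (rotate w a b t).1 (rotate w a b t).2 j =
  cos (w j * t) *: radial a b j + sin (w j * t) *: angular a b j.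
Proof. by rewrite /radial /angular /=; apply/rowP => k; rewrite !mxE; ring. Qed.

Let torus_curve w a b := trig_curve q w (radial a b) (angular a b).

Let torus_curveE w a b t :
  torus_curve w a b t = point (rotate w a b t).1 (rotate w a b t).2.
Proof.
by rewrite /torus_curve /trig_curve /point; congr (_ + _); apply: eq_bigr => j _;
  rewrite radial_rotate.
Qed.

Let torus_curve_in w a b t : on_torus a b -> C (torus_curve w a b t).
Proof. by move=> h; rewrite torus_curveE; apply/point_in/rotate_on. Qed.

(* [x |-> dot (x - q) (radial a b j)] is maximal on the torus at [point a b]. *)
Let radial_normal_torus a b j : on_torus a b -> normal_space C (point a b) (radial a b j).
Proof.
move=> hab v [eps [c [eps0 sc Cc c0 cv]]].
have z0 : - eps < 0 < eps by rewrite oppr_lt0 eps0.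
have dc : is_derive (0 : R) 1 c v by have := smooth_derive1 sc 0 z0; rewrite /= cv.
pose h t := dot (c t - q) (radial a b j).
have dh (t : R) : - eps < t < eps -> is_derive t 1 h (dot (derive1 c t) (radial a b j)).
  move=> te; have dct : is_derive t 1 c (derive1 c t) := smooth_derive1 sc 0 te.
  have hd := is_derive_dot (is_derive_subf dct (is_derive_constf q t 1))
    (is_derive_constf (radial a b j) t 1).
  by apply: (is_derive_eq hd); rewrite subr0 dot0r addr0.
have hmax t : - eps < t < eps -> h t <= h 0.
  move=> te; rewrite /h c0 /point [q + _]addrC addrK.
  have := Cc t te; rewrite CE => -[x [y [hxy ->]]].
  rewrite [q + _]addrC addrK /radial !dot_frame.
  have h1 := hab j; have h2 := hxy j.
  have p1 := sqr_ge0 (x j - a j); have p2 := sqr_ge0 (y j - b j).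
  by nra.
have h0 : is_derive (0 : R) 1 h 0.
  apply: (@derive1_at_max _ h (- eps) eps 0).
  - by rewrite ge0_cp// ltW.
  - by move=> t; rewrite in_itv/= => te; case: (dh t te).
  - by rewrite in_itv.
  - by move=> t; rewrite in_itv/= => te; exact: hmax.
have := is_derive_unique h0 (dh 0 z0).
by rewrite cv => ->.
Qed.

(** The acceleration is a combination of radial vectors, so the curve is a geodesic of [C]; total
    geodesy makes it one of [X]. *)
Let torus_curve_geodesic w a b : on_torus a b -> geodesic X setT (torus_curve w a b).
Proof.
move=> hab; have [_ _] := tgC; apply; split => //.
- exact: openT.
- by exists 0.
- exact: trig_curve_smooth.
move=> t _; split; first exact: torus_curve_in.
rewrite trig_curve_derive2 torus_curveE.
apply: normal_space_sum => j; rewrite -radial_rotate.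
by apply: radial_normal_torus; exact: rotate_on.
Qed.

(** Turning only the j-th circle gives a geodesic of [X] whose acceleration at time 0 is
    [- radial a b j]. So each radial vector is normal to [X], not merely to [C]. *)
Let radial_normal a b j : on_torus a b -> normal_space X (point a b) (radial a b j).
Proof.
move=> hab; pose w (k : 'I_r) : R := (k == j)%:R.
have [_ _ _ _ /(_ 0 I)[_]] := torus_curve_geodesic w hab.
rewrite torus_curveE trig_curve_derive2.
have -> : point (rotate w a b 0).1 (rotate w a b 0).2 = point a b.
  congr (_ + _); apply: eq_bigr => k _; rewrite radial_rotate mulr0 cos0 sin0.
  by rewrite scale1r scale0r addr0.
rewrite (bigD1 j)//= big1 ?addr0 => [|k kj]; last first.
  by rewrite /w (negPf kj) expr0n/= oppr0 scale0r.
rewrite /w eqxx expr1n mulr0 cos0 sin0 scale1r scale0r addr0 => h.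
by have := normal_spaceZ (-1) h; rewrite scalerA mulN1r opprK scale1r.
Qed.

Let angular_tangent a b j : on_torus a b -> tangent_space X (point a b) (angular a b j).
Proof.
move=> hab; pose w (k : 'I_r) : R := (k == j)%:R.
have hp : torus_curve w a b 0 = point a b.
  rewrite torus_curveE; congr (_ + _); apply: eq_bigr => k _;
    rewrite radial_rotate mulr0 cos0 sin0.
  by rewrite scale1r scale0r addr0.
rewrite -hp; apply: (velocity_tangent sX openT I) => [s _|].
  exact/CX/torus_curve_in.
apply: (is_derive_eq (trig_curve_derive _ _ _ _ _)).
rewrite /trig_curve add0r (bigD1 j)//= big1 ?addr0 => [|k kj]; last first.
  by rewrite /w (negPf kj) oppr0 !scale0r !scaler0 addr0.
by rewrite /w eqxx mulr0 cos0 sin0 !scale1r scale0r addr0.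
Qed.

(** The acceleration is normal to [X] and [angular] is tangent, so each angular momentum
    [x y' - y x'] is constant. As [x^2 + y^2] is constant too, each complex coordinate turns at
    constant speed. *)
Let geodesic_in_torus (I : set R) (c : R -> 'rV[R]_n) : geodesic X I c -> I 0 ->
  c @` I `<=` C -> exists w a b, on_torus a b /\
    forall t, I t -> c t = torus_curve w a b t.
Proof.
move=> [oI itvI _ sc gc] I0 cC.
pose x t j := dot (c t - q) (e j); pose y t j := dot (c t - q) (f j).
have coord (a b : 'I_r -> R) : (fun j => dot (point a b - q) (e j)) = a /\
    (fun j => dot (point a b - q) (f j)) = b.
  split; apply/funext => j; rewrite /point [q + _]addrC addrK.
    have := dot_frame a b (fun=> 1) (fun=> 0) j.
    by rewrite scale1r scale0r addr0 mulr1 mulr0 addr0.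
  have := dot_frame a b (fun=> 0) (fun=> 1) j.
  by rewrite scale1r scale0r add0r mulr1 mulr0 add0r.
have cE t : I t -> on_torus (x t) (y t) /\ c t = point (x t) (y t).
  move=> It; have : C (c t) by apply: cC; exists t.
  rewrite CE => -[a [b [hab cab]]].
  have [xa yb] := coord a b; rewrite /x /y cab.
  by rewrite -/(point a b) xa yb.
pose x1 t j := dot (derive1 c t) (e j); pose y1 t j := dot (derive1 c t) (f j).
pose x2 t j := dot (derive1n 2 c t) (e j); pose y2 t j := dot (derive1n 2 c t) (f j).
have dots (u : 'rV[R]_n) (g g' : R -> 'rV[R]_n) (t : R) : is_derive t 1 g (g' t) ->
    is_derive t 1 (fun s => dot (g s) u) (dot (g' t) u).
  move=> dg; apply: (is_derive_eq (is_derive_dot dg (is_derive_constf u t 1))).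
  by rewrite dot0r addr0.
have dc (t : R) : I t -> is_derive t 1 (fun s => c s - q) (derive1 c t).
  move=> It; have h := is_derive_subf (smooth_derive1 sc 0 It) (is_derive_constf q t 1).
  by apply: (is_derive_eq h); rewrite subr0.
have dx j (t : R) : I t -> is_derive t 1 (fun s =>
  x s j) (x1 t j) by move=> /dc/dots; apply.
have dy j (t : R) : I t -> is_derive t 1 (fun s =>
  y s j) (y1 t j) by move=> /dc/dots; apply.
have dx1 j (t : R) : I t -> is_derive t 1 (fun s => x1 s j) (x2 t j).
  by move=> It; exact: (dots (e j) _ _ t (smooth_derive1 sc 1 It)).
have dy1 j (t : R) : I t -> is_derive t 1 (fun s => y1 s j) (y2 t j).
  by move=> It; exact: (dots (f j) _ _ t (smooth_derive1 sc 1 It)).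
have area j t : I t -> x t j * y2 t j - y t j * x2 t j = 0.
  move=> It; have [ht cEt] := cE t It; have [_] := gc t It.
  have tg := angular_tangent j ht; rewrite -cEt in tg => /(_ _ tg).
  rewrite /angular dotDl !dotZl dotC (dotC (f j)) -/(x2 t j) -/(y2 t j) => <-.
  by ring.
(* Angular momentum divided by the squared radius is the angular speed. *)
pose w j := (x 0 j * y1 0 j - y 0 j * x1 0 j) / rho j ^+ 2.
have rho2 j : rho j ^+ 2 != 0 by rewrite sqrf_eq0 gt_eqF.
have wE j t : I t -> x t j * y1 t j - y t j * x1 t j = w j * rho j ^+ 2.
  move=> It; rewrite /w divfK//.
  apply: (is_derive0_cst (f := fun t =>
    x t j * y1 t j - y t j * x1 t j) itvI It I0) => s Is.
  apply: (is_derive_eq (is_derive_subf (is_derive_mul (dx j s Is) (dy1 j s Is))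
    (is_derive_mul (dy j s Is) (dx1 j s Is)))).
  by rewrite -[RHS](area j s Is); ring.
have rad j t : I t -> x t j * x1 t j + y t j * y1 t j = 0.
  move=> It; have h1 := is_derive_addf (is_derive_mul (dx j t It) (dx j t It))
    (is_derive_mul (dy j t It) (dy j t It)).
  have h2 : is_derive t 1 (fun s => x s j * x s j + y s j * y s j) 0.
    apply: (near_derive oI It _ (is_derive_constf (rho j ^+ 2) t 1)) => s Is.
    by have [/(_ j) <- _] := cE s Is; rewrite !expr2.
  have := is_derive_unique h1 h2 => h.
  have n2 : (2 : R) != 0 by rewrite pnatr_eq0.
  by apply: (mulfI n2); rewrite mulr0 -h; ring.
have x1E j t : I t -> x1 t j = - w j * y t j.
  move=> It; apply: (mulfI (rho2 j)); have [/(_ j) h _] := cE t It.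
  rewrite -[in LHS]h; transitivity (x t j * (x t j * x1 t j + y t j * y1 t j)
    - y t j * (x t j * y1 t j - y t j * x1 t j)); first by ring.
  by rewrite rad// wE//; ring.
have y1E j t : I t -> y1 t j = w j * x t j.
  move=> It; apply: (mulfI (rho2 j)); have [/(_ j) h _] := cE t It.
  rewrite -[in LHS]h; transitivity (y t j * (x t j * x1 t j + y t j * y1 t j)
    + x t j * (x t j * y1 t j - y t j * x1 t j)); first by ring.
  by rewrite rad// wE//; ring.
exists w, (x 0), (y 0); split; first by case: (cE 0 I0).
move=> t It; have [_ ->] := cE t It; rewrite torus_curveE.
(* Turning the curve back by the angle [w j * t] gives a constant. *)
have cst1 j : x t j * cos (w j * t) + y t j * sin (w j * t) = x 0 j.
  transitivity (x 0 j * cos (w j * 0) + y 0 j * sin (w j * 0)); last first.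
    by rewrite mulr0 cos0 sin0 mulr1 mulr0 addr0.
  apply: (is_derive0_cst (f := fun t =>
    x t j * cos (w j * t) + y t j * sin (w j * t)) itvI It I0) => s Is.
  apply: (is_derive_eq (is_derive_addf (is_derive_mul (dx j s Is) (is_derive_cosM (w j)
    s))
    (is_derive_mul (dy j s Is) (is_derive_sinM (w j) s)))).
  by rewrite x1E// y1E//; ring.
have cst2 j : y t j * cos (w j * t) - x t j * sin (w j * t) = y 0 j.
  transitivity (y 0 j * cos (w j * 0) - x 0 j * sin (w j * 0)); last first.
    by rewrite mulr0 cos0 sin0 mulr1 mulr0 subr0.
  apply: (is_derive0_cst (f := fun t =>
    y t j * cos (w j * t) - x t j * sin (w j * t)) itvI It I0) => s Is.
  apply: (is_derive_eq (is_derive_subf (is_derive_mul (dy j s Is) (is_derive_cosM (w j)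
    s))
    (is_derive_mul (dx j s Is) (is_derive_sinM (w j) s)))).
  by rewrite x1E// y1E//; ring.
rewrite /point; congr (_ + _); apply: eq_bigr => j _;
  rewrite /radial /= -(cst1 j) -(cst2 j).
have cs := cos2Dsin2 (w j * t).
congr (_ *: _ + _ *: _).
  by transitivity (x t j * (cos (w j * t) ^+ 2 + sin (w j * t) ^+ 2));
    [rewrite cs mulr1|ring].
by transitivity (y t j * (cos (w j * t) ^+ 2 + sin (w j * t) ^+ 2));
  [rewrite cs mulr1|ring].
Qed.

(** In [g (s + t) - g s] the radial vectors at [g s] have coefficients even in [t], the angular ones
    odd. The reflection at [g s] fixes the former and negates the latter, which amounts to changing
    the sign of [t]. *)
Lemma torus_geodesic (I : set R) (c : R -> 'rV[R]_n) : geodesic X I c -> I 0 ->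
  c @` I `<=` C -> exists g : R -> 'rV[R]_n,
    [/\ forall t, I t -> c t = g t,
        forall k, is_trig (fun t => g t 0 k),
        geodesic X setT g,
        forall t, X (g t) /\ normal_space X (g t) (g t - q) &
        forall s t, g (s - t) = g s + (g (s + t) - g s) *m (normal_proj X (g s) *+ 2 -
          1%:M)].
Proof.
move=> gc I0 cC; have [w [a [b [hab cE]]]] := geodesic_in_torus gc I0 cC.
exists (torus_curve w a b); split => //.
- by move=> k; exact: trig_curve_is_trig.
- exact: torus_curve_geodesic.
- move=> t; split; first exact/CX/torus_curve_in.
  rewrite torus_curveE {2}/point [q + _]addrC addrK.
  under eq_bigr do rewrite -[radial _ _ _]scale1r.
  by apply: normal_space_sum => j; apply: radial_normal; exact: rotate_on.
move=> s t; have hs := rotate_on w s hab.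
set x := (rotate w a b s).1 in hs; set y := (rotate w a b s).2 in hs.
have shift u : torus_curve w a b (s + u) = torus_curve w x y u.
  rewrite !torus_curveE; congr (_ + _); apply: eq_bigr => j _.
  rewrite /radial /x /y /= mulrDr cosD sinD.
  by congr (_ *: _ + _ *: _); ring.
have gs : torus_curve w a b s = point x y by rewrite torus_curveE.
rewrite !shift gs -[LHS](subrK (point x y)) addrC; congr (_ + _).
have hN := normal_projP sX (CX (point_in hs)).
have diff u : torus_curve w x y u - point x y =
    \sum_j ((cos (w j * u) - 1) *: radial x y j + sin (w j * u) *: angular x y j).
  rewrite /torus_curve /trig_curve /point opprD addrACA subrr add0r -sumrB.
  by apply: eq_bigr => j _; rewrite scalerBl scale1r addrAC.
rewrite !diff mulmx_suml; apply: eq_bigr => j _.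
rewrite mulrN cosN sinN mulmxDl -!scalemxAl.
rewrite mulmxBr mulmx1 mulmxBr mulmx1 mulr2n !mulmxDr.
have [_ _ /(_ (radial x y j)) hn /(_ (angular x y j)) ht] := hN.
rewrite (hn.1 (radial_normal j hs)) (ht.1 (angular_tangent j hs)).
by rewrite addrK add0r sub0r scalerN scaleNr.
Qed.

End CliffordGeodesic.

(** All later use of the Clifford hypothesis goes through this statement. Since [g t - q] is normal
    at [g t], the reflection there fixes [q]. *)
Theorem clifford_geodesic (R : realType) (n d : nat) (X : set 'rV[R]_n) (I : set R)
    (c : R -> 'rV[R]_n) : submanifold_dim d X -> clifford_type X ->
  geodesic X I c -> I 0 -> exists (q : 'rV[R]_n) (g : R -> 'rV[R]_n),
    [/\ forall t, I t -> c t = g t,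
        forall k, is_trig (fun t => g t 0 k),
        geodesic X setT g,
        forall t, X (g t) /\ normal_space X (g t) (g t - q) &
        forall s t, g (s - t) = g s + (g (s + t) - g s) *m (normal_proj X (g s) *+ 2 -
          1%:M)].
Proof.
move=> sX clX gc I0; have [C [tgC /clifford_torus_real ctC cC]] := clX I c gc.
have [r [rho [q [e [f [rho0 onf CE]]]]]] := ctC.
have [g hg] := torus_geodesic sX tgC rho0 onf CE gc I0 cC.
by exists q, g.
Qed.

(** * Reflections *)

Section Reflections.
Variable R : realType.
Variables (n d : nat) (X : set 'rV[R]_n).
Hypothesis sX : submanifold_dim d X.

Definition refl_mx x : 'M[R]_n := normal_proj X x *+ 2 - 1%:M.
Definition refl x (z : 'rV[R]_n) := x + (z - x) *m refl_mx x.

Lemma refl_mx_tr x : X x -> (refl_mx x)^T = refl_mx x.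
Proof.
move=> /(normal_projP sX)[NT _ _ _].
by rewrite /refl_mx linearB/= trmx1 raddfMn/= NT.
Qed.

Lemma refl_mx_sqr x : X x -> refl_mx x *m refl_mx x = 1%:M.
Proof.
move=> /(normal_projP sX)[_ NN _ _]; set N := normal_proj X x in NN *.
rewrite /refl_mx -/N mulmxBl mul1mx !mulr2n mulmxBr mulmx1 mulmxDl !mulmxDr NN.
by apply/matrixP => i j; rewrite !mxE; ring.
Qed.

Lemma refl_mx_normal x w : X x -> normal_space X x w -> w *m refl_mx x = w.
Proof.
move=> /(normal_projP sX)[_ _ hn _] /hn h.
by rewrite /refl_mx mulmxBr mulmx1 mulr2n mulmxDr h addrK.
Qed.

Lemma refl_mx_tangent x v : X x -> tangent_space X x v -> v *m refl_mx x = - v.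
Proof.
move=> /(normal_projP sX)[_ _ _ ht] /ht h.
by rewrite /refl_mx mulmxBr mulmx1 mulr2n mulmxDr h addr0 sub0r.
Qed.

Lemma dot_refl_mx x u v : X x -> dot (u *m refl_mx x) (v *m refl_mx x) = dot u v.
Proof.
by move=> Xx; rewrite dot_mulmxl refl_mx_tr// -mulmxA refl_mx_sqr// mulmx1.
Qed.

Lemma reflK x z : X x -> refl x (refl x z) = z.
Proof.
move=> Xx; rewrite /refl [x + _ - x]addrAC subrr add0r -mulmxA refl_mx_sqr//.
by rewrite mulmx1 subrKC.
Qed.

Lemma reflB x y z : refl x y - refl x z = (y - z) *m refl_mx x.
Proof. by rewrite /refl opprD addrACA subrr add0r -mulmxBl opprB addrA subrK. Qed.

Lemma refl_dist x y z : X x ->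
  dot (refl x y - refl x z) (refl x y - refl x z) = dot (y - z) (y - z).
Proof. by move=> Xx; rewrite reflB dot_refl_mx. Qed.

Lemma is_derive_refl x (c : R -> 'rV[R]_n) (t : R) v : is_derive t 1 c v ->
  is_derive t 1 (fun s => refl x (c s)) (v *m refl_mx x).
Proof.
move=> dc; have := is_derive_addf (is_derive_constf x t 1)
  (is_derive_mulmxr (refl_mx x) (is_derive_subf dc (is_derive_constf x t 1))).
by rewrite subr0 add0r.
Qed.

(** Reflections preserve [dot], while the topology comes from the sup norm; this lemma and
    [norm_le_dot] compare the two. *)
Lemma norm_small_dot (e : R) : 0 < e ->
  exists2 e' : R, 0 < e' & forall u : 'rV[R]_n, `|u| < e' -> dot u u < e.
Proof.
move=> e0; have n0 : 0 < (n%:R + 1 : R) by rewrite ltr_wpDl.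
exists (Num.min 1 (e / (n%:R + 1))); first by rewrite lt_min ltr01 divr_gt0.
move=> u; rewrite lt_min => /andP[u1 u2].
apply: (@le_lt_trans _ _ (n%:R * `|u|)).
  have -> : n%:R * `|u| = \sum_(i < n) `|u| by rewrite sumr_const card_ord mulr_natl.
  apply: ler_sum => i _; rewrite -expr2 -real_normK ?num_real// expr2.
  rewrite -[leRHS]mulr1 ler_pM// ?coord_le_norm//.
  exact: le_trans (coord_le_norm _ _) (ltW u1).
move: u2; rewrite ltr_pdivlMr// => h; apply: le_lt_trans h.
by rewrite mulrC ler_wpM2l// lerDl.
Qed.

Lemma norm_le_dot (u : 'rV[R]_n) (e : R) : 0 <= e -> dot u u <= e ^+ 2 -> `|u| <= e.
Proof.
move=> e0 ue; apply: norm_le_coord => // j.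
rewrite -ler_sqr ?nnegrE// real_normK ?num_real//; apply: le_trans ue.
rewrite /dot (bigD1 j)//= -expr2 lerDl; apply: sumr_ge0 => i _.
by rewrite -expr2 sqr_ge0.
Qed.

Lemma smooth_affine (I : set R) (c : R -> 'rV[R]_n) (b : 'rV[R]_n) (A : 'M[R]_n) :
  open I -> smooth c I -> smooth (fun t => b + c t *m A) I.
Proof.
move=> oI sc.
apply: (@smooth_class _ _ (fun u => exists k b, u = fun t =>
  b + derive1n k c t *m A)) => //.
  move=> _ [k [b' ->]]; exists (fun t => 0 + derive1n k.+1 c t *m A);
    first by exists k.+1, 0.
  move=> t It.
  exact: (is_derive_addf (is_derive_constf b' t 1) (is_derive_mulmxr A (smooth_derive1
    sc k It))).
by exists 0%N, b.
Qed.

Lemma near_restrict (c : R -> 'rV[R]_n) (I : set R) (t : R) v (e : R) :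
  open I -> I t -> 0 < e ->
  is_derive t 1 c v -> exists2 h : R, 0 < h & forall s, t - h < s < t + h ->
    I s /\ `|c s - c t| < e.
Proof.
move=> oI It e0 /is_derive_continuous cc.
have : \forall s \near t, I s /\ `|c t - c s| < e.
  near=> s; split; first by near: s; exact: open_nbhs_nbhs.
  by near: s; apply: cvgr_dist_lt.
move=> /nbhs_ballP[h /= h0 hh]; exists h => // s /andP[s1 s2].
rewrite distrC; apply: hh; rewrite -ball_normE /ball_/= ltr_norml.
by apply/andP; split; lra.
Unshelve. all: by end_near. Qed.

(** The condition spread by connectedness in [refl_in]. It concerns a neighbourhood of [x], so that
    curves of [X] through [x], and with them tangent vectors, can be reflected. *)
Definition maps_near p x := exists2 e : R, 0 < e &
  forall y, X y -> `|y - x| < e -> X (refl p y).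

Lemma refl_tangent p x v : X p -> X x -> maps_near p x -> tangent_space X x v ->
  tangent_space X (refl p x) (v *m refl_mx p).
Proof.
move=> Xp Xx [e e0 he] [eps [c [eps0 sc Xc c0 cv]]].
have z0 : - eps < 0 < eps by rewrite oppr_lt0 eps0.
have dc : is_derive (0 : R) 1 c v by have := smooth_derive1 sc 0 z0; rewrite /= cv.
have [h h0 hh] := near_restrict (@open_oo R _ _) z0 e0 dc.
rewrite -c0; apply: (velocity_tangent (c := fun s => refl p (c s)) (t :=
  0) sX (@open_oo R (0 - h) (0 + h))).
- by rewrite /= sub0r add0r oppr_lt0 h0.
- by move=> s /hh[Is cs]; apply: he; [exact: Xc|rewrite -c0].
- exact: is_derive_refl.
Qed.

(** [refl_mx p] maps the tangent space at [x] into the one at [refl p x]; the dimensions agree, so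
    it maps onto it, and being orthogonal it carries normal vectors to normal vectors. *)
Lemma refl_normal p x w : X p -> X x -> maps_near p x -> normal_space X x w ->
  normal_space X (refl p x) (w *m refl_mx p).
Proof.
move=> Xp Xx mx.
have Xpx : X (refl p x).
  by have [e e0 he] := mx; apply: he => //; rewrite subrr normr0.
have := normal_projP sX Xx; have := normal_projP sX Xpx.
have rk y : X y -> \rank (1%:M - normal_proj X y) = (n - \rank (@vmask R n d))%N.
  move=> Xy; rewrite -(normal_proj_rank sX Xy); have [_ NN _ _] := normal_projP sX Xy.
  rewrite -mxrank_ker; apply/eqP; rewrite eqn_leq; apply/andP; split; apply: mxrankS.
    by apply/sub_kermxP; rewrite mulmxBl mul1mx NN subrr.
  have h : kermx (normal_proj X y) *m (1%:M - normal_proj X y) = kermx (normal_proj X y).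
    by rewrite mulmxBr mulmx1 mulmx_ker subr0.
  by rewrite -{1}h submxMl.
have rkE : \rank (1%:M - normal_proj X x) = \rank (1%:M - normal_proj X (refl p x)).
  by rewrite !rk.
move: rkE; set N := normal_proj X x; set N' := normal_proj X (refl p x).
move=> rkE [NT' NN' hn' ht'] [NT NN hn ht].
have Su : refl_mx p \in unitmx by have /mulmx1_unit[] := refl_mx_sqr Xp.
have sub : ((1%:M - N) *m refl_mx p <= 1%:M - N')%MS.
  have -> : (1%:M - N) *m refl_mx p = (1%:M - N) *m refl_mx p *m (1%:M - N').
    rewrite [RHS]mulmxBr mulmx1 (_ : _ *m N' = 0) ?subr0//.
    apply/row_matrixP => i; rewrite row0 -mulmxA row_mul mulmxA.
    apply/ht'/refl_tangent => //; apply/ht.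
    by rewrite -row_mul mulmxBl mul1mx NN subrr row0.
  exact: submxMl.
have eqrk : \rank ((1%:M - N) *m refl_mx p) = \rank (1%:M - N').
  by rewrite mxrankMfree ?row_free_unit.
have /submxP[D hD] : (1%:M - N' <= (1%:M - N) *m refl_mx p)%MS.
  by have [_] := mxrank_leqif_eq sub; rewrite eqrk eqxx => /esym/andP[].
move=> /hn wN; apply/hn'; apply/eqP; rewrite eq_sym -subr_eq0; apply/eqP.
have -> : w *m refl_mx p - w *m refl_mx p *m N' = w *m refl_mx p *m (1%:M - N').
  by rewrite [RHS]mulmxBr mulmx1.
have -> : 1%:M - N' = (D *m ((1%:M - N) *m refl_mx p))^T.
  by rewrite -hD linearB/= trmx1 NT'.
have eT : (1%:M - N)^T = 1%:M - N by rewrite linearB/= trmx1 NT.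
rewrite !trmx_mul refl_mx_tr// eT !mulmxA -(mulmxA w) refl_mx_sqr//.
by rewrite mulmx1 [w *m _]mulmxBr mulmx1 wN subrr mul0mx.
Qed.

Hypothesis clX : clifford_type X.

(* Both sides are trigonometric curves, so they coincide as soon as they do
   near one point. *)
Lemma refl_geodesic_end p x (I : set R) (c : R -> 'rV[R]_n) : X p -> X x ->
  maps_near p x -> geodesic X I c -> I 0 -> I 1 -> c 0 = x -> X (refl p (c 1)).
Proof.
move=> Xp Xx [e e0 he] gc I0 I1 c0.
have [q [g [cg tg dg Xg _]]] := clifford_geodesic sX clX gc I0.
have [oI itvI _ sc gc2] := gc.
have [h h0 hh] := near_restrict oI I0 e0 (smooth_derive1 sc 0 I0).
pose J := [set t : R | - h < t < h].
have hJ t : J t -> I t /\ `|c t - x| < e.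
  by rewrite -c0 => tJ; apply: hh; rewrite sub0r add0r.
have J0 : J 0 by rewrite /J/= oppr_lt0 h0.
have mJ t : J t -> maps_near p (c t).
  move=> /hJ[It cte]; exists (e - `|c t - x|); first by rewrite subr_gt0.
  move=> y Xy; rewrite ltrBrDr => ye; apply: he => //; apply: le_lt_trans ye.
  by rewrite -(subrKA (c t) y) ler_normD.
have gd : geodesic X J (fun t => refl p (c t)).
  split.
  - exact: open_oo.
  - exact: is_interval_oo.
  - by exists 0.
  - rewrite (_ : (fun _ => _) = fun t => (p - p *m refl_mx p) + c t *m refl_mx p);
    last first.
      by apply/funext => t; rewrite /refl mulmxBl [RHS]addrAC addrA.
    apply: smooth_affine; first exact: open_oo.
    by move=> vs t /hJ[It _]; exact: sc.
  move=> t Jt; have [It cte] := hJ t Jt; have [Xct nct] := gc2 t It.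
  split; first exact: he.
  suff -> : derive1n 2 (fun t => refl p (c t)) t = derive1n 2 c t *m refl_mx p.
    by apply: refl_normal => //; exact: mJ.
  have d1 (s : R) : J s -> derive1 (fun t => refl p (c t)) s = derive1 c s *m refl_mx p.
    move=> /hJ[Is _]; rewrite derive1E.
    by case: (is_derive_refl p (smooth_derive1 sc 0 Is)).
  have d2 : is_derive t 1 (derive1 (fun t => refl p (c t))) (derive1n 2 c t *m refl_mx p).
    apply: (near_derive (c := fun s => derive1 c s *m refl_mx p) (@open_oo R (- h) h) Jt).
      by move=> s /d1.
    exact: is_derive_mulmxr (smooth_derive1 sc 1 It).
  by rewrite /derive1n/= derive1E; case: d2.
have [q' [g' [cg' tg' _ Xg' _]]] := clifford_geodesic sX clX gd J0.
rewrite cg//; suff -> : refl p (g 1) = g' 1 by case: (Xg' 1).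
apply/rowP => k.
suff : (fun t => refl p (g t) 0 k) = (fun t => g' t 0 k) by move/(congr1 (fun u => u 1)).
apply: (is_trig_eq h0) => [||t th].
- rewrite (_ : (fun _ => _) = fun t => (p - p *m refl_mx p) 0 k +
      \sum_j refl_mx p j k * g t 0 j); last first.
    apply/funext => t; rewrite /refl mulmxBl addrCA addrC 2!mxE; congr (_ + _).
    by rewrite mxE; apply: eq_bigr => j _; rewrite mulrC.
  apply: is_trigD; first exact: is_trig_cst.
  by apply: is_trig_sum => j; exact: is_trigZ.
- exact: tg'.
by rewrite -cg' //= -cg//; have [] := hJ t th.
Qed.

(** * Propagation along a connected submanifold *)

Hypothesis coX : connected X.

(** The hypothesis is symmetric in [y] and [z], so it makes both [P] and its negation relatively
    open in [X]. *)
Lemma connected_ind (P : 'rV[R]_n -> Prop) p : X p -> P p ->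
  (forall x, X x -> exists2 e : R, 0 < e & forall y z, X y -> X z ->
    `|y - x| < e -> `|z - x| < e -> P y -> P z) ->
  forall x, X x -> P x.
Proof.
move=> Xp Pp hP.
have /choice[e he] (x : 'rV[R]_n) : exists e : R, 0 < e /\
  (X x -> forall y z, X y -> X z ->
    `|y - x| < e -> `|z - x| < e -> P y -> P z).
  have [/hP[e ? ?]|nX] := pselect (X x); first by exists e.
  by exists 1.
pose O (Q : 'rV[R]_n -> Prop) := \bigcup_(x in [set x | X x /\ Q x]) ball x (e x).
have oO Q : open (O Q).
  by apply: bigcup_open => x _; apply: ball_open; case: (he x).
have inO Q x : X x -> Q x -> O Q x.
  by move=> Xx Qx; exists x => //; apply: ballxx; case: (he x).
have OP x : X x -> O P x -> P x.
  move=> Xx [y [Xy Py]]; rewrite -ball_normE/= distrC => xy; have [e0 /(_ Xy) h] := he y.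
  by apply: (h y) => //; rewrite subrr normr0.
have OnP x : X x -> O (fun x => ~ P x) x -> ~ P x.
  move=> Xx [y [Xy nPy]]; rewrite -ball_normE/= distrC => xy Px;
    have [e0 /(_ Xy) h] := he y.
  by apply: nPy; apply: (h x) => //; rewrite subrr normr0.
have XPE : X `&` [set x | P x] = X.
  apply: coX; first by exists p.
    exists (O P) => //; apply/seteqP; split => x [Xx h]; split => //.
      exact: inO.
    exact: OP.
  exists (~` O (fun x => ~ P x)); first by rewrite closedC.
  apply/seteqP; split => x [Xx h]; split => //=.
    by move=> /OnP; apply.
  by apply: contrapT => nP; apply: h; exact: inO.
by move=> x; rewrite -{1}XPE => -[].
Qed.

Lemma local_joined x : X x -> exists2 e : R, 0 < e & forall y z, X y -> X z ->
    `|y - x| < e -> `|z - x| < e -> exists (I : set R) (c : R -> 'rV[R]_n),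
      [/\ geodesic X I c, I 0, I 1, c 0 = y & c 1 = z].
Proof.
move=> Xx; have [e e0 he] := local_geodesic sX Xx; exists e => // y z Xy Xz yx zx.
by apply: he => //; exact: ltW.
Qed.

Lemma refl_in p x : X p -> X x -> X (refl p x).
Proof.
move=> Xp Xx; suff [e e0] : maps_near p x by apply => //; rewrite subrr normr0.
apply: (connected_ind Xp _ _ Xx) => [|{x Xx} x Xx].
  (* Near [p] itself, with [g 0 = p] and [g 1 = y], the point [refl p y] is [g (-1)]. *)
  have [e e0 he] := local_joined Xp; exists e => // y Xy yp.
  have [|I [c [gc I0 I1 c0 <-]]] := he p y Xp Xy _ yp; first by rewrite subrr normr0.
  have [q [g [cg _ _ Xg rg]]] := clifford_geodesic sX clX gc I0.
  have := rg 0 1; rewrite sub0r add0r -(cg 0 I0) c0 -(cg 1 I1) => h.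
  by rewrite /refl /refl_mx -h; case: (Xg (-1)).
have [e e0 he] := local_joined Xx; exists e => // y z Xy Xz yx zx my.
exists (e - `|z - x|) => [|u Xu uz]; first by rewrite subr_gt0.
have ux : `|u - x| < e.
  by move: uz; rewrite ltrBrDr; apply: le_lt_trans; rewrite -(subrKA z u) ler_normD.
have [I [c [gc I0 I1 c0 <-]]] := he y u Xy Xu yx ux.
exact: (refl_geodesic_end Xp Xy my gc I0 I1 c0).
Qed.

(** Nearby points [g 0] and [g 1] are exchanged by the reflection at the midpoint [g (1 / 2)]. *)
Lemma homogeneous_ind (P : 'rV[R]_n -> Prop) p : X p -> P p ->
  (forall m x, X m -> X x -> P x -> P (refl m x)) -> forall x, X x -> P x.
Proof.
move=> Xp Pp hP; apply: (connected_ind Xp Pp) => x Xx.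
have [e e0 he] := local_joined Xx; exists e => // y z Xy Xz yx zx Py.
have [I [c [gc I0 I1 c0 <-]]] := he y z Xy Xz yx zx.
have [q [g [cg _ _ Xg rg]]] := clifford_geodesic sX clX gc I0.
have Xm : X (g (1 / 2)) by case: (Xg (1 / 2)).
have := rg (1 / 2) (- (1 / 2)); rewrite opprK -splitr subrr -(cg 0 I0) -(cg 1 I1) c0.
by rewrite cg// -/(refl_mx _) -/(refl _ _) => ->; exact: hP.
Qed.

Lemma extrinsically_symmetric_refl : extrinsically_symmetric X.
Proof.
move=> p Xp; exists (refl p); split.
  exists (mulmxr (refl_mx p)); split => [x|u v|w|v] //=.
  - exact: dot_refl_mx.
  - exact: refl_mx_normal.
  - exact: refl_mx_tangent.
apply/seteqP; split => [_ [x Xx <-]|x Xx]; first exact: refl_in.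
by exists (refl p x); [exact: refl_in|exact: reflK].
Qed.

(** * Closedness *)

Lemma closure_normP (y : 'rV[R]_n) : closure X y <->
  forall e : R, 0 < e -> exists2 x, X x & `|x - y| < e.
Proof.
split=> [cy e e0|h B /nbhs_ballP[e /= e0 he]].
  have [x [Xx]] := cy _ (nbhsx_ballx y e e0).
  by rewrite -ball_normE/= distrC; exists x.
have [x Xx xy] := h e e0; exists x; split => //; apply: he.
by rewrite -ball_normE/= distrC.
Qed.

(** Near one point [p], up to some Euclidean radius, [X] contains its limit points. Reflections are
    isometries preserving [X] and its closure, so by transitivity the same radius serves at every
    point of [X], and each point of the closure is that close to one. *)
Lemma closed_clifford_type : closed X.
Proof.
have [->|/set0P[p Xp]] := eqVneq X set0; first exact: closed0.
have [e e0 he] : exists2 e : R, 0 < e &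
    forall y, closure X y -> dot (y - p) (y - p) <= e -> X y.
  have [_ /(_ p Xp)[U [V [phi [oU oV Up [psi [sphi spsi phiK psiK]] XU]]]]] := sX.
  have /nbhs_ballP[r /= r0 hr] : nbhs p U by exact: open_nbhs_nbhs.
  exists ((r / 2) ^+ 2) => [|y cy yp]; first by rewrite exprn_gt0 ?divr_gt0.
  have Uy : U y.
    apply: hr; rewrite -ball_normE/= distrC.
    apply: le_lt_trans (norm_le_dot _ yp) _; first by rewrite divr_ge0 ?ltW.
    by rewrite ltr_pdivrMr// ltr_pMr// ltr1n.
  apply/(XU y Uy) => i di; apply: contrapT => /eqP phi0.
  have cphi : {for y, continuous phi}.
    exact/differentiable_continuous/(sphi [::]).
  have : \forall x \near y, U x /\ `|phi y - phi x| < `|phi y 0 i|.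
    near=> x; split; first by near: x; exact: open_nbhs_nbhs.
    by near: x; apply: cvgr_dist_lt => //; rewrite normr_gt0.
  move=> /nbhs_ballP[r' /= r'0 hr'].
  have [x Xx xy] := (closure_normP y).1 cy r' r'0.
  have [|Ux] := hr' x; first by rewrite -ball_normE/= distrC.
  rewrite ltNge => /negP; apply.
  have := coord_le_norm (phi y - phi x) i; rewrite !mxE.
  by have /(XU x Ux) /(_ i di) -> := Xx; rewrite subr0.
have main x : X x -> forall y, closure X y -> dot (y - x) (y - x) <= e -> X y.
  apply: (homogeneous_ind (P := fun x => forall y, closure X y ->
    dot (y - x) (y - x) <= e -> X y) Xp he) => m {}x Xm Xx hx y cy yx.
  rewrite -(reflK y Xm); apply: refl_in => //; apply: hx.
    apply/closure_normP => e1 e1_0.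
    have [e2 e2_0 he2] := norm_small_dot (exprn_gt0 2 (divr_gt0 e1_0 (ltr0n R 2))).
    have [z Xz zy] := (closure_normP y).1 cy e2 e2_0.
    exists (refl m z); first exact: refl_in.
    apply: (@le_lt_trans _ _ (e1 / 2)).
      apply: norm_le_dot; first by rewrite divr_ge0// ltW.
      by rewrite refl_dist//; apply/ltW/he2.
    by rewrite ltr_pdivrMr// ltr_pMr// ltr1n.
  by rewrite -(reflK x Xm) refl_dist.
move=> y cy.
have [e1 e1_0 he1] := norm_small_dot e0.
have [x Xx xy] := (closure_normP y).1 cy e1 e1_0.
by apply: (main x Xx y cy); apply/ltW/he1; rewrite distrC.
Unshelve. all: by end_near. Qed.

End Reflections.

(** * Linear spaces of affine fields *)

Section OrthonormalBasis.
Variable R : realType.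

(** Take an orthonormal family in [P] of maximal size: if some [v] in [P] were outside its span, the
    normalised remainder would enlarge it. *)
Lemma orthonormal_basis (m : nat) (P : set 'rV[R]_m) : P 0 ->
  (forall k u v, P u -> P v -> P (k *: u + v)) ->
  exists k (B : 'M[R]_(k, m)), [/\ B *m B^T = 1%:M, forall i, P (row i B) &
    forall v, P v -> v = v *m B^T *m B].
Proof.
move=> P0 Plin.
pose fam k := `[< exists B : 'M[R]_(k, m), B *m B^T = 1%:M /\ forall i, P (row i B) >].
have fam0 : fam 0%N.
  by apply/asboolP; exists 0; split => [|[]//]; apply/matrixP => -[].
have fam_le k : fam k -> (k <= m)%N.
  move=> /asboolP[B [BB _]]; have <- : \rank (B *m B^T) = k by rewrite BB mxrank1.
  exact: leq_trans (mxrankM_maxl _ _) (rank_leq_col B).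
have [k /asboolP[B [BB PB]] kmax] := ex_maxnP (ex_intro _ 0%N fam0) fam_le.
exists k, B; split => // v Pv.
have PvB (w : 'rV[R]_k) : P (w *m B).
  rewrite mulmx_sum_row; elim/big_ind: _ => // [u u' Pu Pu'|i _].
    by rewrite -[u]scale1r; exact: Plin.
  by rewrite -[_ *: _]addr0; exact: Plin.
pose u := v - v *m B^T *m B.
have Pu : P u by rewrite /u addrC -scaleN1r; exact: Plin.
have uB : u *m B^T = 0 by rewrite /u mulmxBl -!mulmxA BB mulmx1 subrr.
apply/eqP; rewrite -subr_eq0 -/u; apply/negP => /negP u0.
have duu : 0 < dot u u.
  by rewrite lt_neqAle dot_ge0 andbT eq_sym; apply: contraNN u0 => /eqP/dot_eq0 ->.
pose e := (Num.sqrt (dot u u))^-1 *: u.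
have ee : e *m e^T = 1%:M.
  apply/matrixP => i j; rewrite !ord1 -dotE /e dotZl dotZr mxE eqxx.
  by rewrite mulrA -expr2 exprVn sqr_sqrtr ?dot_ge0// mulVf// gt_eqF.
have eB : e *m B^T = 0 by rewrite /e -scalemxAl uB scaler0.
have : fam (1 + k)%N.
  apply/asboolP; exists (col_mx e B); split.
    rewrite tr_col_mx mul_col_row ee eB BB.
    rewrite (_ : B *m e^T = 0) -?scalar_mx_block//.
    by apply: trmx_inj; rewrite trmx_mul trmxK eB trmx0.
  move=> i; case: (@split_ordP 1 k i) => j ->; last by rewrite rowKd.
  by rewrite rowKu ord1 row_id /e -[_ *: _]addr0; exact: Plin.
by move/kmax; rewrite ltnn.
Qed.

(** Fredholm alternative. By symmetry the columns of [cokermx K], transposed, lie in the kernel of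
    [K], so orthogonality to the kernel puts [c] in the row space. *)
Lemma sym_solvable (n : nat) (K : 'M[R]_n) (c : 'rV[R]_n) : K^T = K ->
  (forall u : 'rV_n, u *m K = 0 -> dot c u = 0) -> exists z, z *m K = c.
Proof.
move=> KT h; suff /submxP[z ->] : (c <= K)%MS by exists z.
rewrite submxE; apply/eqP/rowP => j; rewrite [RHS]mxE.
have := h (row j (cokermx K)^T).
rewrite dotE -row_mul -{2}KT -trmx_mul mulmx_coker trmx0 row0 => /(_ erefl).
by rewrite tr_row trmxK colE mulmxA -colE mxE.
Qed.

Lemma dot_mxvec (n : nat) (A B : 'M[R]_n) : dot (mxvec A) (mxvec B) = \tr (A *m B^T).
Proof.
rewrite /dot (reindex _ (curry_mxvec_bij n n)) /= /mxtrace.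
transitivity (\sum_i \sum_j A i j * B i j).
  rewrite pair_big; apply: eq_bigr => -[i j] _ /=.
  by rewrite !mxvecE.
by apply: eq_bigr => i _; rewrite mxE; apply: eq_bigr => j _; rewrite mxE.
Qed.

(* [K A b] says that the affine vector field [z |-> z *m A + b] belongs to a
   linear space of fields without nonzero constant field.  The form
   [tr (A *m A'^T)] is then definite on it; in an orthonormal basis
   [(A_i, b_i)], the map [E z := \sum_i (z *m A_i + b_i) *m A_i^T] commutes with
   every isometry preserving [K], and [Z] is the zero set of [E]. *)
Lemma equivariant_zero_set (n : nat) (K : 'M[R]_n -> 'rV[R]_n -> Prop) :
  K 0 0 -> (forall k A b A' b', K A b -> K A' b' -> K (k *: A + A') (k *: b + b')) ->
  (forall b, K 0 b -> b = 0) ->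
  exists Z : set 'rV[R]_n, [/\ Z !=set0,
    forall z z' A b, Z z -> Z z' -> K A b -> (z - z') *m A = 0 &
    forall (S : 'M[R]_n) y, S^T = S -> S *m S = 1%:M ->
      (forall A b, K A b -> K (S *m A *m S) ((y *m A + b) *m S - y *m (S *m A *m S))) ->
      forall z, Z z -> Z (y + (z - y) *m S) ].
Proof.
move=> K0 Klin Kinj.
have [k [B [BB PB spanB]]] := @orthonormal_basis _ [set v | exists b, K (vec_mx v) b]
  ltac:(by exists 0; rewrite linear0)
  ltac:(by move=> a u v [b Kb] [b' Kb']; exists (a *: b + b'); rewrite linearP/=;
    exact: Klin).
pose A i := vec_mx (row i B) : 'M[R]_n.
have /choice[b Kb] i : exists b, K (A i) b by exact: PB.
have Ksum (a : 'I_k -> R) : K (\sum_i a i *: A i) (\sum_i a i *: b i).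
  elim/big_ind2: _ => // [M w M' w' h h'|i _].
    by rewrite -[M]scale1r -[w]scale1r; exact: Klin.
  by rewrite -[_ *: A i]addr0 -[_ *: b i]addr0; exact: Klin.
(* Two fields of [K] with equal linear parts differ by a constant field, hence are equal; so the
   coordinates of [M] also express [w]. *)
have Kspan M w : K M w -> M = \sum_i (mxvec M *m B^T) 0 i *: A i /\
    w = \sum_i (mxvec M *m B^T) 0 i *: b i.
  move=> KM; have e : M = \sum_i (mxvec M *m B^T) 0 i *: A i.
    have := spanB (mxvec M); rewrite /= mxvecK => /(_ (ex_intro _ w KM)) h.
    rewrite -[LHS]mxvecK [in LHS]h mulmx_sum_row linear_sum/=.
    by apply: eq_bigr => i _; rewrite linearZ.
  split=> //; apply/eqP; rewrite eq_sym -subr_eq0; apply/eqP/Kinj.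
  have := Klin (-1) _ _ _ _ KM (Ksum (fun i => (mxvec M *m B^T) 0 i)).
  by rewrite -e !scaleN1r addNr addrC.
pose E (z : 'rV[R]_n) := \sum_i (z *m A i + b i) *m (A i)^T.
pose G := \sum_i A i *m (A i)^T.
pose c := \sum_i b i *m (A i)^T.
have EE (z : 'rV[R]_n) : E z = z *m G + c.
  rewrite /E /G /c mulmx_sumr -big_split/=; apply: eq_bigr => i _.
  by rewrite mulmxDl mulmxA.
have GT : G^T = G.
  by rewrite /G linear_sum/=; apply: eq_bigr => i _; rewrite trmx_mul trmxK.
have kerG (u : 'rV[R]_n) : u *m G = 0 -> forall i, u *m A i = 0.
  move=> uG i; apply: dot_eq0.
  have : \sum_i dot (u *m A i) (u *m A i) = 0.
    rewrite -[RHS](dot0l u) -uG /G mulmx_sumr dot_suml; apply: eq_bigr => j _.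
    by rewrite mulmxA [RHS]dot_mulmxl trmxK.
  by move/eqP; rewrite psumr_eq0 => [/allP/(_ i (mem_index_enum _))/eqP//|j _];
    exact: dot_ge0.
have kerGK (u : 'rV[R]_n) : u *m G = 0 -> forall M w, K M w -> u *m M = 0.
  move=> /kerG uA M w /Kspan[-> _]; rewrite mulmx_sumr big1// => i _.
  by rewrite -scalemxAr uA scaler0.
exists [set z | E z = 0]; split.
(* Solvable, because [c] is orthogonal to the kernel of [G], on which all [A i] vanish. *)
- have [u uG|z zG] := @sym_solvable _ G c GT.
    rewrite /c dot_suml big1// => i _.
    by rewrite dot_mulmxl trmxK kerG// dot0r.
  by exists (- z); rewrite /= EE mulNmx zG addNr.
- move=> z z' M w /= Ez Ez' KM; apply: kerGK KM.
  by rewrite mulmxBl -[_ *m G](addrK c) -[z' *m G](addrK c) -!EE Ez Ez' subrr.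
move=> S y ST SS KS z /= Ez.
pose A' i := S *m A i *m S.
pose b' i := (y *m A i + b i) *m S - y *m A' i.
(* Matrix, in the basis [A i], of conjugation by [S]. Conjugation preserves the trace form, so [O]
   is orthogonal, and the sum defining [E] is unchanged when [A' i], [b' i] replace [A i], [b i]. *)
pose O := \matrix_(i, j) (mxvec (A' i) *m B^T) 0 j.
have KA' i : K (A' i) (b' i) by exact: KS.
have OO : O^T *m O = 1%:M.
  apply: mulmx1C; apply/matrixP => i j.
  have -> : (O *m O^T) i j = dot (mxvec (A' i)) (mxvec (A' j)).
    have -> : mxvec (A' i) = row i O *m B.
      rewrite [LHS](spanB _ (ex_intro _ (b' i) _)) ?mxvecK//; congr (_ *m _).
      by apply/rowP => l; rewrite !mxE.
    have -> : mxvec (A' j) = row j O *m B.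
      rewrite [LHS](spanB _ (ex_intro _ (b' j) _)) ?mxvecK//; congr (_ *m _).
      by apply/rowP => l; rewrite !mxE.
    rewrite dotE trmx_mul mulmxA -(mulmxA (row i O)) BB mulmx1 !mxE.
    by apply: eq_bigr => l _; rewrite !mxE.
  rewrite dot_mxvec /A' !trmx_mul ST.
  have -> : \tr (S *m A i *m S *m (S *m ((A j)^T *m S))) = \tr (A i *m (A j)^T).
    rewrite -!mulmxA (mulmxA S S) SS mul1mx mxtrace_mulC -!mulmxA SS mulmx1.
    by [].
  rewrite -dot_mxvec /A !vec_mxK dotE tr_row.
  have /matrixP/(_ i j) := BB; rewrite !mxE => <-.
  by apply: eq_bigr => l _; rewrite !mxE.
have OOE j l : \sum_i O i j * O i l = (j == l)%:R.
  have /matrixP/(_ j l) := OO; rewrite mxE [RHS]mxE => <-.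
  by apply: eq_bigr => i _; rewrite [(O^T) _ _]mxE.
have A'E i : A' i = \sum_j O i j *: A j.
  by have [-> _] := Kspan _ _ (KA' i); apply: eq_bigr => j _; rewrite [in RHS]mxE.
have b'E i : b' i = \sum_j O i j *: b j.
  by have [_ ->] := Kspan _ _ (KA' i); apply: eq_bigr => j _; rewrite [in RHS]mxE.
have E'E : \sum_i (z *m A' i + b' i) *m (A' i)^T = E z.
  have xiE i : z *m A' i + b' i = \sum_j O i j *: (z *m A j + b j).
    rewrite A'E b'E mulmx_sumr -big_split/=; apply: eq_bigr => j _.
    by rewrite scalerDr scalemxAr.
  have termE i : (z *m A' i + b' i) *m (A' i)^T =
      \sum_j \sum_l (O i j * O i l) *: ((z *m A j + b j) *m (A l)^T).
    rewrite xiE A'E mulmx_suml; apply: eq_bigr => j _.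
    rewrite linear_sum/= mulmx_sumr; apply: eq_bigr => l _.
    by rewrite linearZ/= -scalemxAl -scalemxAr scalerA.
  under eq_bigr do rewrite termE.
  rewrite exchange_big/= /E; apply: eq_bigr => j _.
  rewrite exchange_big/= (bigD1 j)//= [X in _ + X]big1 => [|l lj].
    rewrite addr0 -scaler_suml.
    by rewrite OOE eqxx scale1r.
  by rewrite -scaler_suml OOE eq_sym (negPf lj) scale0r.
(* Moving the point by the reflection amounts to conjugating the fields and reflecting the
   result. *)
have -> : E (y + (z - y) *m S) = (\sum_i (z *m A' i + b' i) *m (A' i)^T) *m S.
  rewrite /E mulmx_suml; apply: eq_bigr => i _.
  have A'T : (A' i)^T *m S = S *m (A i)^T.
    by rewrite /A' !trmx_mul ST -!mulmxA SS mulmx1.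
  have A'S (w : 'rV[R]_n) : w *m A' i *m S = w *m S *m A i.
    by rewrite /A' -(mulmxA w) -(mulmxA _ S S) SS mulmx1 mulmxA.
  rewrite -[RHS]mulmxA A'T [RHS]mulmxA; congr (_ *m _).
  have b'S : b' i *m S = y *m A i + b i - y *m S *m A i.
    by rewrite /b' mulmxBl A'S -(mulmxA (y *m A i + b i)) SS mulmx1.
  rewrite [RHS]mulmxDl A'S b'S.
  rewrite [in LHS]mulmxDl mulmxBl mulmxBl; apply/rowP => j; rewrite !mxE; ring.
by rewrite E'E Ez mul0mx.
Qed.

End OrthonormalBasis.

(** * Boundedness *)

Section Bounded.
Variable R : realType.
Variables (n d : nat) (X : set 'rV[R]_n).
Hypotheses (sX : submanifold_dim d X) (clX : clifford_type X) (coX : connected X).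

Local Notation refl := (refl X).
Local Notation refl_mx := (refl_mx X).

Lemma maps_everywhere p x : X p -> X x -> maps_near X p x.
Proof. by move=> Xp Xx; exists 1 => // y Xy _; exact: (refl_in sX clX coX). Qed.

(** The reflection at [y] carries the normal space at [x] to that at [refl y x], so the projectors
    are conjugate. *)
Lemma refl_mx_refl x y : X x -> X y ->
  refl_mx (refl y x) = refl_mx y *m refl_mx x *m refl_mx y.
Proof.
move=> Xx Xy; set S := refl_mx y; set N := normal_proj X x.
have SS : S *m S = 1%:M := refl_mx_sqr sX Xy.
have ST : S^T = S := refl_mx_tr sX Xy.
have Xyx : X (refl y x) := refl_in sX clX coX Xy Xx.
have [NT NN hn ht] := normal_projP sX Xx.
have back w : w *m S *m S = w by rewrite -mulmxA SS mulmx1.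
have NE w : w *m (S *m N *m S) *m S = w *m S *m N.
  by rewrite -!mulmxA SS mulmx1 !mulmxA.
have h : normal_projector X (refl y x) (S *m N *m S).
  split.
  - by rewrite !trmx_mul ST NT mulmxA.
  - by rewrite -!mulmxA (mulmxA S S) SS mul1mx (mulmxA N) NN.
  - move=> w; split=> [nw|wE].
      have := refl_normal sX Xy Xyx (maps_everywhere Xy Xyx) nw.
      rewrite (reflK sX)// -/S => /hn wSN.
      by rewrite -[LHS]back NE wSN back.
    rewrite -[w]back; apply: (refl_normal sX Xy Xx (maps_everywhere Xy Xx)).
    by apply/hn; rewrite -NE wE.
  - move=> v; split=> [tv|vE].
      have := refl_tangent sX Xy Xyx (maps_everywhere Xy Xyx) tv.
      rewrite (reflK sX)// -/S => /ht vSN.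
      by rewrite -[LHS]back NE vSN mul0mx.
    rewrite -[v]back; apply: (refl_tangent sX Xy Xx (maps_everywhere Xy Xx)).
    by apply/ht; rewrite -NE vE mul0mx.
have -> : refl_mx x = N *+ 2 - 1%:M by [].
have -> : refl_mx (refl y x) = S *m N *m S *+ 2 - 1%:M.
  by rewrite /refl_mx (normal_projE h).
move: S SS {ST back NE h} => S SS.
by rewrite mulmxBr mulmxBl mulmx1 SS !mulr2n mulmxDr mulmxDl.
Qed.

Lemma is_derive_mulmx (m k l : nat) (A : R -> 'M[R]_(m, k)) (B : R -> 'M[R]_(k, l))
    (t : R) A' B' : is_derive t 1 A A' -> is_derive t 1 B B' ->
  is_derive t 1 (fun s => A s *m B s) (A' *m B t + A t *m B').
Proof.
move=> /is_derive_mxP dA /is_derive_mxP dB; apply/is_derive_mxP => i j.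
rewrite (_ : (fun _ => _) = fun s => \sum_h A s i h * B s h j); last first.
  by apply/funext => s; rewrite mxE.
rewrite !mxE -big_split/=; apply: is_derive_bigsum => h.
exact: is_derive_mul.
Qed.

(** What is retained of a geodesic in a torus with centre [q]: the reflections at all its points fix
    [q]. This is readily stable under reflections of [X] and shifts of time. *)
Definition centred_curve (g : R -> 'rV[R]_n) q :=
  [/\ forall t, X (g t), derivable g 0 1 & forall t, normal_space X (g t) (g t - q)].

Lemma centred_curve_refl g q t z : centred_curve g q ->
  refl (g t) z = q + (z - q) *m refl_mx (g t).
Proof.
move=> [Xg _ ng]; rewrite /refl -[z - g t](subrKA q) mulmxDl.
rewrite -(opprB (g t) q) mulNmx (refl_mx_normal sX (Xg t) (ng t)).
by rewrite addrC opprB addrA subrK addrC.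
Qed.

(* The velocity at [t = 0] of the isometries [refl (g t) \o refl (g 0)] is a
   Killing field of [X]. *)
Inductive killing : 'M[R]_n -> 'rV[R]_n -> Prop :=
| killing_curve g q D : centred_curve g q ->
    is_derive (0 : R) 1 (fun t => refl_mx (g t)) D ->
    killing (refl_mx (g 0) *m D) (- q *m (refl_mx (g 0) *m D))
| killing0 : killing 0 0
| killing_lin k A b A' b' : killing A b -> killing A' b' ->
    killing (k *: A + A') (k *: b + b').

(** Differentiating [S^T = S] and [S^2 = 1] for [S = refl_mx (g t)] shows that [D] is symmetric and
    anticommutes with [refl_mx (g 0)], so the product is skew. *)
Lemma killing_skew A b : killing A b -> A^T = - A.
Proof.
elim=> [g q D [Xg dg ng] dD||k {}A {}b A' b' _ IH _ IH']; last 2 first.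
- by rewrite trmx0 oppr0.
- by rewrite linearP/= IH IH' opprD scalerN.
have DT : D^T = D.
  apply: (is_derive_unique (c := fun t => refl_mx (g t)) (t := 0) (v := 1)) => //.
  apply/is_derive_mxP => i j; rewrite mxE.
  rewrite (_ : (fun _ => _) = fun t => refl_mx (g t) j i).
    by move/is_derive_mxP: dD.
  by apply/funext => t; rewrite -{1}(refl_mx_tr sX (Xg t)) mxE.
have : D *m refl_mx (g 0) + refl_mx (g 0) *m D = 0.
  apply: is_derive_unique (is_derive_mulmx dD dD) _.
  rewrite (_ : (fun _ => _) = fun=> 1%:M); first exact: is_derive_constf.
  by apply/funext => t; rewrite (refl_mx_sqr sX).
by move/eqP; rewrite addr_eq0 => /eqP h; rewrite trmx_mul DT (refl_mx_tr sX).
Qed.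

(** Both reflections fix [q], so their product is linear around [q]. *)
Lemma killing_curve_derive g q D z : centred_curve g q ->
  is_derive (0 : R) 1 (fun t => refl_mx (g t)) D ->
  is_derive (0 : R) 1 (fun t => refl (g t) (refl (g 0) z))
    ((z - q) *m (refl_mx (g 0) *m D)).
Proof.
move=> cg dD.
rewrite (_ : (fun _ => _) = fun t =>
  q + ((z - q) *m refl_mx (g 0)) *m refl_mx (g t)); last first.
  apply/funext => t; rewrite !(centred_curve_refl _ _ cg).
  by congr (q + _ *m _); rewrite addrAC subrr add0r.
have := is_derive_addf (is_derive_constf q (0 : R) 1)
  (is_derive_mulmx (is_derive_constf ((z - q) *m refl_mx (g 0)) (0 : R) 1) dD).
by rewrite mul0mx !add0r mulmxA.
Qed.

(** A generator at [y] is the velocity of [refl (g t) (refl (g 0) y)], a curve in [X] through [y] at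
    time 0; tangent vectors form a linear space. *)
Lemma killing_tangent A b y : killing A b -> X y -> tangent_space X y (y *m A + b).
Proof.
move=> KA Xy; have [_ _ _ ht] := normal_projP sX Xy; apply/ht.
elim: KA => [g q D cg dD||k {}A {}b A' b' _ IH _ IH']; last 2 first.
- by rewrite mulmx0 addr0 mul0mx.
- rewrite mulmxDr -scalemxAr addrACA -scalerDr mulmxDl -scalemxAl IH IH'.
  by rewrite scaler0 addr0.
apply/ht; rewrite mulNmx -mulmxBl.
have [Xg _ _] := cg.
have r0 : refl (g 0) (refl (g 0) y) = y by rewrite (reflK sX).
rewrite -{1}r0.
apply: (velocity_tangent sX openT I _ (killing_curve_derive y cg dD)) => t _.
by do 2 apply: (refl_in sX clX coX) => //.
Qed.

(** Conjugation by the reflection at [y] turns the generator of [g], [q] into that of the reflected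
    curve and centre. This is the invariance asked for by [equivariant_zero_set]. *)
Lemma killing_conj A b y : killing A b -> X y ->
  killing (refl_mx y *m A *m refl_mx y)
    ((y *m A + b) *m refl_mx y - y *m (refl_mx y *m A *m refl_mx y)).
Proof.
move=> KA Xy; set S := refl_mx y.
have SS : S *m S = 1%:M := refl_mx_sqr sX Xy.
elim: KA => [g q D cg dD||k {}A {}b A' b' _ IH _ IH']; last 2 first.
- rewrite !mulmx0 mul0mx addr0 mulmx0 mul0mx subrr; exact: killing0.
- clearbody S; have := killing_lin k IH IH'; congr killing.
    by rewrite mulmxDr mulmxDl -scalemxAr -scalemxAl.
  rewrite !(mulmxDr, mulmxDl) -!(scalemxAr, scalemxAl).
  by apply/rowP => j; rewrite !mxE; ring.
have [Xg dg ng] := cg.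
have cg' : centred_curve (fun t => refl y (g t)) (refl y q).
  split=> [t||t]; first exact: (refl_in sX clX coX).
    by have := is_derive_refl X y (derivableP dg); case.
  rewrite reflB; apply: (refl_normal sX Xy (Xg t)) => //.
  exact: maps_everywhere.
have dD' : is_derive (0 : R) 1 (fun t => refl_mx (refl y (g t))) (S *m D *m S).
  rewrite (_ : (fun _ => _) = fun t => S *m refl_mx (g t) *m S); last first.
    by apply/funext => t; rewrite refl_mx_refl.
  apply: is_derive_mulmxr.
  have := is_derive_mulmx (is_derive_constf S (0 : R) 1) dD.
  by rewrite mul0mx add0r.
have := killing_curve cg' dD'.
rewrite refl_mx_refl// -/S; set T := refl_mx (g 0) *m D.
have -> : S *m refl_mx (g 0) *m S *m (S *m D *m S) = S *m T *m S.
  by rewrite -!mulmxA (mulmxA S S) SS mul1mx /T !mulmxA.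
congr killing; rewrite /refl -/S; clearbody S T.
have e (w : 'rV[R]_n) : w *m S *m (S *m T *m S) = w *m T *m S.
  by rewrite !mulmxA -(mulmxA w S S) SS mulmx1.
rewrite [LHS]mulNmx [in LHS]mulmxDl e mulmxBl mulmxBl mulmxDl !mulNmx.
by apply/rowP => j; rewrite !mxE; ring.
Qed.

Lemma joined_trig x : X x -> exists2 e : R, 0 < e & forall y z, X y -> X z ->
    `|y - x| < e -> `|z - x| < e -> exists (q : 'rV[R]_n) (g : R -> 'rV[R]_n),
      [/\ g 0 = y /\ g 1 = z, forall k, is_trig (fun t => g t 0 k), geodesic X setT g,
        (forall t, normal_space X (g t) (g t - q)) &
        forall s t, g (s - t) = refl (g s) (g (s + t))].
Proof.
move=> Xx; have [e e0 he] := local_joined sX Xx; exists e => // y z Xy Xz yx zx.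
have [I [c [gc I0 I1 c0 c1]]] := he y z Xy Xz yx zx.
have [q [g [cg tg gg Xg rg]]] := clifford_geodesic sX clX gc I0.
exists q, g; split => //; first by rewrite -!cg.
by move=> t; case: (Xg t).
Qed.

(* A constant Killing field [b] has constant inner product with the velocity of
   a geodesic; as trigonometric curves are bounded, geodesics stay orthogonal
   to [b], and so does [X]. *)
Lemma killing_inj b : X !=set0 -> killing 0 b -> b = 0.
Proof.
move=> [x Xx] Kb.
have tb y : X y -> tangent_space X y b.
  by move=> Xy; have := killing_tangent Kb Xy; rewrite mulmx0 add0r.
have [e e0 he] := joined_trig Xx.
have orth y : X y -> `|y - x| < e -> dot y b = dot x b.
  move=> Xy yx; have [|q [g [[gx gy] tg [_ _ _ sg gg] _ _]]] := he x y Xx Xy _ yx.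
    by rewrite subrr normr0.
  have dg (t : R) : is_derive t 1 (fun s => dot (g s) b) (dot (derive1 g t) b).
    apply: (is_derive_eq (is_derive_dot (smooth_derive1 sg 0 (I :
      setT t)) (is_derive_constf b t 1))).
    by rewrite dot0r addr0.
  have d2g (t : R) : is_derive t 1 (fun s => dot (derive1 g s) b) 0.
    apply: (is_derive_eq (is_derive_dot (smooth_derive1 sg 1 (I :
      setT t)) (is_derive_constf b t 1))).
    by have [Xgt ngt] := gg t I; rewrite dot0r addr0 dotC ngt//; exact: tb.
  pose k := dot (derive1 g 0) b.
  have kE (t : R) : dot (derive1 g t) b = k.
    exact: (is_derive0_cst (f := fun t => dot (derive1 g t) b) (I := setT)).
  have lin (t : R) : dot (g t) b = k * t + dot (g 0) b.
    have h : dot (g t) b - k * t = dot (g 0) b - k * 0.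
      apply: (is_derive0_cst (f := fun t => dot (g t) b - k * t) (I := setT)) => // s _.
      apply: (is_derive_eq (is_derive_subf (dg s) (is_derive_cmul k (is_derive_idf s)))).
      by rewrite kE mulr1 subrr.
    by rewrite -[LHS](subrK (k * t)) h mulr0 subr0 addrC.
  have k0 : k = 0.
    apply: (@is_trig_linear _ k (dot (g 0) b)).
    rewrite (_ : (fun _ => _) = fun t => \sum_j b 0 j * g t 0 j).
      by apply: is_trig_sum => j; exact: is_trigZ.
    by apply/funext => t; rewrite -lin; apply: eq_bigr => j _; rewrite mulrC.
  by rewrite -gy -gx lin k0 mul0r add0r.
(* [b] is itself the velocity at [x] of a curve of [X], along which the product with [b] is constant
   near time 0; so [dot b b = 0]. *)
have [eps [c [eps0 sc Xc c0 cv]]] := tb x Xx.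
have z0 : - eps < 0 < eps by rewrite oppr_lt0 eps0.
have dc : is_derive (0 : R) 1 c b by have := smooth_derive1 sc 0 z0; rewrite /= cv.
have [h h0 hh] := near_restrict (@open_oo R _ _) z0 e0 dc.
apply: dot_eq0.
have := is_derive_dot dc (is_derive_constf b (0 : R) 1); rewrite dot0r addr0 => d1.
apply: is_derive_unique d1 _.
have hz : 0 - h < 0 < 0 + h by rewrite sub0r add0r oppr_lt0 h0.
apply: (near_derive (@open_oo R _ _) hz _ (is_derive_constf (dot x b) (0 : R) 1)) => s hs.
have [Is cs] := hh s hs.
by rewrite orth//; [exact: Xc|rewrite -c0].
Qed.

(** [Z] is stable under reflections, so [refl (g t) (refl (g 0) ctr)] stays in [Z], and points of
    [Z] differ by vectors killed by [A]. Differentiating gives [(ctr - q) *m A *m A = 0]; as [A] is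
    skew, [(ctr - q) *m A = 0]. *)
Lemma centre_exists : X !=set0 -> exists ctr : 'rV[R]_n, forall g q D,
  centred_curve g q -> is_derive (0 : R) 1 (fun t => refl_mx (g t)) D ->
  (ctr - q) *m (refl_mx (g 0) *m D) = 0.
Proof.
move=> X0.
have [Z [[ctr Zo] Zdiff Zrefl]] := equivariant_zero_set killing0 killing_lin
  (fun b => killing_inj X0).
exists ctr => g q D cg dD; have [Xg _ _] := cg.
set A := refl_mx (g 0) *m D.
have KA : killing A (- q *m A) by exact: killing_curve.
have Zr y z : X y -> Z z -> Z (refl y z).
  move=> Xy; apply: Zrefl; [exact: (refl_mx_tr sX Xy)|exact: (refl_mx_sqr sX Xy)|].
  by move=> A' b' KA'; exact: killing_conj.
have hA : (ctr - q) *m A *m A = 0.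
  have h1 := is_derive_mulmxr A (killing_curve_derive ctr cg dD).
  apply: is_derive_unique h1 _.
  rewrite (_ : (fun _ => _) = fun=> ctr *m A); first exact: is_derive_constf.
  apply/funext => t; apply/eqP; rewrite -subr_eq0 -mulmxBl; apply/eqP.
  by apply: Zdiff KA => //; apply: (Zr) => //; apply: (Zr).
apply: dot_eq0; rewrite dot_mulmxl (killing_skew KA) mulmxN dotNr.
by rewrite hA dot0r oppr0.
Qed.

Lemma in_sphere : X !=set0 -> exists (ctr : 'rV[R]_n) (r : R), forall x, X x ->
  dot (x - ctr) (x - ctr) = r.
Proof.
move=> X0; have [p Xp] := X0; have [ctr ho] := centre_exists X0.
exists ctr, (dot (p - ctr) (p - ctr)).
apply: (connected_ind coX (P := fun x =>
  dot (x - ctr) (x - ctr) = dot (p - ctr) (p - ctr)) Xp) => // x Xx.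
have [e e0 he] := joined_trig Xx; exists e => // y z Xy Xz yx zx <-.
have [q [g [[<- <-] _ [_ _ _ sg gg] ng rg]]] := he y z Xy Xz yx zx.
apply: (is_derive0_cst (f := fun t => dot (g t - ctr) (g t - ctr)) (I := setT)) => // t _.
have dg (s : R) : is_derive s 1 g (derive1 g s) := smooth_derive1 sg 0 (I : setT s).
have dgo : is_derive t 1 (fun s => g s - ctr) (derive1 g t).
  by apply: (is_derive_eq (is_derive_subf (dg t) (is_derive_constf ctr t 1)));
    rewrite subr0.
apply: (is_derive_eq (is_derive_dot dgo dgo)); rewrite (dotC (g t - ctr)).
suff -> : dot (derive1 g t) (g t - ctr) = 0 by rewrite addr0.
(* Generators are taken at time 0, so time is shifted to put [g t] there. *)
pose gt s := g (t + s).
have dgt (s : R) : is_derive s 1 gt (derive1 g (t + s)).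
  have ds : is_derive s 1 (fun s => t + s) 1.
    by apply: (is_derive_eq (is_derive_addf (is_derive_constf t s 1) (is_derive_idf
      s))); rewrite add0r.
  have dgd : differentiable g (t + s) by apply/derivable1_diffP; case: (dg (t + s)).
  apply: (is_derive_eq (is_derive_chain (c := fun s : R => t + s) dgd ds)).
  by rewrite -deriveE// -derive1E.
have cgt : centred_curve gt q.
  split=> [s||s]; [by case: (gg (t + s) I)|by case: (dgt 0)|exact: ng].
have [Xgt _ _] := cgt.
have [N' dN] := normal_proj_derivable sX openT (I : setT (0 : R)) (fun s _ =>
  Xgt s) (dgt 0).
have [D dD] : exists D, is_derive (0 : R) 1 (fun s => refl_mx (gt s)) D.
  exists (N' + N' - 0); rewrite /refl_mx.
  rewrite (_ : (fun _ => _) = fun s =>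
    normal_proj X (gt s) + normal_proj X (gt s) - 1%:M).
    exact: (is_derive_subf (is_derive_addf dN dN) (is_derive_constf _ _ _)).
  by apply/funext => s; rewrite mulr2n.
set A := refl_mx (gt 0) *m D.
have AT : A^T = - A by apply: killing_skew; exact: killing_curve cgt dD.
(* The reflection at [gt 0] fixes [gt 0], and the one at [gt s] sends it to [gt (2 * s)]; so the
   generator at [g t] is twice the velocity. *)
have h1 : is_derive (0 : R) 1 (fun s => gt (2 * s)) ((gt 0 - q) *m A).
  have := killing_curve_derive (gt 0) cgt dD; congr is_derive.
  apply/funext => s; rewrite /refl subrr mul0mx addr0 /gt.
  have := rg (t + s) (- s); rewrite opprK addrK -/(refl _ _) addr0 => <-.
  by congr g; ring.
have h2 : is_derive (0 : R) 1 (fun s => gt (2 * s)) (2 *: derive1 g t).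
  have d2 := is_derive_cmul 2 (is_derive_idf (0 : R)).
  have dgd : differentiable gt (2 * 0 : R) by apply/derivable1_diffP; case: (dgt (2 * 0)).
  apply: (is_derive_eq (is_derive_chain dgd d2)).
  rewrite [2 * 1](_ : _ = 2 *: (1 : R))// linearZ/= -deriveE//.
  by case: (dgt (2 * 0)) => _ ->; rewrite mulr0 addr0.
have e1 := is_derive_unique h2 h1.
(* The generator also vanishes at [ctr]; centred there it is skew, hence orthogonal to the
   radius. *)
have e2 : (gt 0 - q) *m A = (gt 0 - ctr) *m A.
  rewrite -(subrKA ctr) mulmxDl.
  by rewrite (ho _ _ _ cgt dD) addr0.
have gtE : gt 0 = g t by rewrite /gt addr0.
have n2 : (2 : R) != 0 by rewrite pnatr_eq0.
apply: (mulfI n2); rewrite mulr0 -dotZl e1 e2 gtE.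
have : dot ((g t - ctr) *m A) (g t - ctr) = - dot ((g t - ctr) *m A) (g t - ctr).
  by rewrite {1}dot_mulmxl AT mulmxN dotNr dotC.
move=> /eqP; rewrite -addr_eq0 -mulr2n mulrn_eq0 /= => /eqP; exact.
Qed.

Lemma compact_clifford_type : compact X.
Proof.
have [->|/set0P X0] := eqVneq X set0; first exact: compact0.
apply: bounded_closed_compact; last exact: (closed_clifford_type sX clX coX).
have [ctr [r hr]] := in_sphere X0.
have r0 : 0 <= r by have [x Xx] := X0; rewrite -(hr x Xx) dot_ge0.
exists (`|ctr| + Num.sqrt r); split; first exact: num_real.
move=> M hM x Xx; apply: le_trans (ltW hM).
rewrite -[x](subrK ctr) addrC (le_trans (ler_normD _ _))// lerD2l.
by apply: norm_le_dot; rewrite ?sqrtr_ge0// sqr_sqrtr// hr.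
Qed.

End Bounded.

Theorem proposition2p2 (R : realType) (n : nat) (X : set 'rV[R]_n) :
  submanifold X -> connected X -> clifford_type X ->
  compact X /\ extrinsically_symmetric X.
Proof.
move=> [d sX] coX clX; split; first exact: compact_clifford_type sX clX coX.
exact: extrinsically_symmetric_refl sX clX coX.
Qed.
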